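(* Let $F(x,y)=\sqrt{g_x(y,y)}+g(X(x),y)$ be an arbitrary left invariant Randers metric of Berwald type on any simply connected three-dimensional real Lie group $G$, where $g$ is a left invariant Riemannian metric and $X$ is a left invariant vector field on $G$ with $\|X\|_g<1$. Then the six-dimensional tangent Lie group $TG$ admits a left invariant Randers metric of Berwald type of the form $F^v$, where $F^v((x,y),\widetilde z)=\sqrt{\widetilde g(\widetilde z,\widetilde z)}+\widetilde g(X^v(x,y),\widetilde z)$ for $x\in G$, $y\in T_xG$, $\widetilde z\in T_{(x,y)}TG$, if and only if $G$ is one of the following two cases, given as the simply connected Lie groups whose Lie algebra has a basis $\{W,Y,Z\}$ with the stated brackets: Case 1: $[W,Y]=0$, $[W,Z]=0$, $[Y,Z]=0$ (the group $\mathbb R^3$); Case 2: $[W,Y]=0$, $[W,Z]=-Y$, $[Y,Z]=-2Y$ (the nonunimodular group $G_0$).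
   Context: Lifts. For a vector field $X$ on $G$ with flow $\phi_t$, the complete lift $X^c$ and the vertical lift $X^v$ are the vector fields on $TG$ that are the infinitesimal generators of $y\mapsto (T_x\phi_t)(y)$ and $y\mapsto y+tX(x)$ ($y\in T_xG$), respectively. They satisfy $[X^v,Y^v]=0$, $[X^c,Y^c]=[X,Y]^c$, $[X^v,Y^c]=[X,Y]^v$. Tangent Lie group. $TG$ is a Lie group whose multiplication is the tangent map of the multiplication of $G$: $(v,w)\mapsto T_yl_x w+T_xr_y v$ for $v\in T_xG$, $w\in T_yG$ ($l$, $r$ left and right translations). If $X$ is left invariant on $G$, then $X^c,X^v$ are left invariant on $TG$; if $\{X_i\}$ is a basis of the Lie algebra of $G$, then $\{X_i^c\}\cup\{X_i^v\}$ is a basis of the Lie algebra of $TG$. Lifted metric. Given a left invariant Riemannian metric $g$ on $G$, $\widetilde g$ is the left invariant Riemannian metric on $TG$ with $\widetilde g(X^c,Y^c)=\widetilde g(X^v,Y^v)=g(X,Y)$ and $\widetilde g(X^c,Y^v)=0$ for all left invariant vector fields $X,Y$ on $G$. Randers metrics. A Randers metric on a manifold $M$ is a Finsler metric $F(x,y)=\sqrt{g_x(y,y)}+g(X(x),y)$ with $g$ Riemannian and $X$ a vector field with $\|X\|_g=\sqrt{g(X,X)}<1$. It is of Berwald type if $X$ is parallel with respect to the Levi-Civita connection of $g$. (For $F^v$ on $TG$: $X^v$ is parallel for the Levi-Civita connection of $\widetilde g$.) The simply connected three-dimensional real Lie groups admitting (left invariant) Randers metrics of Berwald type are listed as the two groups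 in the claim and a Case 3, $[W,Y]=0$, $[W,Z]=Y$, $[Y,Z]=-W$ (the solvable Lie group $\widetilde{E_0}(2)$), together with the following data for $g$ (matrix in the basis $W,Y,Z$) and $X$. Case 1: $g$ is the identity matrix, $X=pW+qY+rZ$ with $\sqrt{p^2+q^2+r^2}<1$. Case 2: $g=\begin{pmatrix}1&\frac12&0\\ \frac12&1&0\\ 0&0&\nu\end{pmatrix}$ with $\nu>0$, $X=-2pW+pY$ with $|p|<\frac{\sqrt3}{3}$. Case 3: $g=\mathrm{diag}(1,1,\nu)$ with $\nu>0$, $X=pZ$ with $|p|<\frac{1}{\sqrt\nu}$.
   Formalization: The vector field X is assumed not identically zero (F non-Riemannian): for X = 0 the metric F^v is Riemannian and trivially of Berwald type on every TG, so the claim fails, e.g. for the group of Case 3 with p = 0. *)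

(* Defs.v *)
From HB Require Import structures.
From mathcomp Require Import all_boot all_order all_algebra.
From mathcomp Require Import all_classical all_reals all_analysis.

Set Implicit Arguments.
Unset Strict Implicit.
Unset Printing Implicit Defensive.

Import Order.TTheory GRing.Theory Num.Theory.
Import numFieldNormedType.Exports.

Local Open Scope classical_set_scope.
Local Open Scope ring_scope.

(** * Smooth manifolds

    A manifold modelled on a (finite-dimensional) normed space [V] is a type of
    points with a set of injective local parametrizations, defined on open
    subsets of [V], with smooth changes of coordinates.  The products and
    tangent bundles of such manifolds are modelled on [V * W] and [V * V]. *)

(** All iterated directional derivatives of [h] are differentiable near [u];
    in finite dimension this says that [h] is C^oo on a neighbourhood of [u]. *)
Definition smooth_near (R : realType) (V W : normedModType R) (h : V -> W)
    (u : V) : Prop :=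
  \forall v \near u, forall s : seq V,
    differentiable (foldr (fun w (k : V -> W) z => 'D_w k z) h s) v.

(** [cpar] is only meaningful on [cdom]. *)
Record chart (R : realType) (V : normedModType R) (T : Type) := Chart {
  cdom : set V;
  cpar : V -> T }.

Record mfd (R : realType) (V : normedModType R) := Mfd {
  pt :> Type;
  atlas : set (chart V pt) }.

(** [P] holds at all points near [x]. *)
Definition mnear (R : realType) (V : normedModType R) (M : mfd V) (x : M)
    (P : M -> Prop) : Prop :=
  exists c u, [/\ atlas c, cdom c u, cpar c u = x &
                  \forall v \near u, P (cpar c v)].

Definition mopen (R : realType) (V : normedModType R) (M : mfd V)
    (A : set M) : Prop :=
  forall c, atlas c -> open [set u | cdom c u /\ A (cpar c u)].

Definition mcontinuous (R : realType) (V : normedModType R) (M : mfd V)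
    (T : topologicalType) (f : T -> M) : Prop :=
  forall A, mopen A -> open (f @^-1` A).

Record is_manifold (R : realType) (V : normedModType R) (M : mfd V) : Prop := {
  mfd_open : forall c : chart V M, atlas c -> open (cdom c);
  mfd_inj : forall (c : chart V M) u v, atlas c -> cdom c u -> cdom c v ->
    cpar c u = cpar c v -> u = v;
  mfd_compat : forall (c d : chart V M) u v, atlas c -> atlas d ->
    cdom c u -> cdom d v -> cpar c u = cpar d v ->
    exists tau : V -> V, [/\ smooth_near tau u, tau u = v &
      \forall u' \near u, cdom d (tau u') /\ cpar d (tau u') = cpar c u'];
  mfd_hausdorff : forall x y : M, x <> y ->
    exists A B : set M,
      [/\ mopen A, mopen B, A x, B y & A `&` B = set0];
  (* second countability, including the fact that the atlas covers *)
  mfd_countable : exists s : nat -> chart V M, (forall k, atlas (s k)) /\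
    forall x : M, exists k u, cdom (s k) u /\ cpar (s k) u = x }.

Definition line_mfd (R : realType) : mfd R^o :=
  {| pt := R; atlas := [set Chart (V := R^o) setT (fun t => t : R)] |}.

Definition prod_mfd (R : realType) (V W : normedModType R) (M : mfd V)
    (N : mfd W) : mfd (V * W)%type :=
  {| pt := (M * N)%type;
     atlas := [set e | exists (c : chart V M) (d : chart W N),
       [/\ atlas c, atlas d &
           e = Chart (V := (V * W)%type)
                     [set uv | cdom c uv.1 /\ cdom d uv.2]
                     (fun uv => (cpar c uv.1, cpar d uv.2))]] |}.

(** [f] is C^oo on a neighbourhood of [x]. *)
Definition smooth_at (R : realType) (V : normedModType R) (M : mfd V)
    (f : M -> R) (x : M) : Prop :=
  exists c u, [/\ atlas c, cdom c u, cpar c u = x &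
                  smooth_near (f \o cpar c : V -> R^o) u].

(** A map is smooth (near [x]) iff it pulls smooth germs of functions back to
    smooth germs; as the germs have arbitrary values away from the base point,
    this includes continuity. *)
Definition smooth_map_at (R : realType) (V W : normedModType R) (M : mfd V)
    (N : mfd W) (F : M -> N) (x : M) : Prop :=
  forall f : N -> R, smooth_at f (F x) -> smooth_at (f \o F) x.

Definition smooth_map (R : realType) (V W : normedModType R) (M : mfd V)
    (N : mfd W) (F : M -> N) : Prop :=
  forall x, smooth_map_at F x.

(** All loops and homotopies on [[0, 1]] extend continuously to the real line
    and to the plane, by clamping, so that the latter serve as sources. *)
Definition simply_connected (R : realType) (V : normedModType R) (M : mfd V) :
    Prop :=
  (forall x y : M, exists gam : R -> M,
     [/\ mcontinuous gam, gam 0 = x & gam 1 = y]) /\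
  (forall gam : R -> M, mcontinuous gam -> gam 0 = gam 1 ->
     exists H : (R * R)%type -> M,
     [/\ mcontinuous H,
         forall t, 0 <= t <= 1 -> H (0, t) = gam t,
         forall t, 0 <= t <= 1 -> H (1, t) = gam 0 &
         forall s, 0 <= s <= 1 -> H (s, 0) = gam 0 /\ H (s, 1) = gam 0]).

(** * Tangent vectors and vector fields

    A tangent vector at [x] is identified with the directional derivative it
    defines on the functions that are smooth near [x]; it is extended by the
    value 0 to all other functions, so that equality of tangent vectors is
    equality. *)

Definition tfun (R : realType) (V : normedModType R) (M : mfd V) : Type :=
  (M -> R) -> R^o.

Definition tvec (R : realType) (V : normedModType R) (M : mfd V)
    (c : chart V M) (u w : V) : tfun M :=
  fun f => if `[< smooth_at f (cpar c u) >]
           then 'D_w (f \o cpar c : V -> R^o) u else 0.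

Definition tangent (R : realType) (V : normedModType R) (M : mfd V) (x : M)
    (v : tfun M) : Prop :=
  exists c u w, [/\ atlas c, cdom c u, cpar c u = x & v = tvec c u w].

(** The tangent map of [F] at [x]. *)
Definition tmap (R : realType) (V W : normedModType R) (M : mfd V)
    (N : mfd W) (F : M -> N) (x : M) (v : tfun M) : tfun N :=
  fun f => if `[< smooth_at f (F x) >] then v (f \o F) else 0.

Definition velocity (R : realType) (V : normedModType R) (M : mfd V)
    (gam : R -> M) (t : R) : tfun M :=
  fun f => if `[< smooth_at f (gam t) >]
           then 'D_1 (f \o gam : R^o -> R^o) t else 0.

Definition vfield (R : realType) (V : normedModType R) (M : mfd V) : Type :=
  M -> tfun M.

Definition is_vfield (R : realType) (V : normedModType R) (M : mfd V)
    (X : vfield M) : Prop :=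
  forall c, atlas c -> exists w : V -> V, forall u, cdom c u ->
    smooth_near w u /\ X (cpar c u) = tvec c u (w u).

Definition vadd (R : realType) (V : normedModType R) (M : mfd V)
    (X Y : vfield M) : vfield M := fun x f => X x f + Y x f.

Definition vmul (R : realType) (V : normedModType R) (M : mfd V)
    (h : M -> R) (X : vfield M) : vfield M := fun x f => h x * X x f.

Definition vscale (R : realType) (V : normedModType R) (M : mfd V)
    (a : R) (X : vfield M) : vfield M := vmul (fun _ => a) X.

Definition vzero (R : realType) (V : normedModType R) (M : mfd V) : vfield M :=
  fun _ _ => 0.
Arguments vzero {R V} M.

(** [X f] *)
Definition vapp (R : realType) (V : normedModType R) (M : mfd V)
    (X : vfield M) (f : M -> R) : M -> R := fun x => X x f.

Definition bracket (R : realType) (V : normedModType R) (M : mfd V)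
    (X Y : vfield M) : vfield M :=
  fun x f => if `[< smooth_at f x >]
             then X x (vapp Y f) - Y x (vapp X f) else 0.

(** [phi] is, around [x] and for small times, the flow of [X]. *)
Definition is_local_flow (R : realType) (V : normedModType R) (M : mfd V)
    (X : vfield M) (phi : R -> M -> M) (x : M) : Prop :=
  [/\ smooth_map_at (M := prod_mfd (line_mfd R) M) (fun p => phi p.1 p.2)
        (0, x),
      mnear x (fun y => phi 0 y = y) &
      mnear (M := prod_mfd (line_mfd R) M) (0, x) (fun p =>
        velocity (phi^~ p.2) p.1 = X (phi p.1 p.2))].

(** * Riemannian metrics, the Levi-Civita connection, Randers metrics *)

Definition metric (R : realType) (V : normedModType R) (M : mfd V) : Type :=
  M -> tfun M -> tfun M -> R.

Record is_riemannian (R : realType) (V : normedModType R) (M : mfd V)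
    (g : metric M) : Prop := {
  riem_add : forall x v w z, tangent x v -> tangent x w -> tangent x z ->
    g x (fun f => v f + w f) z = g x v z + g x w z;
  riem_scale : forall x (a : R) v z, tangent x v -> tangent x z ->
    g x (fun f => a * v f) z = a * g x v z;
  riem_sym : forall x v z, tangent x v -> tangent x z -> g x v z = g x z v;
  riem_pos : forall x v, tangent x v -> v <> (fun _ => 0) -> 0 < g x v v;
  riem_smooth : forall c u w z, atlas c -> cdom c u ->
    smooth_near
      (fun u' => g (cpar c u') (tvec c u' w) (tvec c u' z) : R^o) u }.

Definition minner (R : realType) (V : normedModType R) (M : mfd V)
    (g : metric M) (X Y : vfield M) : M -> R := fun x => g x (X x) (Y x).

Record is_connection (R : realType) (V : normedModType R) (M : mfd V)
    (nabla : vfield M -> vfield M -> vfield M) : Prop := {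
  conn_vfield : forall X Y, is_vfield X -> is_vfield Y ->
    is_vfield (nabla X Y);
  conn_addl : forall X X' Y, is_vfield X -> is_vfield X' -> is_vfield Y ->
    nabla (vadd X X') Y = vadd (nabla X Y) (nabla X' Y);
  conn_mull : forall f X Y, (forall x, smooth_at f x) ->
    is_vfield X -> is_vfield Y ->
    nabla (vmul f X) Y = vmul f (nabla X Y);
  conn_addr : forall X Y Y', is_vfield X -> is_vfield Y -> is_vfield Y' ->
    nabla X (vadd Y Y') = vadd (nabla X Y) (nabla X Y');
  conn_leibniz : forall f X Y, (forall x, smooth_at f x) ->
    is_vfield X -> is_vfield Y ->
    nabla X (vmul f Y) = vadd (vmul (vapp X f) Y) (vmul f (nabla X Y)) }.

Record is_levi_civita (R : realType) (V : normedModType R) (M : mfd V)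
    (g : metric M) (nabla : vfield M -> vfield M -> vfield M) : Prop := {
  lc_connection : is_connection nabla;
  lc_torsion : forall X Y, is_vfield X -> is_vfield Y ->
    nabla X Y = vadd (nabla Y X) (bracket X Y);
  lc_metric : forall X Y Z x, is_vfield X -> is_vfield Y -> is_vfield Z ->
    vapp Z (minner g X Y) x
    = minner g (nabla Z X) Y x + minner g X (nabla Z Y) x }.

(** [X] is parallel for the Levi-Civita connection of [g]. *)
Definition is_parallel (R : realType) (V : normedModType R) (M : mfd V)
    (g : metric M) (X : vfield M) : Prop :=
  exists2 nabla, is_levi_civita g nabla &
    forall Y, is_vfield Y -> nabla Y X = vzero M.

Definition randers (R : realType) (V : normedModType R) (M : mfd V)
    (g : metric M) (X : vfield M) : M -> tfun M -> R :=
  fun x y => Num.sqrt (g x y y) + g x (X x) y.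

(** [F] is the Randers metric given by [g] and [X]; the bound on the norm of
    [X] is what makes [F] positive and strongly convex, i.e. Finsler. *)
Definition is_randers (R : realType) (V : normedModType R) (M : mfd V)
    (F : M -> tfun M -> R) (g : metric M) (X : vfield M) : Prop :=
  [/\ is_riemannian g, is_vfield X,
      forall x, Num.sqrt (g x (X x) (X x)) < 1 &
      forall x y, tangent x y -> F x y = randers g X x y].

(** * Lie groups *)

Record is_lie_group (R : realType) (V : normedModType R) (G : mfd V)
    (mul : G -> G -> G) (inv : G -> G) (one : G) : Prop := {
  lie_mfd : is_manifold G;
  lie_mulA : forall x y z, mul x (mul y z) = mul (mul x y) z;
  lie_mul1 : forall x, mul one x = x /\ mul x one = x;
  lie_mulV : forall x, mul (inv x) x = one /\ mul x (inv x) = one;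
  lie_smooth_mul : smooth_map (M := prod_mfd G G) (fun p => mul p.1 p.2);
  lie_smooth_inv : smooth_map inv }.

Definition left_invariant_vfield (R : realType) (V : normedModType R)
    (G : mfd V) (mul : G -> G -> G) (X : vfield G) : Prop :=
  is_vfield X /\ forall a x, tmap (mul a) x (X x) = X (mul a x).

Definition left_invariant_metric (R : realType) (V : normedModType R)
    (G : mfd V) (mul : G -> G -> G) (g : metric G) : Prop :=
  forall a x v w, tangent x v -> tangent x w ->
    g (mul a x) (tmap (mul a) x v) (tmap (mul a) x w) = g x v w.

(** [F] is the left invariant Randers metric of Berwald type given by the left
    invariant [g] and [X]. *)
Definition left_invariant_randers_berwald (R : realType)
    (V : normedModType R) (G : mfd V) (mul : G -> G -> G)
    (F : G -> tfun G -> R) (g : metric G) (X : vfield G) : Prop :=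
  [/\ is_randers F g X, left_invariant_metric mul g,
      left_invariant_vfield mul X & is_parallel g X].

(** [W], [Y], [Z] is a basis of the Lie algebra of left invariant vector
    fields. *)
Definition lie_algebra_basis (R : realType) (V : normedModType R) (G : mfd V)
    (mul : G -> G -> G) (W Y Z : vfield G) : Prop :=
  let comb (a b c : R) :=
    vadd (vscale a W) (vadd (vscale b Y) (vscale c Z)) in
  [/\ left_invariant_vfield mul W, left_invariant_vfield mul Y,
      left_invariant_vfield mul Z,
      forall a b c, comb a b c = vzero G -> [/\ a = 0, b = 0 & c = 0] &
      forall X, left_invariant_vfield mul X -> exists a b c, X = comb a b c].

(** [R^3] *)
Definition lie_case1 (R : realType) (V : normedModType R) (G : mfd V)
    (mul : G -> G -> G) : Prop :=
  simply_connected G /\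
  exists W Y Z, [/\ lie_algebra_basis mul W Y Z, bracket W Y = vzero G,
                    bracket W Z = vzero G & bracket Y Z = vzero G].

(** The nonunimodular group [G_0]. *)
Definition lie_case2 (R : realType) (V : normedModType R) (G : mfd V)
    (mul : G -> G -> G) : Prop :=
  simply_connected G /\
  exists W Y Z, [/\ lie_algebra_basis mul W Y Z, bracket W Y = vzero G,
                    bracket W Z = vscale (- 1) Y &
                    bracket Y Z = vscale (- 2) Y].

(** * The tangent bundle, lifts and the tangent Lie group *)

Definition tpoint (R : realType) (V : normedModType R) (M : mfd V) : Type :=
  {p : M * tfun M | `[< tangent p.1 p.2 >]}.

(** [tpt p0 x v] is the point of the tangent bundle given by a vector [v] that
    is tangent at [x]; the junk value is [p0] when it is not. *)
Definition tpt (R : realType) (V : normedModType R) (M : mfd V)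
    (p0 : tpoint M) (x : M) (v : tfun M) : tpoint M := insubd p0 (x, v).

Definition tangent_bundle (R : realType) (V : normedModType R) (M : mfd V) :
    mfd (V * V)%type :=
  {| pt := tpoint M;
     atlas := [set d | exists (c : chart V M) (p0 : tpoint M), atlas c /\
       d = Chart (V := (V * V)%type) [set uw | cdom c uw.1]
                 (fun uw => tpt p0 (cpar c uw.1) (tvec c uw.1 uw.2))] |}.

Definition tbase (R : realType) (V : normedModType R) (M : mfd V)
    (p : tangent_bundle M) : M := (val (p : tpoint M)).1.

Definition tfib (R : realType) (V : normedModType R) (M : mfd V)
    (p : tangent_bundle M) : tfun M := (val (p : tpoint M)).2.

(** The generator of [y |-> y + t X(x)]. *)
Definition vertical_lift (R : realType) (V : normedModType R) (M : mfd V)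
    (X : vfield M) : vfield (tangent_bundle M) :=
  fun p => velocity (M := tangent_bundle M)
    (fun t => tpt p (tbase p) (fun f => tfib p f + t * X (tbase p) f)) 0.

(** [Xc] is the generator of [y |-> (T_x phi_t)(y)] for the (unique, always
    existing) germs of flows [phi] of [X]. *)
Definition is_complete_lift (R : realType) (V : normedModType R) (M : mfd V)
    (X : vfield M) (Xc : vfield (tangent_bundle M)) : Prop :=
  forall (p : tangent_bundle M) (phi : R -> M -> M),
    is_local_flow X phi (tbase p) ->
    Xc p = velocity (M := tangent_bundle M)
      (fun t => tpt p (phi t (tbase p)) (tmap (phi t) (tbase p) (tfib p))) 0.

(** [(x, v) (y, w) = (x y, T l_x w + T r_y v)] *)
Definition tangent_mul (R : realType) (V : normedModType R) (G : mfd V)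
    (mul : G -> G -> G) (p q : tangent_bundle G) : tangent_bundle G :=
  tpt p (mul (tbase p) (tbase q))
    (fun f => tmap (mul (tbase p)) (tbase q) (tfib q) f
            + tmap (mul^~ (tbase q)) (tbase p) (tfib p) f).

Record is_lifted_metric (R : realType) (V : normedModType R) (G : mfd V)
    (mul : G -> G -> G) (g : metric G) (gt : metric (tangent_bundle G)) :
    Prop := {
  lifted_riemannian : is_riemannian gt;
  lifted_left_invariant : left_invariant_metric (tangent_mul mul) gt;
  lifted_cc : forall X Y Xc Yc p,
    left_invariant_vfield mul X -> left_invariant_vfield mul Y ->
    is_complete_lift X Xc -> is_complete_lift Y Yc ->
    minner gt Xc Yc p = minner g X Y (tbase p);
  lifted_vv : forall X Y p,
    left_invariant_vfield mul X -> left_invariant_vfield mul Y ->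
    minner gt (vertical_lift X) (vertical_lift Y) p
    = minner g X Y (tbase p);
  lifted_cv : forall X Y Xc p,
    left_invariant_vfield mul X -> left_invariant_vfield mul Y ->
    is_complete_lift X Xc ->
    minner gt Xc (vertical_lift Y) p = 0 }.

Definition randers_v (R : realType) (V : normedModType R) (G : mfd V)
    (gt : metric (tangent_bundle G)) (X : vfield G) :
    tangent_bundle G -> tfun (tangent_bundle G) -> R :=
  randers gt (vertical_lift X).

(* Main.v *)
(* Let [X] be the given parallel field on [G].  For left invariant fields, the
   Koszul formula shows that a left invariant field is parallel iff it is
   orthogonal to all brackets and its adjoint action is skew.  On [TG] the
   relations [X^v,Y^c] = [X,Y]^v and [X^v,Y^v] = 0 turn the skewness of
   [X^v], tested on a pair (Y^c, Z^v), into g([X,Y],Z) = 0: hence X^v is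
   parallel iff [X] is central.  Conversely, if [X] is central, an explicit
   Levi-Civita connection is given by constant Christoffel symbols in the
   orthonormal frame of complete and vertical lifts.

   Finally, if [X] is central and orthogonal to the derived algebra, the plane
   orthogonal to [X] is a two-dimensional Lie algebra: it is either abelian
   (case 1) or that of the affine group of the line (case 2).  In case 2 the
   image of ad X lies in the line of [Y], and its skewness makes it vanish.

   Tangent vectors of [TG] are determined by their action on the functions
   f o pi and df.  Complete lifts are written in charts as (y, Dy), which
   agrees with the generator of the tangent flow by the symmetry of second
   derivatives; the existence of flows plays no role. *)

Require Import Defs.
From HB Require Import structures.
From mathcomp Require Import all_boot all_order all_algebra.
From mathcomp Require Import all_classical all_reals all_analysis.
From mathcomp Require Import ring lra.

Set Implicit Arguments.
Unset Strict Implicit.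
Unset Printing Implicit Defensive.

Import Order.TTheory GRing.Theory Num.Theory.
Import numFieldNormedType.Exports.

Local Open Scope classical_set_scope.
Local Open Scope ring_scope.

(** * Calculus in finite-dimensional normed spaces *)

Section Calculus.
Context {R : realType}.
Implicit Types U V W : normedModType R.

(** The theorem takes [X] nonzero because otherwise its vertical lift is zero, hence parallel over
    every group, and the classification would fail. Being nonzero also lets [X] be normalised to the
    first vector of an orthonormal frame. Tangent vectors are functionals on all real functions,
    with value 0 off the smooth germs. Linearity and the Leibniz rule in the function argument hold
    only for germs smooth at the base point, so identities between fields often split into a smooth
    case and a case where both sides are 0. The model spaces are row vectors, the line and their
    products; hence the calculus for normed spaces with a finite continuous coordinate system
    ([findim]). Coordinates turn a derivative in a variable direction into a finite sum of products,
    which is how compositions, brackets and complete lifts are shown to be smooth. From a parallel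
    field only zero torsion and metric compatibility of the given connection are used. To prove a
    lift parallel, a connection on all fields of TG must be produced; a global orthonormal frame
    with constant structure constants gives one without chart formulas. *)

Lemma nearP U (u : U) (P : U -> Prop) :
  (\forall v \near u, P v) <-> exists A : set U, [/\ open A, A u & A `<=` P].
Proof.
change (nbhs u P <-> exists A : set U, [/\ open A, A u & A `<=` P]).
rewrite nbhsE; split=> [[A [oA Au] AP]|[A [oA Au AP]]]; by exists A.
Qed.

Lemma near_near U (u : U) (P : U -> Prop) :
  (\forall v \near u, P v) -> \forall v \near u, \forall w \near v, P w.
Proof.
move=> /nearP[A [oA Au AP]]; apply/nearP; exists A; split=> // v Av.
by apply/nearP; exists A.
Qed.

(** The difference [g - f] vanishes near [u], so it is [o(h)] with differential 0, and [g] is the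
    sum of [f] and this difference. *)
Lemma differentiable_near_eq U V (f g : U -> V) u :
  (\forall v \near u, f v = g v) -> differentiable f u -> differentiable g u.
Proof.
move=> fg df.
have fgu : f u = g u := nbhs_singleton fg.
pose d := g - f.
have dd : differentiable d u.
  have Hd : d \o shift u = cst (d u) + (\0 : U -> V) +o_ 0 id.
    apply/eqaddoP => e e0.
    have : \forall h \near (0 : U), f (h + u) = g (h + u).
      have c : (fun h : U => h + u) @ (0 : U) --> u.
        by rewrite -[X in _ --> X]add0r; apply: cvgD; [exact: cvg_id|exact: cvg_cst].
      exact: c _ fg.
    apply: filter_app; near=> h => H.
    rewrite /= /d !fctE /= H fgu !subrr addr0 subr0 normr0.
    by rewrite mulr_ge0 // ltW.
  have H0 : continuous (\0 : U -> V) by move=> x; exact: cvg_cst.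
  apply/diff_locallyP.
  have E : 'd d u = (\0 : U -> V) :> (U -> V).
    exact: (@diff_unique _ _ _ _ \0 _ H0 Hd).
  by rewrite E; split.
have -> : g = f + d by rewrite /d addrC subrK.
exact: differentiableD.
Unshelve. all: by end_near. Qed.

Lemma deriveDir U V (f : U -> V) u (a b : U) (k : R) : differentiable f u ->
  'D_(k *: a + b) f u = k *: 'D_a f u + 'D_b f u.
Proof. by move=> df; rewrite !deriveE // linearP. Qed.

Lemma deriveDirD U V (f : U -> V) u (a b : U) : differentiable f u ->
  'D_(a + b) f u = 'D_a f u + 'D_b f u.
Proof. by move=> df; rewrite !deriveE // linearD. Qed.

Lemma deriveDirZ U V (f : U -> V) u (a : U) (k : R) : differentiable f u ->
  'D_(k *: a) f u = k *: 'D_a f u.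
Proof. by move=> df; rewrite !deriveE // linearZ. Qed.

Lemma deriveDir_sum U V (f : U -> V) u n (a : 'I_n -> U) : differentiable f u ->
  'D_(\sum_i a i) f u = \sum_i 'D_(a i) f u.
Proof.
by move=> df; rewrite deriveE // linear_sum; apply: eq_bigr => i _; rewrite deriveE.
Qed.

Lemma derive_chain U V W (f : U -> V) (g : V -> W) u w :
  differentiable f u -> differentiable g (f u) ->
  'D_w (g \o f) u = 'D_('D_w f u) g (f u).
Proof.
move=> df dg; rewrite deriveE; last exact: differentiable_comp.
by rewrite diff_comp //= !deriveE.
Qed.

Lemma derive_lin U V (f : {linear U -> V}) u w : continuous f -> 'D_w f u = f w.
Proof. by move=> fc; rewrite deriveE ?diff_lin //; exact: linear_differentiable. Qed.

Lemma derive_linpost U V W (f : U -> V) (L : {linear V -> W}) u w : continuous L ->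
  differentiable f u -> 'D_w (L \o f) u = L ('D_w f u).
Proof.
by move=> Lc df; rewrite derive_chain ?derive_lin //; exact: linear_differentiable.
Qed.

(** Scaling in curried form, as the differentiation rules for bilinear maps expect it; this yields
    the product rule for a scalar function times a vector function. *)
Let scaleb V := fun (a : R^o) (v : V) => a *: v.

Lemma scaleb_bilinear V : bilinear_for
    (GRing.Scale.Law.clone _ _ *:%R _) (GRing.Scale.Law.clone _ _ *:%R _)
    (@scaleb V).
Proof.
split=> [u'|u] a x y /=.
- by rewrite /scaleb scalerDl scalerA.
- by rewrite /scaleb scalerDr !scalerA mulrC.
Qed.
HB.instance Definition _ V := bilinear_isBilinear.Build R R^o V V _ _ (@scaleb V)
  (@scaleb_bilinear V).

Lemma is_diff_scaleb V (p : R^o * V) :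
  is_diff p (fun q => q.1 *: q.2 : V) (fun q => p.1 *: q.2 + q.1 *: p.2).
Proof.
have c : continuous (fun q : R^o * V => scaleb q.1 q.2).
  exact: scale_continuous.
apply: DiffDef; first exact: (differentiable_bilin (f := @scaleb V)).
exact: (diff_bilin (f := @scaleb V)).
Qed.

Lemma is_diff_scale U V (h : U -> R^o) (k : U -> V) u :
  differentiable h u -> differentiable k u ->
  is_diff u (fun z => h z *: k z) (fun w => h u *: 'd k u w + 'd h u w *: k u).
Proof.
move=> /differentiableP dh /differentiableP dk.
have H := is_diff_pair dh dk.
exact: (is_diff_comp H (is_diff_scaleb (h u, k u))).
Qed.

Lemma differentiable_scale U V (h : U -> R^o) (k : U -> V) u :
  differentiable h u -> differentiable k u ->
  differentiable (fun z => h z *: k z) u.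
Proof. by move=> dh dk; have [] := is_diff_scale dh dk. Qed.

Lemma derive_scale U V (h : U -> R^o) (k : U -> V) u w :
  differentiable h u -> differentiable k u ->
  'D_w (fun z => h z *: k z) u = h u *: 'D_w k u + 'D_w h u *: k u.
Proof.
move=> dh dk; have [d E] := is_diff_scale dh dk.
by rewrite deriveE // E !deriveE.
Qed.

(** Finite orders of smoothness on a fixed open set. Unlike the statement about all sequences of
    directions, this supports induction through product and chain rules, where the derivative of a
    product consists of products of one order less. *)
Fixpoint Cn U V (A : set U) (n : nat) (h : U -> V) : Prop :=
  (forall v, A v -> differentiable h v) /\
  if n is m.+1 then forall w, Cn A m ('D_w h) else True.

Lemma Cn_diff U V (A : set U) n (h : U -> V) v :
  Cn A n h -> A v -> differentiable h v.
Proof. by case: n => [|n] [H _]; apply: H. Qed.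

Lemma Cn_ext U V (A : set U) n (h k : U -> V) : open A ->
  (forall v, A v -> h v = k v) -> Cn A n h -> Cn A n k.
Proof.
move=> oA; elim: n h k => [|n IH] h k hk.
  move=> [H _]; split=> // v Av; apply: differentiable_near_eq (H _ Av).
  by apply/nearP; exists A.
move=> [H H']; split=> [v Av|w].
  by apply: differentiable_near_eq (H _ Av); apply/nearP; exists A.
apply: IH (H' w) => v Av; apply: near_eq_derive.
by apply/nearP; exists A.
Qed.

Lemma CnS U V (A : set U) n (h : U -> V) : Cn A n.+1 h -> Cn A n h.
Proof.
elim: n h => [|n IH] h [H H']; split=> // w.
exact/IH/H'.
Qed.

Lemma Cn_sub U V (A B : set U) n (h : U -> V) : B `<=` A -> Cn A n h -> Cn B n h.
Proof.
move=> BA; elim: n h => [|n IH] h [H H']; split=> //.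
- by move=> v /BA; apply: H.
- by move=> v /BA; apply: H.
- by move=> w; apply: IH (H' w).
Qed.

Lemma Cn_cst U V (A : set U) n (a : V) : open A -> Cn A n (fun _ : U => a).
Proof.
move=> oA; elim: n a => [|n IH] a; split=> // w.
by apply: (Cn_ext oA _ (IH 0)) => v _; rewrite derive_cst.
Qed.

Lemma Cn_lin U V (A : set U) n (L : {linear U -> V}) : open A -> continuous L ->
  Cn A n L.
Proof.
move=> oA Lc; case: n => [|n]; split=> //.
- by move=> v _; exact: linear_differentiable.
- by move=> v _; exact: linear_differentiable.
move=> w; apply: (Cn_ext oA _ (Cn_cst n (L w) oA)) => v _.
by rewrite derive_lin.
Qed.

Lemma Cn_linpost U V W (A : set U) n (h : U -> V) (L : {linear V -> W}) :
  open A -> continuous L -> Cn A n h -> Cn A n (fun z => L (h z)).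
Proof.
move=> oA Lc; have dL v : differentiable L v by exact: linear_differentiable.
elim: n h => [|n IH] h [H H']; split=> //.
- by move=> v Av; apply: differentiable_comp => //; exact: H.
- by move=> v Av; apply: differentiable_comp => //; exact: H.
move=> w; apply: (Cn_ext oA _ (IH _ (H' w))) => v Av.
by rewrite -(derive_linpost w Lc) //; exact: H.
Qed.

Lemma Cn_add U V (A : set U) n (h k : U -> V) : open A ->
  Cn A n h -> Cn A n k -> Cn A n (fun z => h z + k z).
Proof.
move=> oA; elim: n h k => [|n IH] h k [H H'] [K K']; split=> //.
- by move=> v Av; apply: differentiableD; [exact: H|exact: K].
- by move=> v Av; apply: differentiableD; [exact: H|exact: K].
move=> w; apply: (Cn_ext oA _ (IH _ _ (H' w) (K' w))) => v Av.
by rewrite deriveD //; apply: diff_derivable; [exact: H|exact: K].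
Qed.

Lemma Cn_scale U V (A : set U) n (h : U -> R^o) (k : U -> V) : open A ->
  Cn A n h -> Cn A n k -> Cn A n (fun z => h z *: k z).
Proof.
move=> oA; elim: n h k => [|n IH] h k Hh Hk; split=> //.
- by move=> v Av; apply: differentiable_scale;
    [exact: Cn_diff Hh Av|exact: Cn_diff Hk Av].
- by move=> v Av; apply: differentiable_scale;
    [exact: Cn_diff Hh Av|exact: Cn_diff Hk Av].
move=> w.
have H1 := IH _ _ (CnS Hh) (Hk.2 w).
have H2 := IH _ _ (Hh.2 w) (CnS Hk).
apply: (Cn_ext oA _ (Cn_add oA H1 H2)) => v Av.
by rewrite derive_scale //; [exact: Cn_diff Hh Av|exact: Cn_diff Hk Av].
Qed.

Lemma Cn_sum U V (A : set U) n m (h : 'I_m -> U -> V) : open A ->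
  (forall i, Cn A n (h i)) -> Cn A n (fun z => \sum_i h i z).
Proof.
move=> oA; elim: m h => [|m IH] h H.
  by apply: (Cn_ext oA _ (Cn_cst n 0 oA)) => v _; rewrite big_ord0.
have H1 := IH (fun i => h (lift ord0 i)) (fun i => H _).
apply: (Cn_ext oA _ (Cn_add oA (H ord0) H1)) => v _.
by rewrite big_ord_recl.
Qed.

(* [V] is finite-dimensional, in terms of a continuous linear coordinate system. *)
Definition findim V : Prop := exists (n : nat) (e : 'I_n -> V)
  (l : 'I_n -> {linear V -> R^o}), (forall i, continuous (l i)) /\
  (forall v, v = \sum_i l i v *: e i) .

(** The direction ['D_w k z] in the chain rule varies with [z]. Expanded in coordinates of [V], the
    derivative becomes a finite sum of scalar functions times ['D_(e i) h \o k], to which [Cn_scale]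
    and the induction hypothesis apply. *)
Lemma Cn_comp U V W (A : set U) (B : set V) n (k : U -> V) (h : V -> W) :
  findim V -> open A -> open B -> (forall v, A v -> B (k v)) ->
  Cn A n k -> Cn B n h -> Cn A n (fun z => h (k z)).
Proof.
move=> [m [e [l [lc le]]]] oA oB AB.
elim: n h k AB => [|n IH] h k AB Hk Hh; split=> //.
- move=> v Av; apply: (@differentiable_comp _ _ _ _ k h); first exact: Cn_diff Hk Av.
  exact: Cn_diff Hh (AB _ Av).
- move=> v Av; apply: (@differentiable_comp _ _ _ _ k h); first exact: Cn_diff Hk Av.
  exact: Cn_diff Hh (AB _ Av).
move=> w.
have H i : Cn A n (fun z => l i ('D_w k z) *: 'D_(e i) h (k z)).
  apply: Cn_scale => //; last by apply: (IH ('D_(e i) h) k) => //; [exact: CnS|exact: Hh.2].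
  exact: (Cn_linpost oA (lc i) (Hk.2 w)).
apply: (Cn_ext oA _ (Cn_sum oA H)) => v Av.
have dh : differentiable h (k v) by exact: Cn_diff Hh (AB _ Av).
rewrite (@derive_chain _ _ _ k h) //; last exact: Cn_diff Hk Av.
rewrite [in RHS](le ('D_w k v)) deriveDir_sum //.
by apply: eq_bigr => i _; rewrite deriveDirZ.
Qed.

Lemma smooth_nearE U V (h : U -> V) u : smooth_near h u <->
  exists A : set U, [/\ open A, A u & forall n, Cn A n h].
Proof.
have E (A : set U) : (forall n, Cn A n h) <-> forall v, A v -> forall s : seq U,
    differentiable (foldr (fun w (k : U -> V) z => 'D_w k z) h s) v.

  split.
    (* [foldr] takes the derivative along the last entry of [s] first, whereas [Cn] peels off the
       derivative taken first; hence the induction from the end of the list. *)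
    move=> H v Av s; elim/last_ind: s h H => [|s w IH] k H.
      exact: Cn_diff (H 0%N) Av.
    by rewrite foldr_rcons; apply: IH => n; exact: (H n.+1).2.
  move=> H n; elim: n h H => [|n IH] k H; split=> //.
  - by move=> v Av; exact: H v Av [::].
  - by move=> v Av; exact: H v Av [::].
  by move=> w; apply: IH => v Av s; have := H v Av (rcons s w); rewrite foldr_rcons.
split=> [/nearP[A [oA Au AP]]|[A [oA Au AP]]]; [|apply/nearP]; exists A; split=> //.
  exact/E.
by apply/E.
Qed.

Lemma smooth_diff U V (h : U -> V) u : smooth_near h u -> differentiable h u.
Proof. by move=> /smooth_nearE[A [_ Au H]]; exact: Cn_diff (H 0%N) Au. Qed.

Lemma smooth_near_near U V (h : U -> V) u : smooth_near h u ->
  \forall v \near u, smooth_near h v.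
Proof. exact: near_near. Qed.

Lemma smooth_ext U V (h k : U -> V) u :
  (\forall v \near u, h v = k v) -> smooth_near h u -> smooth_near k u.
Proof.
move=> /nearP[B [oB Bu BP]] /smooth_nearE[A [oA Au H]]; apply/smooth_nearE.
have oAB := openI oA oB.
exists (A `&` B); split=> // n.
apply: (Cn_ext oAB) (Cn_sub _ (H n)); last by move=> ? [].
by move=> v [_ /BP].
Qed.

Lemma smooth_cst U V (a : V) u : smooth_near (fun _ : U => a) u.
Proof.
apply/smooth_nearE; exists setT; split=> // ; first exact: openT.
by move=> n; apply: Cn_cst; exact: openT.
Qed.

Lemma smooth_lin U V (L : {linear U -> V}) u : continuous L -> smooth_near L u.
Proof.
move=> Lc; apply/smooth_nearE; exists setT; split=> //; first exact: openT.
by move=> n; apply: Cn_lin => //; exact: openT.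
Qed.

Lemma smooth_linpost U V W (h : U -> V) (L : {linear V -> W}) u :
  continuous L -> smooth_near h u -> smooth_near (fun z => L (h z)) u.
Proof.
move=> Lc /smooth_nearE[A [oA Au H]]; apply/smooth_nearE; exists A; split=> // n.
exact: Cn_linpost.
Qed.

Lemma smooth_add U V (h k : U -> V) u : smooth_near h u -> smooth_near k u ->
  smooth_near (fun z => h z + k z) u.
Proof.
move=> /smooth_nearE[A [oA Au H]] /smooth_nearE[B [oB Bu K]]; apply/smooth_nearE.
have oAB := openI oA oB.
exists (A `&` B); split=> // n; apply: Cn_add => //.
  by apply: Cn_sub (H n) => ? [].
by apply: Cn_sub (K n) => ? [].
Qed.

Lemma smooth_scale U V (h : U -> R^o) (k : U -> V) u :
  smooth_near h u -> smooth_near k u -> smooth_near (fun z => h z *: k z) u.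
Proof.
move=> /smooth_nearE[A [oA Au H]] /smooth_nearE[B [oB Bu K]]; apply/smooth_nearE.
have oAB := openI oA oB.
exists (A `&` B); split=> // n; apply: Cn_scale => //.
  by apply: Cn_sub (H n) => ? [].
by apply: Cn_sub (K n) => ? [].
Qed.

Lemma smooth_mul U (h k : U -> R^o) u :
  smooth_near h u -> smooth_near k u -> smooth_near (fun z => h z * k z : R^o) u.
Proof. exact: smooth_scale. Qed.

Lemma smooth_sum U V m (h : 'I_m -> U -> V) u :
  (forall i, smooth_near (h i) u) -> smooth_near (fun z => \sum_i h i z) u.
Proof.
elim: m h => [|m IH] h H.
  apply: (@smooth_ext _ _ (fun _ => 0)); last exact: smooth_cst.
  by near=> v; rewrite big_ord0.
have H1 := IH (fun i => h (lift ord0 i)) (fun i => H _).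
apply: smooth_ext (smooth_add (H ord0) H1).
by near=> v; rewrite big_ord_recl.
Unshelve. all: by end_near. Qed.

Lemma smooth_continuous U V (h : U -> V) u : smooth_near h u ->
  {for u, continuous h}.
Proof. by move=> /smooth_diff /differentiable_continuous. Qed.

Lemma near_comp U V (k : U -> V) u (P : V -> Prop) : {for u, continuous k} ->
  (\forall v \near k u, P v) -> \forall z \near u, P (k z).
Proof. by move=> kc H; apply: (kc [set v | P v]). Qed.

Lemma smooth_near_comp U V (k : U -> V) u (P : V -> Prop) : smooth_near k u ->
  (\forall v \near k u, P v) -> \forall z \near u, P (k z).
Proof. by move=> /smooth_continuous; exact: near_comp. Qed.

Lemma smooth_comp U V W (k : U -> V) (h : V -> W) u : findim V ->
  smooth_near k u -> smooth_near h (k u) -> smooth_near (fun z => h (k z)) u.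
Proof.
move=> fV Hk /smooth_nearE[B [oB Bu Hh]].
have : \forall z \near u, B (k z).
  apply: (smooth_near_comp (P := B) Hk); apply/nearP; exists B; split=> //.
move=> /nearP[C [oC Cu CB]].
have /smooth_nearE[A [oA Au HA]] := Hk.
apply/smooth_nearE; have oAC := openI oA oC.
exists (A `&` C); split=> // n; apply: (Cn_comp (B := B)) => //.
  by move=> v [_ /CB].
by apply: Cn_sub (HA n) => ? [].
Qed.

Lemma smooth_derive U V (h : U -> V) u w : smooth_near h u ->
  smooth_near ('D_w h) u.
Proof.
move=> /smooth_nearE[A [oA Au H]]; apply/smooth_nearE; exists A; split=> // n.
exact: (H n.+1).2.
Qed.

(** Both the base point and the direction may vary. This is the local form of [X f], of a term of a
    bracket, and of [df] on the tangent bundle. *)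
Lemma smooth_derive_var U V W (h : V -> W) (k d : U -> V) u : findim V ->
  smooth_near k u -> smooth_near d u -> smooth_near h (k u) ->
  smooth_near (fun z => 'D_(d z) h (k z)) u.
Proof.
move=> fV Hk Hd Hh; have [m [e [l [lc le]]]] := fV.
have H i : smooth_near (fun z => l i (d z) *: 'D_(e i) h (k z)) u.
  apply: smooth_scale; first exact: smooth_linpost.
  by apply: (smooth_comp (h := 'D_(e i) h)) => //; apply: smooth_derive.
apply: smooth_ext (smooth_sum H); near=> v.
have dh : differentiable h (k v).
  apply: smooth_diff; near: v; apply: smooth_near_comp Hk _.
  exact: smooth_near_near.
rewrite [in RHS](le (d v)) deriveDir_sum //.
by apply: eq_bigr => i _; rewrite deriveDirZ.
Unshelve. all: by end_near. Qed.

Lemma smooth_id U (u : U) : smooth_near (fun z => z) u.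
Proof. by apply: (smooth_lin (L := idfun)) => x; exact: cvg_id. Qed.

End Calculus.

(** * Symmetry of second derivatives; coordinates on products *)

Section Schwarz.
Context {R : realType}.
Implicit Types U V W : normedModType R.

(** [A], [B], [C] are values of a first derivative at [c v + t w], [c v] and 0 (relative to [u]),
    and [p], [q] are its differential at [v], [w]. Subtracting two linear approximations leaves only
    [t q]. *)
Let second_difference_bound (A B C p q c t e : R) : 0 < t ->
  `|A - C - (c * p + t * q)| <= e / 2 * t -> `|B - C - c * p| <= e / 2 * t ->
  `|(A - B) * t - t ^+ 2 * q| <= e * t ^+ 2.
Proof.
move=> t0 H1 H2.
have -> : (A - B) * t - t ^+ 2 * q = t * (A - B - t * q) by ring.
rewrite normrM (ger0_norm (ltW t0)) expr2 mulrCA ler_pM2l //.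
have -> : A - B - t * q = (A - C - (c * p + t * q)) - (B - C - c * p) by ring.
apply: le_trans (ler_normB _ _) _.
by rewrite [e]splitr mulrDl lerD.
Qed.

Let swap_bound (a p q T e : R) : 0 < T ->
  `|a - T * p| <= e / 2 * T -> `|a - T * q| <= e / 2 * T -> `|p - q| <= e.
Proof.
move=> T0 H1 H2; rewrite -(ler_pM2r T0) -{1}(ger0_norm (ltW T0)) -normrM.
have -> : (p - q) * T = (a - T * q) - (a - T * p) by ring.
apply: le_trans (ler_normB _ _) _.
by rewrite [X in _ <= X * _]splitr mulrDl lerD.
Qed.

(** The mean value theorem along [v] reduces the second difference to a difference of two values of
    ['D_v h]; differentiability of ['D_v h] at the single point [u] estimates both. *)
Lemma second_difference U (h : U -> R^o) u v w : smooth_near h u ->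
  forall e : R, 0 < e -> \forall t \near (0:R)^'+,
  `|h (u + t *: v + t *: w) - h (u + t *: v) - h (u + t *: w) + h u
    - t ^+ 2 * 'D_w ('D_v h) u| <= e * t ^+ 2.
Proof.
move=> Hh e e0; pose g := 'D_v h.
have dg : differentiable g u by exact/smooth_diff/smooth_derive.
have H1 := diff_locallyx dg.
(* [t * M] bounds all vectors [a v + b w] with [a], [b] in [[0, t]]; the summand 1 keeps [M]
   positive when [v] and [w] vanish. The precision [e / (2 M)] then gives an error of at most
   [e / 2 * t] for each approximation. *)
pose M := `|v| + `|w| + 1.
have M0 : 0 < M by rewrite /M ltr_wpDl // addr_ge0.
have e'0 : 0 < e / (2 * M) by rewrite divr_gt0 // mulr_gt0.
have H2 : \forall z \near (0 : U),
    `|g (z + u) - g u - 'd g u z| <= e / (2 * M) * `|z|.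
  have /eqaddoP/(_ _ e'0) := diff_locally dg.
  by apply: filterS => z /=; rewrite !fctE /= opprD addrA.
have H3 : \forall z \near (0:U), differentiable h (z + u).
  have c : (fun z : U => z + u) @ (0 : U) --> u.
    by rewrite -[X in _ --> X]add0r; apply: cvgD; [exact: cvg_id|exact: cvg_cst].
  have H : \forall z \near u, differentiable h z.
    by apply: filterS (smooth_near_near Hh) => z; exact: smooth_diff.
  exact: c _ H.
have [d /= d0 Hd] := (nbhs_ballP _ _).1 (filterI H2 H3).
near=> t.
have t0 : 0 < t by near: t; exact: nbhs_right_gt.
have tM : t * M < d.
  rewrite -ltr_pdivlMr //; near: t; apply: nbhs_right_lt; exact: divr_gt0.
have bd (a b : R) : 0 <= a <= t -> 0 <= b <= t -> `|a *: v + b *: w| <= t * M.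
  move=> /andP[a0 at_] /andP[b0 bt]; apply: le_trans (ler_normD _ _) _.
  rewrite !normrZ !ger0_norm // /M !mulrDr mulr1.
  apply: le_trans (_ : t * `|v| + t * `|w| <= _); last by rewrite lerDl ltW.
  by rewrite lerD // ler_wpM2r.
have Hd' (a b : R) : 0 <= a <= t -> 0 <= b <= t ->
   `|g (a *: v + b *: w + u) - g u - 'd g u (a *: v + b *: w)| <= e / 2 * t
   /\ differentiable h (a *: v + b *: w + u).
  move=> Ha Hb; have B := bd _ _ Ha Hb.
  have [/=|h1 h2] := Hd (a *: v + b *: w).
    by rewrite -ball_normE /= sub0r normrN (le_lt_trans B).
  split=> //; apply: le_trans h1 _.
  have -> : e / 2 * t = e / (2 * M) * (t * M).
    by field; rewrite gt_eqF.
  by rewrite ler_wpM2l // ltW.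
(* The term [0 *: w] gives both summands the same shape, so that [dl] differentiates each of
   them. *)
pose phi (s : R) : R := h (s *: v + t *: w + u) - h (s *: v + 0 *: w + u).
pose dphi (s : R) : R := g (s *: v + t *: w + u) - g (s *: v + 0 *: w + u).
have t_ : 0 <= t <= t by rewrite lexx ltW.
have z_ : (0 : R) <= 0 <= t by rewrite lexx ltW.
have dl (b s : R) : 0 <= b <= t -> 0 <= s <= t ->
    is_derive s 1 (fun s : R => h (s *: v + b *: w + u) : R)
       (g (s *: v + b *: w + u)).
  move=> Hb Hs; have [_ dh] := Hd' _ _ Hs Hb.
  have /= := @derive_chain _ _ _ _ (fun s : R^o => s *: v + b *: w + u) h s 1.
  have dL : is_diff (s : R^o) (fun s : R^o => s *: v + b *: w + u) (fun s => s *: v).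
    have -> : (fun s : R^o => s *: v + b *: w + u) =
      (fun s : R^o => s *: v) + cst (b *: w + u).
      by apply/funext => x; rewrite fctE addrA.
    apply: is_diff_eq; by rewrite addr0.
  have [dL1 dL2] := dL.
  move=> /(_ dL1 dh); rewrite (deriveE _ dL1) dL2 scale1r -/(g _) => <-.
  apply: derivableP; apply: diff_derivable.
  exact: (@differentiable_comp _ _ _ _ (fun s : R^o => s *: v + b *: w + u) h).
have dphiP (s : R) : 0 <= s <= t -> is_derive s 1 phi (dphi s).
  by move=> Hs; apply: is_deriveB; apply: dl.
have [||c /[!in_itv] /= /andP[c0 ct]] := MVT t0 (f := phi) (df := dphi).
- by move=> s /[!in_itv] /= /andP[s0 st]; apply: dphiP; rewrite !ltW.
- apply: derivable_within_continuous => s /[!in_itv] /= Hs.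
  by have [] := dphiP s Hs.
have Hc : 0 <= c <= t by rewrite !ltW.
have [E1 _] := Hd' _ _ Hc t_.
have [E2 _] := Hd' _ _ Hc z_.
rewrite subr0 /phi /dphi !scale0r !add0r !addr0 => E.
rewrite deriveE // -/g.
rewrite !scale0r !addr0 in E2.
have L1 : 'd g u (c *: v + t *: w) = c * 'd g u v + t * 'd g u w.
  by rewrite linearD !linearZ.
have L2 : 'd g u (c *: v) = c * 'd g u v by rewrite linearZ.
rewrite L1 in E1; rewrite L2 in E2.
have -> : h (u + t *: v + t *: w) - h (u + t *: v) - h (u + t *: w) + h u
  = h (t *: v + t *: w + u) - h (t *: v + u) - (h (t *: w + u) - h u).
  rewrite -[u + t *: v + _]addrA !(addrC u) opprB addrA.
  by rewrite [in RHS]addrAC.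
rewrite E.
exact: (second_difference_bound t0 E1 E2).
Unshelve. all: by end_near. Qed.

(** The second difference is symmetric in [v] and [w], and divided by [t ^+ 2] it approximates both
    iterated derivatives. *)
Lemma derive_swap U (h : U -> R^o) u v w : smooth_near h u ->
  'D_v ('D_w h) u = 'D_w ('D_v h) u.
Proof.
move=> Hh; apply/eqP; rewrite -subr_eq0 -normr_le0; apply/ler_addgt0Pr => e e0; rewrite add0r.
have e2 : 0 < e / 2 by rewrite divr_gt0.
have H1 := second_difference v w Hh e2.
have H2 := second_difference w v Hh e2.
have [t [[h1 h2] t0]] := filter_ex (filterI (filterI H1 H2) (nbhs_right_gt 0)).
have t2 : 0 < t ^+ 2 by rewrite exprn_gt0.
rewrite /= in h1 h2.
have E : h (u + t *: w + t *: v) - h (u + t *: w) - h (u + t *: v) + h u =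
    h (u + t *: v + t *: w) - h (u + t *: v) - h (u + t *: w) + h u.
  by rewrite (addrAC u) (addrAC (h _)).
rewrite E in h2.
exact: (swap_bound t2 h2 h1).
Qed.

Lemma findim_real : findim R^o.
Proof.
exists 1%N, (fun _ => 1 : R^o), (fun _ => idfun); split=> [_ x|v].
  exact: cvg_id.
by rewrite big_ord1 /= /GRing.scale /= mulr1.
Qed.

Let coordl n (i : 'I_n) : 'rV[R]_n -> R^o := fun v => v ord0 i.
Let coordl_linear n (i : 'I_n) : linear (@coordl n i).
Proof. by move=> a x y; rewrite /coordl !mxE. Qed.
HB.instance Definition _ n i :=
  GRing.isLinear.Build R 'rV[R]_n R^o _ (@coordl n i) (@coordl_linear n i).

Lemma findim_row n : findim 'rV[R]_n.
Proof.
exists n, (delta_mx ord0), (fun i => @coordl n i : {linear _ -> _}); split.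
  by move=> i; exact: coord_continuous.
by move=> v; rewrite {1}[v]row_sum_delta.
Qed.

Let pair1 U V : U -> U * V := fun u => (u, 0).
Let pair2 U V : V -> U * V := fun v => (0, v).
Let pair1_linear U V : linear (@pair1 U V).
Proof. by move=> a x y; congr (_, _); rewrite /= scaler0 addr0. Qed.
Let pair2_linear U V : linear (@pair2 U V).
Proof. by move=> a x y; congr (_, _); rewrite /= scaler0 addr0. Qed.
HB.instance Definition _ U V :=
  GRing.isLinear.Build R U (U * V)%type _ (@pair1 U V) (@pair1_linear U V).
HB.instance Definition _ U V :=
  GRing.isLinear.Build R V (U * V)%type _ (@pair2 U V) (@pair2_linear U V).
Let pair1_continuous U V : continuous (@pair1 U V).
Proof. by move=> x; apply: cvg_pair; [exact: cvg_id|exact: cvg_cst]. Qed.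
Let pair2_continuous U V : continuous (@pair2 U V).
Proof. by move=> x; apply: cvg_pair; [exact: cvg_cst|exact: cvg_id]. Qed.

Let fstl U V : (U * V)%type -> U := fst.
Let sndl U V : (U * V)%type -> V := snd.
Let fstl_linear U V : linear (@fstl U V). Proof. by []. Qed.
Let sndl_linear U V : linear (@sndl U V). Proof. by []. Qed.
HB.instance Definition _ U V :=
  GRing.isLinear.Build R (U * V)%type U _ (@fstl U V) (@fstl_linear U V).
HB.instance Definition _ U V :=
  GRing.isLinear.Build R (U * V)%type V _ (@sndl U V) (@sndl_linear U V).
Let fstl_continuous U V : continuous (@fstl U V).
Proof. by move=> x; exact: cvg_fst. Qed.
Let sndl_continuous U V : continuous (@sndl U V).
Proof. by move=> x; exact: cvg_snd. Qed.

Lemma findim_prod U V : findim U -> findim V -> findim (U * V)%type.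
Proof.
move=> [m [e [l [lc le]]]] [n [e' [l' [lc' le']]]].
pose E (i : 'I_(m + n)) : U * V := match fintype.split i with
  | inl j => (e j, 0) | inr j => (0, e' j) end.
pose L (i : 'I_(m + n)) : {linear (U * V)%type -> R^o} := match fintype.split i with
  | inl j => l j \o @fstl U V | inr j => l' j \o @sndl U V end.
exists (m + n)%N, E, L; split.
  move=> i; rewrite /L; case: (fintype.split i) => j z; apply: continuous_comp.
  - exact: fstl_continuous.
  - exact: lc.
  - exact: sndl_continuous.
  - exact: lc'.
move=> [u v]; rewrite big_split_ord /=.
under eq_bigr => i _ do rewrite /L /E (unsplitK (inl i)).
under [X in _ + X]eq_bigr => i _ do rewrite /L /E (unsplitK (inr i)).
rewrite /= /fstl /sndl /=.
have -> : \sum_(i < m) l i u *: ((e i, 0) : U * V) = @pair1 U V u.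
  by rewrite [X in pair1 _ X](le u) linear_sum; apply: eq_bigr => i _; rewrite linearZ.
have -> : \sum_(i < n) l' i v *: ((0, e' i) : U * V) = @pair2 U V v.
  by rewrite [X in pair2 _ X](le' v) linear_sum; apply: eq_bigr => i _; rewrite linearZ.
by congr (_, _) => /=; rewrite ?addr0 ?add0r.
Qed.

Lemma smooth_fst U V (z : U * V) : smooth_near (fst : U * V -> U) z.
Proof. exact: (smooth_lin _ (@fstl_continuous U V)). Qed.

Lemma smooth_snd U V (z : U * V) : smooth_near (snd : U * V -> V) z.
Proof. exact: (smooth_lin _ (@sndl_continuous U V)). Qed.

Lemma smooth_pair U V W (f : W -> U) (g : W -> V) w :
  smooth_near f w -> smooth_near g w -> smooth_near (fun z => (f z, g z)) w.
Proof.
move=> Hf Hg.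
have H := smooth_add (smooth_linpost (@pair1_continuous U V) Hf)
  (smooth_linpost (@pair2_continuous U V) Hg).
by apply: smooth_ext H; near=> z; congr (_, _); rewrite /= ?addr0 ?add0r.
Unshelve. all: by end_near. Qed.

Lemma derive_pair U V W (f : W -> U) (g : W -> V) w d :
  differentiable f w -> differentiable g w ->
  'D_d (fun z => (f z, g z)) w = ('D_d f w, 'D_d g w).
Proof.
move=> df dg; have H := is_diff_pair (differentiableP df) (differentiableP dg).
have [H1 H2] := H.
by rewrite deriveE // H2 !deriveE.
Qed.

Lemma derive_fst U V (z d : U * V) : 'D_d (fst : U * V -> U) z = d.1.
Proof. exact: (derive_lin _ _ (@fstl_continuous U V)). Qed.

Lemma derive_snd U V (z d : U * V) : 'D_d (snd : U * V -> V) z = d.2.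
Proof. exact: (derive_lin _ _ (@sndl_continuous U V)). Qed.

End Schwarz.

(** * Tangent vectors and smooth maps *)

(** The chart conditions of a manifold, with covering stated by itself; in this form they pass to
    products and tangent bundles by chart computations. *)
Record good_atlas (R : realType) (V : normedModType R) (M : mfd V) : Prop := {
  ga_open : forall c : chart V M, atlas c -> open (cdom c);
  ga_inj : forall (c : chart V M) u v, atlas c -> cdom c u -> cdom c v ->
    cpar c u = cpar c v -> u = v;
  ga_compat : forall (c d : chart V M) u v, atlas c -> atlas d ->
    cdom c u -> cdom d v -> cpar c u = cpar d v ->
    exists tau : V -> V, [/\ smooth_near tau u, tau u = v &
      \forall u' \near u, cdom d (tau u') /\ cpar d (tau u') = cpar c u'];
  ga_cover : forall x : M, exists (c : chart V M) u,
    [/\ atlas c, cdom c u & cpar c u = x] }.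

Lemma manifold_good (R : realType) (V : normedModType R) (M : mfd V) :
  is_manifold M -> good_atlas M.
Proof.
case=> o i c _ [s [sa sc]]; split=> // x.
by have [k [u [ku kx]]] := sc x; exists (s k), u.
Qed.

Section Tangent.
Context {R : realType} {V : normedModType R} (fV : findim V).
Context {M : mfd V} (gM : good_atlas M).
Implicit Types (c d : chart V M) (f g : M -> R) (x : M).

Lemma chart_near c u : atlas c -> cdom c u -> \forall v \near u, cdom c v.
Proof.
by move=> ac cu; apply/nearP; exists (cdom c); split=> //; exact: ga_open.
Qed.

(** [smooth_at] speaks of some chart; a change of coordinates carries smoothness to any given chart
    around the point. *)
Lemma smooth_atP c u f : atlas c -> cdom c u ->
  smooth_at f (cpar c u) <-> smooth_near (f \o cpar c : V -> R^o) u.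
Proof.
move=> ac cu; split=> [[d [v [ad dv e H]]]|H]; last by exists c, u; split.
have [tau [st tu tn]] := ga_compat gM ac ad cu dv (esym e).
have H' : smooth_near (fun z => (f \o cpar d : V -> R^o) (tau z)) u.
  by apply: smooth_comp => //; rewrite tu.
by apply: smooth_ext H'; near=> z; rewrite /= (near tn z _).2.
Unshelve. all: by end_near. Qed.

Lemma mnear_chart c u x (P : M -> Prop) : mnear x P -> atlas c -> cdom c u ->
  cpar c u = x -> \forall v \near u, P (cpar c v).
Proof.
move=> [d [v [ad dv dx Pn]]] ac cu cx.
have [tau [st tu tn]] := ga_compat gM ac ad cu dv (etrans cx (esym dx)).
rewrite -tu in Pn; have := smooth_near_comp st Pn.
by apply: filterS2 tn => z [_ <-].
Qed.

Lemma mnearS x (P Q : M -> Prop) : (forall y, P y -> Q y) -> mnear x P -> mnear x Q.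
Proof.
move=> PQ [c [u [ac cu cx H]]]; exists c, u; split=> //.
by apply: filterS H => v; exact: PQ.
Qed.

Lemma mnear_all x (P : M -> Prop) : (forall y, P y) -> mnear x P.
Proof.
move=> HP; have [c [u [ac cu cx]]] := ga_cover gM x.
by exists c, u; split=> //; near=> z.
Unshelve. all: by end_near. Qed.

Lemma mnear_here x (P : M -> Prop) : mnear x P -> P x.
Proof. by move=> [c [u [ac cu <-]]] /nbhs_singleton. Qed.

Lemma smooth_at_near x f : smooth_at f x -> mnear x (smooth_at f).
Proof.
move=> [c [u [ac cu cx H]]]; exists c, u; split=> //.
have := chart_near ac cu; apply: filterS2 (smooth_near_near H) => v sv cv.
exact/smooth_atP.
Qed.

Lemma smooth_at_eq x f g : mnear x (fun y => f y = g y) ->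
  smooth_at f x -> smooth_at g x.
Proof.
move=> fg [c [u [ac cu cx H]]]; exists c, u; split=> //.
apply: smooth_ext H; exact: (mnear_chart fg ac cu cx).
Qed.

Lemma smooth_at_add x f g : smooth_at f x -> smooth_at g x ->
  smooth_at (fun y => f y + g y) x.
Proof.
have [c [u [ac cu <-]]] := ga_cover gM x.
rewrite !smooth_atP //; exact: smooth_add.
Qed.

Lemma smooth_at_mul x f g : smooth_at f x -> smooth_at g x ->
  smooth_at (fun y => f y * g y) x.
Proof.
have [c [u [ac cu <-]]] := ga_cover gM x.
rewrite !smooth_atP //; exact: smooth_mul.
Qed.

Lemma smooth_at_cst x (a : R) : smooth_at (fun _ : M => a) x.
Proof.
have [c [u [ac cu <-]]] := ga_cover gM x.
rewrite smooth_atP //; exact: smooth_cst.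
Qed.

Lemma smooth_at_sum x n (f : 'I_n -> M -> R) : (forall i, smooth_at (f i) x) ->
  smooth_at (fun y => \sum_i f i y) x.
Proof.
have [c [u [ac cu <-]]] := ga_cover gM x => H.
apply/smooth_atP => //.
by apply: smooth_sum (fun i => _) => i; have /smooth_atP := H i; apply.
Qed.

Lemma smooth_at_scale x a f : smooth_at f x -> smooth_at (fun y => a * f y) x.
Proof. by move=> H; apply: smooth_at_mul => //; exact: smooth_at_cst. Qed.

Lemma tvecE c u w f : smooth_at f (cpar c u) ->
  tvec c u w f = 'D_w (f \o cpar c : V -> R^o) u.
Proof. by move=> H; rewrite /tvec asboolT. Qed.

Lemma tvec_junk c u w f : ~ smooth_at f (cpar c u) -> tvec c u w f = 0.
Proof. by move=> H; rewrite /tvec asboolF. Qed.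

Lemma tvec_diff c u f : atlas c -> cdom c u -> smooth_at f (cpar c u) ->
  differentiable (f \o cpar c : V -> R^o) u.
Proof. by move=> ac cu /smooth_atP H; apply: smooth_diff; apply: H. Qed.

Lemma tvecP c u a w z f : atlas c -> cdom c u ->
  tvec c u (a *: w + z) f = a * tvec c u w f + tvec c u z f.
Proof.
move=> ac cu; have [H|H] := pselect (smooth_at f (cpar c u)).
  by rewrite !tvecE // deriveDir //; exact: tvec_diff.
by rewrite !tvec_junk // mulr0 addr0.
Qed.

Lemma tvecD c u w z f : atlas c -> cdom c u ->
  tvec c u (w + z) f = tvec c u w f + tvec c u z f.
Proof. by move=> ac cu; rewrite -[w]scale1r tvecP // mul1r scale1r. Qed.

Lemma tvec0 c u f : tvec c u 0 f = 0.
Proof. by rewrite /tvec; case: asboolP => // _; rewrite derive0. Qed.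

Lemma tvecZ c u a w f : atlas c -> cdom c u ->
  tvec c u (a *: w) f = a * tvec c u w f.
Proof. by move=> ac cu; rewrite -[a *: w]addr0 tvecP // tvec0 addr0. Qed.

Lemma tvec_sum c u n (w : 'I_n -> V) f : atlas c -> cdom c u ->
  tvec c u (\sum_i w i) f = \sum_i tvec c u (w i) f.
Proof.
move=> ac cu; elim: n w => [|n IH] w; first by rewrite !big_ord0 tvec0.
by rewrite !big_ord_recl tvecD // IH.
Qed.

Lemma tvec_change c d u w (tau : V -> V) : atlas c -> cdom c u -> atlas d ->
  smooth_near tau u ->
  (\forall u' \near u, cdom d (tau u') /\ cpar d (tau u') = cpar c u') ->
  tvec c u w = tvec d (tau u) ('D_w tau u).
Proof.
move=> ac cu ad st tn; have [dtu e] := nbhs_singleton tn.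
apply/funext => f; have [H|H] := pselect (smooth_at f (cpar c u)); last first.
  by rewrite !tvec_junk // e.
rewrite !tvecE ?e // -(@derive_chain _ _ _ _ tau (f \o cpar d : V -> R^o)).
- by apply: near_eq_derive; apply: filterS tn => z [_ E]; rewrite /= E.
- exact: smooth_diff.
- by apply: tvec_diff => //; rewrite e.
Qed.

Lemma tangent_tvec c u w : atlas c -> cdom c u -> tangent (cpar c u) (tvec c u w).
Proof. by move=> ac cu; exists c, u, w. Qed.

Lemma tangent_chart c u x v : tangent x v -> atlas c -> cdom c u -> cpar c u = x ->
  exists w, v = tvec c u w.
Proof.
move=> [d [z [w [ad dz dx ->]]]] ac cu cx.
have [tau [st tu tn]] := ga_compat gM ad ac dz cu (etrans dx (esym cx)).
exists ('D_w tau z); rewrite -tu; exact: tvec_change.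
Qed.

Lemma tangent_junk x v f : tangent x v -> ~ smooth_at f x -> v f = 0.
Proof. by move=> [c [u [w [ac cu <- ->]]]] H; rewrite tvec_junk. Qed.

Lemma tangent_eq x v f g : tangent x v -> mnear x (fun y => f y = g y) -> v f = v g.
Proof.
move=> [c [u [w [ac cu cx ->]]]] fg.
have [H|H] := pselect (smooth_at f x).
  rewrite !tvecE ?cx //; last exact: smooth_at_eq H.
  apply: near_eq_derive; exact: (mnear_chart fg ac cu cx).
rewrite !tvec_junk ?cx // => Hg; apply: H; apply: smooth_at_eq Hg.
by apply: mnearS fg => y.
Qed.

Lemma tangent_addf x v f g : tangent x v -> smooth_at f x -> smooth_at g x ->
  v (fun y => f y + g y) = v f + v g.
Proof.
move=> [c [u [w [ac cu cx ->]]]]; rewrite -cx => Hf Hg.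
rewrite !tvecE //; last exact: smooth_at_add.
by rewrite -deriveD //; apply: diff_derivable; exact: tvec_diff.
Qed.

Lemma tangent_mulf x v f g : tangent x v -> smooth_at f x -> smooth_at g x ->
  v (fun y => f y * g y) = f x * v g + v f * g x.
Proof.
move=> [c [u [w [ac cu cx ->]]]]; rewrite -cx => Hf Hg.
rewrite !tvecE //; last exact: smooth_at_mul.
by rewrite -(derive_scale (h := f \o cpar c : V -> R^o)
  (k := g \o cpar c : V -> R^o)) //; exact: tvec_diff.
Qed.

Lemma tangent_cst x v (a : R) : tangent x v -> v (fun _ => a) = 0.
Proof.
move=> [c [u [w [ac cu cx ->]]]]; rewrite tvecE; last exact: smooth_at_cst.
exact: derive_cst.
Qed.

Lemma tangent_scalef x v a f : tangent x v -> smooth_at f x ->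
  v (fun y => a * f y) = a * v f.
Proof.
move=> tv sf; rewrite (tangent_mulf tv) //; last exact: smooth_at_cst.
by rewrite (tangent_cst _ tv) mul0r addr0.
Qed.

Lemma tangent_subf x v f g : tangent x v -> smooth_at f x -> smooth_at g x ->
  v (fun y => f y - g y) = v f - v g.
Proof.
move=> tv Hf Hg; rewrite -mulN1r -(tangent_scalef _ tv) //.
rewrite -(tangent_addf tv) //; last exact: smooth_at_scale.
by apply: (tangent_eq tv); apply: mnear_all => y; rewrite mulN1r.
Qed.

Lemma tangent_sumf x v n (f : 'I_n -> M -> R) : tangent x v ->
  (forall i, smooth_at (f i) x) -> v (fun y => \sum_i f i y) = \sum_i v (f i).
Proof.
move=> tv; elim: n f => [|n IH] f H.
  rewrite big_ord0 -[RHS](tangent_cst 0 tv).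
  by congr v; apply/funext => y; rewrite big_ord0.
rewrite big_ord_recl -IH // -(tangent_addf tv) //; last exact: smooth_at_sum.
by congr v; apply/funext => y; rewrite big_ord_recl.
Qed.

Lemma tangent0 x : tangent x (fun _ => 0).
Proof.
have [c [u [ac cu <-]]] := ga_cover gM x; exists c, u, 0; split=> //.
by apply/funext => f; rewrite tvec0.
Qed.

Lemma tangentP x a v w : tangent x v -> tangent x w ->
  tangent x (fun f => a * v f + w f).
Proof.
have [c [u [ac cu cx]]] := ga_cover gM x.
move=> /tangent_chart/(_ ac cu cx)[v' ->] /tangent_chart/(_ ac cu cx)[w' ->].
exists c, u, (a *: v' + w'); split=> //.
by apply/funext => f; rewrite tvecP.
Qed.

Lemma tangentD x v w : tangent x v -> tangent x w ->
  tangent x (fun f => v f + w f).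
Proof.
move=> tv tw; have := tangentP 1 tv tw.
by congr tangent; apply/funext => f; rewrite mul1r.
Qed.

Lemma tangentZ x a v : tangent x v -> tangent x (fun f => a * v f).
Proof.
move=> tv; have := tangentP a tv (tangent0 x).
by congr tangent; apply/funext => f; rewrite addr0.
Qed.

Lemma tangent_sum x n (v : 'I_n -> tfun M) : (forall i, tangent x (v i)) ->
  tangent x (fun f => \sum_i v i f).
Proof.
elim: n v => [|n IH] v H.
  have := tangent0 x; congr tangent; apply/funext => f; by rewrite big_ord0.
have := tangentD (H ord0) (IH _ (fun i => H (lift ord0 i))).
by congr tangent; apply/funext => f; rewrite big_ord_recl.
Qed.

(* The value is [0] outside of the image of [cpar c]. *)
Definition cinv c x : V :=
  if pselect (exists u, cdom c u /\ cpar c u = x) is left e then projT1 (cid e) else 0.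

Lemma cinvP c x : (exists u, cdom c u /\ cpar c u = x) ->
  cdom c (cinv c x) /\ cpar c (cinv c x) = x.
Proof. by rewrite /cinv; case: pselect => // e _; case: cid. Qed.

Lemma cinvK c u : atlas c -> cdom c u -> cinv c (cpar c u) = u.
Proof.
move=> ac cu; have [|h1 h2] := @cinvP c (cpar c u); first by exists u.
exact: (ga_inj gM ac).
Qed.

Lemma coord_eq c u (l : V -> R) : atlas c -> cdom c u ->
  \forall z \near u, l z = l (cinv c (cpar c z)).
Proof.
move=> ac cu; have := chart_near ac cu.
by apply: filterS => z cz; rewrite cinvK.
Qed.

Lemma coord_smooth c u (l : {linear V -> R^o}) : continuous l -> atlas c ->
  cdom c u -> smooth_at (fun x => l (cinv c x)) (cpar c u).
Proof.
move=> lc ac cu; apply/smooth_atP => //.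
apply: smooth_ext (smooth_lin u lc).
exact: coord_eq.
Qed.

Lemma tvec_coord c u w (l : {linear V -> R^o}) : continuous l -> atlas c ->
  cdom c u -> tvec c u w (fun x => l (cinv c x)) = l w.
Proof.
move=> lc ac cu; rewrite tvecE; last exact: coord_smooth.
rewrite -(derive_lin u w lc); apply: near_eq_derive.
by apply: filterS (coord_eq l ac cu) => z ->.
Qed.

(** The coordinates of a chart, extended by [cinv], are smooth germs, and a tangent vector applied
    to them returns its own components. *)
Lemma tvec_inj c u w z : atlas c -> cdom c u -> tvec c u w = tvec c u z -> w = z.
Proof.
have [m [e [l [lc le]]]] := fV => ac cu E.
rewrite (le w) (le z); apply: eq_bigr => i _; congr (_ *: _).
by rewrite -(tvec_coord w (lc i) ac cu) E tvec_coord.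
Qed.

End Tangent.

(** * Smooth maps and tangent maps in charts *)

Section SmoothMaps.
Context {R : realType} {V W : normedModType R} (fV : findim V) (fW : findim W).
Context {M : mfd V} {N : mfd W} (gM : good_atlas M) (gN : good_atlas N).
Implicit Types (c : chart V M) (d : chart W N) (F : M -> N).

(* The indicator function of the domain of [d] is a smooth germ at [F x]; its
   pullback is continuous, so that [F] maps a neighbourhood of [x] into that
   domain. *)
Lemma smooth_map_chart F c u d v : smooth_map_at F (cpar c u) ->
  atlas c -> cdom c u -> atlas d -> cdom d v -> cpar d v = F (cpar c u) ->
  exists k : V -> W, [/\ smooth_near k u, k u = v &
    \forall u' \near u, cdom d (k u') /\ cpar d (k u') = F (cpar c u')].
Proof.
move=> sF ac cu ad dv dF.
pose I y : R := `[< exists u, cdom d u /\ cpar d u = y >]%:R.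
have sI : smooth_at I (F (cpar c u)).
  rewrite -dF; apply/smooth_atP => //.
  apply: smooth_ext (smooth_cst (1 : R^o) v).
  apply: filterS (chart_near gN ad dv) => z dz.
  by rewrite /I /= asboolT //; exists z.
have sIF : smooth_near (I \o F \o cpar c : V -> R^o) u.
  by apply/(smooth_atP fV gM) => //; exact: sF.
have In : \forall z \near u, exists u', cdom d u' /\ cpar d u' = F (cpar c z).
  have I1 : \forall y \near ((I \o F \o cpar c) u : R^o), 0 < y.
    rewrite /I /= asboolT; last by exists v.
    exact: (@lt_nbhsr _ (0:R) 1).
  have := smooth_near_comp sIF I1.
  by apply: filterS => z; rewrite /I /=; case: asboolP => //; rewrite ltxx.
have [m [e [l [lc le]]]] := fW.
pose k z := cinv d (F (cpar c z)).
exists k; split; last by apply: filterS In => z /cinvP.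
- have H i : smooth_near (fun z => l i (k z)) u.
    have := coord_smooth fW gN (lc i) ad dv; rewrite dF => /sF.
    by move=> /(smooth_atP fV gM _ ac cu).
  have := smooth_sum (fun i => smooth_scale (H i) (smooth_cst (e i) u)).
  by apply: smooth_ext; near=> z; rewrite [in RHS](le (k z)).
- by rewrite /k -dF; exact: cinvK.
Unshelve. all: by end_near. Qed.

Lemma chart_smooth_map F c u d (k : V -> W) :
  atlas c -> cdom c u -> atlas d -> smooth_near k u ->
  (\forall u' \near u, cdom d (k u') /\ cpar d (k u') = F (cpar c u')) ->
  smooth_map_at F (cpar c u).
Proof.
move=> ac cu ad sk kn f; have [dk e] := nbhs_singleton kn.
rewrite -e => /(smooth_atP fW gN) => /(_ ad dk) H.
apply/(smooth_atP fV gM) => //.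
apply: smooth_ext (smooth_comp fW sk H).
by apply: filterS kn => z [_ E]; rewrite /= E.
Qed.

Lemma tmap_tvec F c u d (k : V -> W) w :
  atlas c -> cdom c u -> atlas d -> smooth_near k u ->
  (\forall u' \near u, cdom d (k u') /\ cpar d (k u') = F (cpar c u')) ->
  tmap F (cpar c u) (tvec c u w) = tvec d (k u) ('D_w k u).
Proof.
move=> ac cu ad sk kn; have [dk e] := nbhs_singleton kn.
have sF := chart_smooth_map ac cu ad sk kn.
apply/funext => f; rewrite /tmap; case: asboolP => H; last first.
  by rewrite tvec_junk // e.
have H' := sF _ H.
rewrite !tvecE ?e // -(@derive_chain _ _ _ _ k (f \o cpar d : W -> R^o)).
- by apply: near_eq_derive; apply: filterS kn => z [_ E]; rewrite /= E.
- exact: smooth_diff.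
- by apply: (tvec_diff fW gN) => //; rewrite e.
Qed.

Lemma tmap_tangent F x v : smooth_map_at F x -> tangent x v ->
  tangent (F x) (tmap F x v).
Proof.
move=> sF [c [u [w [ac cu cx ->]]]]; rewrite -cx in sF *.
have [d [z [ad dz dF]]] := ga_cover gN (F (cpar c u)).
have [k [sk kz kn]] := smooth_map_chart sF ac cu ad dz dF.
by rewrite (tmap_tvec _ ac cu ad sk kn) -dF kz; exact: tangent_tvec.
Qed.

End SmoothMaps.

(** * Vector fields *)

Section VectorFields.
Context {R : realType} {V : normedModType R} (fV : findim V).
Context {M : mfd V} (gM : good_atlas M).
Implicit Types (c d : chart V M) (f g : M -> R) (x : M) (X Y : vfield M).

Lemma vfield_tangent X x : is_vfield X -> tangent x (X x).
Proof.
move=> HX; have [c [u [ac cu <-]]] := ga_cover gM x.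
have [w Hw] := HX c ac; have [_ ->] := Hw u cu.
exact: tangent_tvec.
Qed.

Lemma vapp_smooth X x f : is_vfield X -> smooth_at f x -> smooth_at (vapp X f) x.
Proof.
move=> HX; have [c [u [ac cu <-]]] := ga_cover gM x.
have [w Hw] := HX c ac; have [sw _] := Hw u cu.
move=> sf; have /(smooth_atP fV gM) := sf => /(_ ac cu) sf'.
apply/(smooth_atP fV gM) => //.
apply: smooth_ext (smooth_derive_var fV (smooth_id u) sw sf').
have nf := mnear_chart gM (smooth_at_near fV gM sf) ac cu erefl.
apply: filterS2 (chart_near gM ac cu) nf => z cz fz.
by rewrite /vapp /= (Hw z cz).2 tvecE.
Qed.

Lemma vapp_chart X c (w : V -> V) u f : atlas c -> cdom c u ->
  (\forall z \near u, X (cpar c z) = tvec c z (w z)) ->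
  smooth_at f (cpar c u) ->
  \forall z \near u, vapp X f (cpar c z) = 'D_(w z) (f \o cpar c : V -> R^o) z.
Proof.
move=> ac cu Xn sf.
have nf := mnear_chart gM (smooth_at_near fV gM sf) ac cu erefl.
by apply: filterS2 Xn nf => z Xz fz; rewrite /vapp Xz tvecE.
Qed.

(* By injectivity of the charts the local coefficients are determined by [X]. *)
Lemma vfield_local X :
  (forall c u, atlas c -> cdom c u -> exists w : V -> V, smooth_near w u /\
     \forall z \near u, X (cpar c z) = tvec c z (w z)) ->
  is_vfield X.
Proof.
move=> H c ac.
have H' u : exists w, cdom c u -> X (cpar c u) = tvec c u w.
  have [cu|ncu] := pselect (cdom c u); last by exists 0.
  have [w [_ Hw]] := H c u ac cu; exists (w u) => _; exact: nbhs_singleton Hw.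
have [w Hw] := choice H'; exists w => u cu; split; last exact: Hw.
have [w' [sw' Hw']] := H c u ac cu.
apply: smooth_ext sw'; apply: filterS2 (chart_near gM ac cu) Hw' => z cz E.
apply: (tvec_inj fV gM ac cz); rewrite -E; exact: Hw.
Qed.

Lemma vfield_add X Y : is_vfield X -> is_vfield Y -> is_vfield (vadd X Y).
Proof.
move=> HX HY c ac; have [w Hw] := HX c ac; have [z Hz] := HY c ac.
exists (fun u => w u + z u) => u cu; have [sw Xu] := Hw u cu.
have [sz Yu] := Hz u cu; split; first exact: smooth_add.
by apply/funext => f; rewrite /vadd Xu Yu (tvecD fV gM).
Qed.

Lemma vfield_mul (h : M -> R) X : (forall x, smooth_at h x) -> is_vfield X ->
  is_vfield (vmul h X).
Proof.
move=> sh HX c ac; have [w Hw] := HX c ac.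
exists (fun u => h (cpar c u) *: w u) => u cu; have [sw Xu] := Hw u cu.
split; last by apply/funext => f; rewrite /vmul Xu (tvecZ fV gM).
apply: (smooth_scale (h := h \o cpar c : V -> R^o)) => //.
by apply/(smooth_atP fV gM).
Qed.

Lemma vfield_scale a X : is_vfield X -> is_vfield (vscale a X).
Proof. by apply: vfield_mul => x; exact: (smooth_at_cst fV gM). Qed.

Lemma vfield_zero : is_vfield (vzero M).
Proof.
move=> c ac; exists (fun _ => 0) => u cu; split; first exact: smooth_cst.
by apply/funext => f; rewrite tvec0.
Qed.

Lemma vfield_sum n (X : 'I_n -> vfield M) : (forall i, is_vfield (X i)) ->
  is_vfield (fun x f => \sum_i X i x f).
Proof.
elim: n X => [|n IH] X H.
  have := vfield_zero; congr is_vfield.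
  by apply/funext => x; apply/funext => f; rewrite big_ord0.
have := vfield_add (H ord0) (IH _ (fun i => H (lift ord0 i))).
congr is_vfield; apply/funext => x; apply/funext => f.
by rewrite /vadd big_ord_recl.
Qed.

(** Product rule for a derivative whose direction and base point both move: one term for the base
    point with the direction frozen, one for the direction. It computes brackets in charts, the
    action of tangent vectors of TM on [df], and the derivative of left translation on TG. *)
Lemma derive_derive_var (U W : normedModType R) (h : V -> W) (k : U -> V) (b : U -> V) (u a : U) :
  smooth_near h (b u) -> smooth_near k u -> smooth_near b u ->
  'D_a (fun z => 'D_(k z) h (b z)) u =
  'D_('D_a b u) ('D_(k u) h) (b u) + 'D_('D_a k u) h (b u)
.
Proof.
move=> sh sk sb; have [m [e [l [lc le]]]] := fV.
have dn : \forall z \near u, differentiable h (b z).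
  have := smooth_near_comp sb (smooth_near_near sh).
  by apply: filterS => z; exact: smooth_diff.
have dn' : \forall z \near b u, differentiable h z.
  by have := smooth_near_near sh; apply: filterS => z; exact: smooth_diff.
transitivity ('D_a (\sum_i (fun z => l i (k z) *: 'D_(e i) h (b z))) u).
  apply: near_eq_derive; apply: filterS dn => z dz.
  rewrite [in LHS](le (k z)) deriveDir_sum // fct_sumE.
  by apply: eq_bigr => i _; rewrite deriveDirZ.
have sl i : smooth_near (fun z => l i (k z)) u by exact: smooth_linpost.
have sd i : smooth_near (fun z => 'D_(e i) h (b z)) u.
  by apply: (smooth_comp (h := 'D_(e i) h)) => //; exact: smooth_derive.
rewrite derive_sum; last first.
  by move=> i; apply/diff_derivable/smooth_diff/smooth_scale.
have E i : 'D_a (fun z => l i (k z) *: 'D_(e i) h (b z)) u =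
   l i (k u) *: 'D_('D_a b u) ('D_(e i) h) (b u) + l i ('D_a k u) *: 'D_(e i) h (b u).
  rewrite derive_scale; [|exact: smooth_diff (sl i)|exact: smooth_diff (sd i)].
  rewrite (@derive_chain _ _ _ _ b ('D_(e i) h)); last 2 first.
  - exact: smooth_diff.
  - exact/smooth_diff/smooth_derive.
  by rewrite (@derive_linpost _ _ _ _ k (l i)) //; exact: smooth_diff.
under eq_bigr => i _ do rewrite E.
rewrite big_split /=; congr (_ + _); last first.
  rewrite [in RHS](le ('D_a k u)) deriveDir_sum; last exact: smooth_diff.
  by apply: eq_bigr => i _; rewrite deriveDirZ //; exact: smooth_diff.
(* The coefficients are frozen at [k u], so the sum is again the derivative of [h] in one constant
   direction. *)
transitivity ('D_('D_a b u) (\sum_i (fun z => l i (k u) *: 'D_(e i) h z)) (b u)).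
  rewrite derive_sum; last first.
    move=> i; apply/diff_derivable/smooth_diff/smooth_scale.
      exact: smooth_cst.
    exact: smooth_derive.
  apply: eq_bigr => i _; rewrite derive_scale.
  - by rewrite derive_cst scale0r addr0.
  - exact: differentiable_cst.
  - exact/smooth_diff/smooth_derive.
apply: near_eq_derive; apply: filterS dn' => z dz.
rewrite [in RHS](le (k u)) deriveDir_sum // fct_sumE.
by apply: eq_bigr => i _; rewrite deriveDirZ.
Qed.

Lemma bracketE X Y x f : smooth_at f x ->
  bracket X Y x f = X x (vapp Y f) - Y x (vapp X f).
Proof. by move=> H; rewrite /bracket asboolT. Qed.

Lemma bracket_chart X Y c (w z : V -> V) u : atlas c -> cdom c u ->
  smooth_near w u -> smooth_near z u ->
  (\forall u' \near u, X (cpar c u') = tvec c u' (w u')) ->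
  (\forall u' \near u, Y (cpar c u') = tvec c u' (z u')) ->
  bracket X Y (cpar c u) = tvec c u ('D_(w u) z u - 'D_(z u) w u).
Proof.
move=> ac cu sw sz Xn Yn; apply/funext => f.
have [sf|nf] := pselect (smooth_at f (cpar c u)); last first.
  by rewrite tvec_junk // /bracket asboolF.
have sh : smooth_near (f \o cpar c : V -> R^o) u by apply/(smooth_atP fV gM).
rewrite bracketE // (nbhs_singleton Xn) (nbhs_singleton Yn).
have E X1 Y1 (w1 z1 : V -> V) : smooth_near z1 u ->
    (\forall u' \near u, X1 (cpar c u') = tvec c u' (w1 u')) ->
    (\forall u' \near u, Y1 (cpar c u') = tvec c u' (z1 u')) ->
    tvec c u (w1 u) (vapp Y1 f) =
    'D_(w1 u) ('D_(z1 u) (f \o cpar c : V -> R^o)) u +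
    'D_('D_(w1 u) z1 u) (f \o cpar c : V -> R^o) u.
  move=> sz1 X1n Y1n.
  have nE := vapp_chart ac cu Y1n sf.
  have sV : smooth_at (vapp Y1 f) (cpar c u).
    apply/(smooth_atP fV gM) => //.
    apply: smooth_ext (smooth_derive_var fV (smooth_id u) sz1 sh).
    by apply: filterS nE => v <-.
  rewrite tvecE // -[in RHS](@derive_id _ _ u (w1 u)).
  rewrite derive_id.
  have := derive_derive_var (w1 u) sh sz1 (smooth_id u).
  rewrite derive_id => <-.
  exact: near_eq_derive.
(* The two second-order terms cancel by symmetry, which leaves a first-order operator, that is a
   tangent vector. *)
rewrite (E X Y w z) // (E Y X z w) // (derive_swap _ _ sh).
rewrite opprD addrACA subrr add0r tvecE //.
rewrite deriveDirD; last exact: smooth_diff.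
congr (_ + _); have := deriveDirZ ('D_(z u) w u) (-1) (smooth_diff sh).
by rewrite !scaleN1r => ->.
Qed.

Lemma bracket_vfield X Y : is_vfield X -> is_vfield Y -> is_vfield (bracket X Y).
Proof.
move=> HX HY; apply: vfield_local => c u ac cu.
have [w Hw] := HX c ac; have [z Hz] := HY c ac.
exists (fun v => 'D_(w v) z v - 'D_(z v) w v).
have [[sw _] [sz _]] := (Hw u cu, Hz u cu).
split.
  apply: smooth_add; first exact: (smooth_derive_var fV (smooth_id u)).
  have := smooth_scale (smooth_cst (-1 : R^o) u) (smooth_derive_var fV (smooth_id u) sz sw).
  by apply: smooth_ext; near=> v; rewrite scaleN1r.
have cn := near_near (chart_near gM ac cu).
apply: filterS cn => v cn; apply: bracket_chart => //.
- exact: nbhs_singleton cn.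
- exact: (Hw v (nbhs_singleton cn)).1.
- exact: (Hz v (nbhs_singleton cn)).1.
- by apply: filterS cn => v' /Hw[].
- by apply: filterS cn => v' /Hz[].
Unshelve. all: by end_near. Qed.

End VectorFields.

(** * Products and tangent bundles *)

Lemma near_fst (R : realType) (V W : normedModType R) (z : V * W) (P : V -> Prop) :
  (\forall u \near z.1, P u) -> \forall y \near z, P y.1.
Proof. exact: smooth_near_comp (smooth_fst z). Qed.

Lemma near_snd (R : realType) (V W : normedModType R) (z : V * W) (P : W -> Prop) :
  (\forall u \near z.2, P u) -> \forall y \near z, P y.2.
Proof. exact: smooth_near_comp (smooth_snd z). Qed.

Lemma open_near (R : realType) (V : normedModType R) (A : set V) :
  (forall u, A u -> \forall v \near u, A v) -> open A.
Proof. by move=> H; rewrite openE => u /H. Qed.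

Lemma line_good (R : realType) : good_atlas (line_mfd R).
Proof.
split.
- by move=> c ->; exact: openT.
- by move=> c u v ->.
- move=> c d u v -> -> _ _ uv; exists id; split=> //; first exact: smooth_id.
  by near=> z.
- by move=> x; eexists; exists x; split.
Unshelve. all: by end_near. Qed.

Section Product.
Context {R : realType} {V W : normedModType R} (fV : findim V) (fW : findim W).
Context {M : mfd V} {N : mfd W} (gM : good_atlas M) (gN : good_atlas N).

Definition prod_chart (c : chart V M) (d : chart W N) :
    chart (V * W)%type (prod_mfd M N) :=
  Chart (V := (V * W)%type) (T := prod_mfd M N)
    [set uv | cdom c uv.1 /\ cdom d uv.2] (fun uv => (cpar c uv.1, cpar d uv.2)).

Lemma prod_good : good_atlas (prod_mfd M N).
Proof.
split.
- move=> e [c [d [ac ad ->]]] /=; apply: open_near => uv [cu dv].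
  have H1 := near_fst (chart_near gM ac cu).
  have H2 := near_snd (chart_near gN ad dv).
  exact: filterI H1 H2.
- move=> e [u1 u2] [v1 v2] [c [d [ac ad ->]]] /= [cu dv] [cu' dv'] [E1 E2].
  by congr (_, _); [exact: (ga_inj gM ac)|exact: (ga_inj gN ad)].
- move=> e e' [u1 u2] [v1 v2] [c [d [ac ad ->]]] [c' [d' [ac' ad' ->]]] /=.
  move=> [cu dv] [cu' dv'] [E1 E2].
  have [tau [st tu tn]] := ga_compat gM ac ac' cu cu' E1.
  have [rho [sr ru rn]] := ga_compat gN ad ad' dv dv' E2.
  exists (fun z => (tau z.1, rho z.2)); split=> /=.
  + apply: smooth_pair.
      by apply: (smooth_comp (k := fst)) => //; exact: smooth_fst.
    by apply: (smooth_comp (k := snd)) => //; exact: smooth_snd.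
  + by rewrite tu ru.
  + have := near_snd (z := (u1, u2)) rn.
    apply: filterS2 (near_fst (z := (u1, u2)) tn) => z [H1 H2] [H3 H4].
    by split=> //; rewrite H2 H4.
- move=> [x y]; have [c [u [ac cu cx]]] := ga_cover gM x.
  have [d [v [ad dv dy]]] := ga_cover gN y.
  exists (prod_chart c d), (u, v); split=> //=; last by rewrite cx dy.
  by exists c, d.
Qed.

End Product.

Section TangentBundle.
Context {R : realType} {V : normedModType R} (fV : findim V).
Context {M : mfd V} (gM : good_atlas M).
Implicit Types (c d : chart V M) (f g : M -> R) (x : M) (X Y : vfield M).

Local Notation TM := (tangent_bundle M).

Lemma tptE (p0 : tpoint M) x v : tangent x v -> val (tpt p0 x v) = (x, v).
Proof. by move=> H; rewrite /tpt insubdK //; apply/asboolP. Qed.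

Lemma tbase_tpt (p0 : tpoint M) x v : tangent x v ->
  tbase (tpt p0 x v : TM) = x.
Proof. by move=> H; rewrite /tbase tptE. Qed.

Lemma tfib_tpt (p0 : tpoint M) x v : tangent x v ->
  tfib (tpt p0 x v : TM) = v.
Proof. by move=> H; rewrite /tfib tptE. Qed.

Lemma tangent_tfib (p : TM) : tangent (tbase p) (tfib p).
Proof. exact: (asboolW (valP (p : tpoint M))). Qed.

Lemma tpoint_eq (p q : TM) : tbase p = tbase q -> tfib p = tfib q -> p = q.
Proof.
rewrite /tbase /tfib => E1 E2; apply: val_inj.
by case: (val p) (val q) E1 E2 => [? ?] [? ?] /= -> ->.
Qed.

(** [p0] is the default value of [tpt]; on the domain of the chart the pair is tangent and the
    default is never taken. *)
Definition tchart c (p0 : tpoint M) : chart (V * V)%type TM :=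
  Chart (V := (V * V)%type) (T := TM) [set uw | cdom c uw.1]
    (fun uw => tpt p0 (cpar c uw.1) (tvec c uw.1 uw.2)).

Lemma atlas_tchart c p0 : atlas c -> atlas (tchart c p0).
Proof. by move=> ac; exists c, p0. Qed.

Lemma tbase_tchart c p0 z : atlas c -> cdom c z.1 ->
  tbase (cpar (tchart c p0) z) = cpar c z.1.
Proof. by move=> ac cz; apply: tbase_tpt; exact: tangent_tvec. Qed.

Lemma tfib_tchart c p0 z : atlas c -> cdom c z.1 ->
  tfib (cpar (tchart c p0) z) = tvec c z.1 z.2.
Proof. by move=> ac cz; apply: tfib_tpt; exact: tangent_tvec. Qed.

Lemma tchart_eq c (p0 : tpoint M) u w (p : TM) : atlas c -> cdom c u ->
  tbase p = cpar c u -> tfib p = tvec c u w -> cpar (tchart c p0) (u, w) = p.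
Proof.
move=> ac cu E1 E2; apply: tpoint_eq; first by rewrite tbase_tchart.
by rewrite tfib_tchart.
Qed.

Lemma tchart_cover_at (p0 : tpoint M) (p : TM) c u : atlas c -> cdom c u ->
  cpar c u = tbase p ->
  exists w, tfib p = tvec c u w /\ cpar (tchart c p0) (u, w) = p.
Proof.
move=> ac cu cx; have [w E] := tangent_chart fV gM (tangent_tfib p) ac cu cx.
by exists w; split=> //; exact: tchart_eq.
Qed.

Lemma tchart_cover (p0 : tpoint M) (p : TM) : exists c u w,
  [/\ atlas c, cdom c u, tbase p = cpar c u, tfib p = tvec c u w &
      cpar (tchart c p0) (u, w) = p].
Proof.
have [c [u [ac cu cx]]] := ga_cover gM (tbase p).
have [w [E E']] := tchart_cover_at p0 ac cu cx.
by exists c, u, w.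
Qed.

(* The representation of [p |-> (F (tbase p), T F (tfib p))] when [k]
   represents [F]. *)
Definition tlift (U W : normedModType R) (k : U -> W) (z : U * U) : W * W :=
  (k z.1, 'D_(z.2) k z.1).

Lemma smooth_tlift (U W : normedModType R) (k : U -> W) z :
  findim U -> smooth_near k z.1 -> smooth_near (tlift k) z.
Proof.
move=> fU sk; apply: smooth_pair.
  by apply: (smooth_comp (k := fst)) => //; exact: smooth_fst.
apply: (smooth_derive_var (k := fst) (d := snd)) => //.
  exact: smooth_fst.
exact: smooth_snd.
Qed.

(** Coordinate changes of the tangent bundle are the lifts [tlift tau] of those of [M]; injectivity
    on fibres is [tvec_inj]. *)
Lemma tangent_bundle_good : good_atlas TM.
Proof.
split.
- move=> e [c [p0 [ac ->]]] /=; apply: open_near => z cz.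
  exact: near_fst (chart_near gM ac cz).
- move=> e [u w] [u' w'] [c [p0 [ac ->]]] /= cu cu' E.
  have E1 := congr1 (@tbase _ _ M) E.
  have E2 := congr1 (@tfib _ _ M) E.
  rewrite !tbase_tpt in E1; do ?exact: tangent_tvec.
  have uu := ga_inj gM ac cu cu' E1; rewrite -uu in E2 *.
  rewrite !tfib_tpt in E2; do ?exact: tangent_tvec.
  by congr (_, _); exact: (tvec_inj fV gM ac cu E2).
- move=> e e' [u w] [u' w'] [c [p0 [ac ->]]] [d [q0 [ad ->]]] /= cu du' E.
  have E1 := congr1 (@tbase _ _ M) E.
  have E2 := congr1 (@tfib _ _ M) E.
  rewrite !tbase_tpt in E1; do ?exact: tangent_tvec.
  rewrite !tfib_tpt in E2; do ?exact: tangent_tvec.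
  have [tau [st tu tn]] := ga_compat gM ac ad cu du' E1.
  exists (tlift tau); split.
  + exact: smooth_tlift.
  + congr (_, _) => //=; apply: (tvec_inj fV gM ad du').
    by rewrite -E2 -tu; symmetry; apply: tvec_change.
  + have H : \forall a \near u, [/\ \forall a' \near a,
        cdom d (tau a') /\ cpar d (tau a') = cpar c a', smooth_near tau a & cdom c a].
      apply: filterS3 (near_near tn) (smooth_near_near st) (chart_near gM ac cu).
      by move=> a.
    have := near_fst (z := (u, w)) H; apply: filterS => -[a b] /= [tna sta ca].
    have [da Ea] := nbhs_singleton tna; split=> //.
    have Ev : tvec c a b = tvec d (tau a) ('D_b tau a) by exact: tvec_change.
    by apply: tpoint_eq; rewrite ?tbase_tpt ?tfib_tpt; do ?exact: tangent_tvec.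
- move=> p; have [c [u [w [ac cu _ _ E]]]] := tchart_cover p p.
  by exists (tchart c p), (u, w); split=> //; exact: atlas_tchart.
Qed.

End TangentBundle.

(** * The Levi-Civita connection of an orthonormal frame *)

Section Riemannian.
Context {R : realType} {V : normedModType R} (fV : findim V).
Context {M : mfd V} (gM : good_atlas M).
Context {g : metric M} (hg : is_riemannian g).
Implicit Types (c : chart V M) (f : M -> R) (x : M) (X Y Z : vfield M).

Lemma metric0l x z : tangent x z -> g x (fun _ => 0) z = 0.
Proof.
move=> tz; have t0 := tangent0 gM x.
rewrite -[RHS](mul0r (g x (fun _ => 0) z)) -(riem_scale hg) //.
by congr (g x _ z); apply/funext => f; rewrite mul0r.
Qed.

Lemma metric_suml x n (a : 'I_n -> R) (v : 'I_n -> tfun M) z :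
  (forall i, tangent x (v i)) -> tangent x z ->
  g x (fun f => \sum_i a i * v i f) z = \sum_i a i * g x (v i) z.
Proof.
move=> tv tz; elim: n a v tv => [|n IH] a v tv.
  rewrite big_ord0 -[RHS](metric0l tz).
  by congr (g x _ z); apply/funext => f; rewrite big_ord0.
rewrite big_ord_recl -IH // -(riem_scale hg) // -(riem_add hg) //.
- by congr (g x _ z); apply/funext => f; rewrite big_ord_recl.
- exact: (tangentZ fV gM).
- by apply: (tangent_sum fV gM) => i; exact: (tangentZ fV gM).
Qed.

Lemma metric_sumr x n (a : 'I_n -> R) (v : 'I_n -> tfun M) z :
  (forall i, tangent x (v i)) -> tangent x z ->
  g x z (fun f => \sum_i a i * v i f) = \sum_i a i * g x z (v i).
Proof.
move=> tv tz; rewrite (riem_sym hg) //; last first.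
  by apply: (tangent_sum fV gM) => i; exact: (tangentZ fV gM).
by rewrite metric_suml //; apply: eq_bigr => i _; rewrite (riem_sym hg).
Qed.

Lemma minner_sym X Y : is_vfield X -> is_vfield Y -> minner g X Y = minner g Y X.
Proof.
move=> HX HY; apply/funext => x.
by apply: (riem_sym hg); exact: (vfield_tangent gM).
Qed.

(** Smoothness of a metric is given only on fields with constant chart coefficients, so both fields
    are expanded bilinearly in a coordinate basis. *)
Lemma minner_smooth X Y x : is_vfield X -> is_vfield Y -> smooth_at (minner g X Y) x.
Proof.
move=> HX HY; have [c [u [ac cu <-]]] := ga_cover gM x.
have [w Hw] := HX c ac; have [z Hz] := HY c ac.
have [[sw _] [sz _]] := (Hw u cu, Hz u cu).
have [m [e [l [lc le]]]] := fV.
apply/(smooth_atP fV gM) => //.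
have H i j : smooth_near (fun v => (l i (w v) * l j (z v)) *
   g (cpar c v) (tvec c v (e i)) (tvec c v (e j)) : R^o) u.
  apply: smooth_mul; last exact: (riem_smooth hg).
  by apply: smooth_mul; exact: smooth_linpost.
apply: smooth_ext (smooth_sum (fun i => smooth_sum (H i))).
apply: filterS (chart_near gM ac cu) => v cv.
rewrite /minner /= (Hw v cv).2 (Hz v cv).2.
have tt b : tangent (cpar c v) (tvec c v b) by exact: tangent_tvec.
have E b : tvec c v b = fun f => \sum_i l i b * tvec c v (e i) f.
  apply/funext => f; rewrite {1}(le b) (tvec_sum fV gM) //.
  by apply: eq_bigr => i _; rewrite (tvecZ fV gM).
rewrite [in RHS](E (w v)) metric_suml //; apply: eq_bigr => i _.
rewrite [in RHS](E (z v)) metric_sumr // mulr_sumr.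
by apply: eq_bigr => j _; rewrite mulrA.
Qed.

End Riemannian.

Section Frame.
Context {R : realType} {V : normedModType R} (fV : findim V).
Context {M : mfd V} (gM : good_atlas M).
Context {g : metric M} (hg : is_riemannian g).
Context {n : nat} (E : 'I_n -> vfield M) (C : 'I_n -> 'I_n -> 'I_n -> R).
Hypothesis vE : forall i, is_vfield (E i).
Hypothesis orthE : forall i j x, g x (E i x) (E j x) = (i == j)%:R.
Hypothesis spanE : forall x v, tangent x v ->
  exists a : 'I_n -> R, v = fun f => \sum_i a i * E i x f.
Hypothesis bracketEE : forall i j x f,
  bracket (E i) (E j) x f = \sum_k C i j k * E k x f.
Hypothesis antiC : forall i j k, C i j k = - C j i k.
Implicit Types (X Y Z : vfield M) (x : M).

Let tE i x : tangent x (E i x). Proof. exact: (vfield_tangent gM). Qed.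

(** The Koszul formula for an orthonormal frame, where inner products are constant and only the
    three bracket terms remain. Skewness in the last two indices ([gam_anti]) will give metric
    compatibility, [gam_torsion] zero torsion. *)
Definition christoffel i j k : R := (C i j k - C j k i + C k i j) / 2.

Let gam_anti i j k : christoffel i j k = - christoffel i k j.
Proof.
rewrite /christoffel (antiC i k j) (antiC k j i) (antiC j i k); lra.
Qed.

Let gam_torsion i j k : christoffel i j k = christoffel j i k + C i j k.
Proof.
rewrite /christoffel (antiC j i k) (antiC i k j) (antiC k j i); lra.
Qed.

Let co X k : M -> R := minner g X (E k).

(** The extension of [nabla (E i) (E j) = \sum_k christoffel i j k * E k] to all fields by the
    Leibniz rule, with [co X k] as the coefficient of [X] along [E k]. *)
Definition frame_nabla X Y : vfield M := fun x f =>
  \sum_k (X x (co Y k) + \sum_i \sum_j co X i x * co Y j x * christoffel i j k)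
         * E k x f.

Let co_comb (h : 'I_n -> M -> R) k x :
  co (fun x f => \sum_i h i x * E i x f) k x = h k x.
Proof.
rewrite /co /minner (metric_suml fV gM hg) // (bigD1 k) //= orthE eqxx mulr1.
by rewrite big1 ?addr0 // => i ik; rewrite orthE (negbTE ik) mulr0.
Qed.

Let expand X x f : is_vfield X -> X x f = \sum_k co X k x * E k x f.
Proof.
move=> HX; have [a Ha] := spanE (vfield_tangent gM x HX).
rewrite Ha; apply: eq_bigr => k _; congr (_ * _).
rewrite /co /minner Ha (metric_suml fV gM hg) // (bigD1 k) //= orthE eqxx mulr1.
by rewrite big1 ?addr0 // => i ik; rewrite orthE (negbTE ik) mulr0.
Qed.

Let expand_fun X : is_vfield X -> X = fun x f => \sum_k co X k x * E k x f.
Proof. by move=> HX; apply/funext => x; apply/funext => f; exact: expand. Qed.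

Let inner_comb X Y x : is_vfield X -> is_vfield Y ->
  minner g X Y x = \sum_k co X k x * co Y k x.
Proof.
move=> HX HY; rewrite /minner [X in g x (X x)](expand_fun HX).
rewrite (metric_suml fV gM hg) //; last exact: (vfield_tangent gM).
apply: eq_bigr => k _; congr (_ * _).
by rewrite /co (minner_sym gM hg HY).
Qed.

Let co_smooth X k x : is_vfield X -> smooth_at (co X k) x.
Proof. by move=> HX; exact: (minner_smooth fV gM hg). Qed.

Let nabla_vfield X Y : is_vfield X -> is_vfield Y -> is_vfield (frame_nabla X Y).
Proof.
move=> HX HY.
apply: (vfield_sum fV gM (X := fun k => vmul _ (E k))) => k.
apply: (vfield_mul fV gM) => // x.
apply: (smooth_at_add fV gM).
  by apply: (vapp_smooth fV gM) => //; exact: co_smooth.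
apply: (smooth_at_sum fV gM) => i; apply: (smooth_at_sum fV gM) => j.
apply: (smooth_at_mul fV gM); last exact: (smooth_at_cst fV gM).
by apply: (smooth_at_mul fV gM); exact: co_smooth.
Qed.

Let co_add X X' k x : is_vfield X -> is_vfield X' ->
  co (vadd X X') k x = co X k x + co X' k x.
Proof.
move=> HX HX'; rewrite /co /minner; apply: (riem_add hg) => //.
- exact: (vfield_tangent gM).
- exact: (vfield_tangent gM).
Qed.

Let co_mul f X k x : is_vfield X -> co (vmul f X) k x = f x * co X k x.
Proof.
move=> HX; rewrite /co /minner; apply: (riem_scale hg) => //.
exact: (vfield_tangent gM).
Qed.

Let nabla_connection : is_connection frame_nabla.
Proof.
split; first exact: nabla_vfield.
- move=> X X' Y HX HX' HY; apply/funext => x; apply/funext => f.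
  rewrite /frame_nabla /vadd -big_split /=; apply: eq_bigr => k _.
  rewrite -mulrDl; congr (_ * _); rewrite addrACA; congr (_ + _).
  rewrite -big_split /=; apply: eq_bigr => i _.
  rewrite -big_split /=; apply: eq_bigr => j _.
  by rewrite co_add // !mulrDl.
- move=> h X Y sh HX HY; apply/funext => x; apply/funext => f.
  rewrite /frame_nabla /vmul mulr_sumr; apply: eq_bigr => k _.
  rewrite mulrA; congr (_ * _); rewrite mulrDr; congr (_ + _).
  rewrite mulr_sumr; apply: eq_bigr => i _.
  rewrite mulr_sumr; apply: eq_bigr => j _.
  by rewrite co_mul // !mulrA.
- move=> X Y Y' HX HY HY'; apply/funext => x; apply/funext => f.
  rewrite /frame_nabla {3}/vadd -big_split /=; apply: eq_bigr => k _.
  rewrite -mulrDl; congr (_ * _); rewrite addrACA; congr (_ + _).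
    rewrite -(tangent_addf fV gM (vfield_tangent gM x HX)) //; try exact: co_smooth.
    by congr (X x _); apply/funext => y; exact: co_add.
  rewrite -big_split /=; apply: eq_bigr => i _.
  rewrite -big_split /=; apply: eq_bigr => j _.
  by rewrite co_add // mulrDr mulrDl.
- move=> h X Y sh HX HY; apply/funext => x; apply/funext => f.
  rewrite /vadd {2 3}/vmul /vapp [Y x f]expand //.
  rewrite /frame_nabla !mulr_sumr -big_split /=; apply: eq_bigr => k _.
  rewrite !mulrA -mulrDl; congr (_ * _).
  have -> : co (vmul h Y) k = fun y => h y * co Y k y.
    by apply/funext => y; exact: co_mul.
  rewrite (tangent_mulf fV gM (vfield_tangent gM x HX)) //; last exact: co_smooth.
  rewrite mulrDr addrA [h x * _ + _]addrC; congr (_ + _).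
  rewrite mulr_sumr; apply: eq_bigr => i _.
  rewrite mulr_sumr; apply: eq_bigr => j _.
  by rewrite co_mul //; ring.
Qed.

Let nabla_metric X Y Z x : is_vfield X -> is_vfield Y -> is_vfield Z ->
  vapp Z (minner g X Y) x
    = minner g (frame_nabla Z X) Y x + minner g X (frame_nabla Z Y) x.
Proof.
move=> HX HY HZ; rewrite !inner_comb //; try exact: nabla_vfield.
rewrite /vapp.
have -> : minner g X Y = fun x => \sum_k co X k x * co Y k x.
  by apply/funext => y; exact: inner_comb.
have tZ := vfield_tangent gM x HZ.
rewrite (tangent_sumf fV gM tZ); last first.
  by move=> i; apply: (smooth_at_mul fV gM); exact: co_smooth.
have En A k : co (frame_nabla Z A) k x = Z x (co A k) +
   \sum_i \sum_j co Z i x * co A j x * christoffel i j k.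
  exact: (co_comb (fun k x => Z x (co A k) +
   \sum_i \sum_j co Z i x * co A j x * christoffel i j k)).
under [X in _ = X + _]eq_bigr => k _ do rewrite En mulrDl.
under [X in _ = _ + X]eq_bigr => k _ do rewrite En mulrDr.
(* What is split off here are the Christoffel terms of the two inner products; they cancel pairwise
   by skewness in the last two indices. The rest is the Leibniz rule for the coefficients. *)
rewrite !big_split /= addrACA -big_split /= [X in _ = _ + X](_ : _ = 0).
  rewrite addr0; apply: eq_bigr => k _.
  rewrite (tangent_mulf fV gM tZ); try exact: co_smooth.
  by rewrite addrC.
under [X in X + _]eq_bigr => k _ do rewrite mulr_suml.
under [X in _ + X]eq_bigr => k _ do rewrite mulr_sumr.
rewrite [X in X + _]exchange_big [X in _ + X]exchange_big /=.
rewrite -big_split big1 //= => i _.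
under [X in X + _]eq_bigr => k _ do rewrite mulr_suml.
under [X in _ + X]eq_bigr => k _ do rewrite mulr_sumr.
rewrite [X in X + _]exchange_big -big_split big1 //= => k _.
rewrite -big_split big1 //= => j _.
rewrite [christoffel i k j]gam_anti; ring.
Qed.

Let nabla_torsion X Y : is_vfield X -> is_vfield Y ->
  frame_nabla X Y = vadd (frame_nabla Y X) (bracket X Y).
Proof.
move=> HX HY; apply/funext => x; apply/funext => f.
have [sf|nf] := pselect (smooth_at f x); last first.
  rewrite /vadd /frame_nabla /bracket asboolF // addr0.
  by rewrite !big1 // => k _; rewrite (tangent_junk (tE k x)) ?mulr0.
have tX := vfield_tangent gM x HX; have tY := vfield_tangent gM x HY.
rewrite /vadd bracketE //.
(* [A (B f)] consists of a part that differentiates the coefficients of [B] and a second-order part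
   in the frame; antisymmetrised, the latter becomes the brackets of the frame fields. *)
have D A B : is_vfield A -> is_vfield B -> A x (vapp B f) =
   \sum_k A x (co B k) * E k x f +
   \sum_i \sum_k co A i x * co B k x * E i x (vapp (E k) f).
  move=> HA HB; have tA := vfield_tangent gM x HA.
  have sEf k : smooth_at (vapp (E k) f) x by exact: (vapp_smooth fV gM).
  have -> : A x (vapp B f) = A x (fun y => \sum_k co B k y * vapp (E k) f y).
    by congr (A x _); apply/funext => y; exact: expand.
  rewrite (tangent_sumf fV gM tA); last first.
    by move=> k; apply: (smooth_at_mul fV gM) => //; exact: co_smooth.
  rewrite exchange_big -big_split /=; apply: eq_bigr => k _.
  rewrite (tangent_mulf fV gM tA) //; last exact: co_smooth.
  rewrite addrC; congr (_ + _); rewrite [A x _]expand // mulr_sumr.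
  by apply: eq_bigr => i _; ring.
have -> : X x (vapp Y f) - Y x (vapp X f) =
   \sum_k (X x (co Y k) - Y x (co X k)) * E k x f +
   \sum_i \sum_j co X i x * co Y j x * \sum_k C i j k * E k x f.
  rewrite !D // opprD addrACA -sumrB; congr (_ + _).
    by apply: eq_bigr => k _; rewrite mulrBl.
  rewrite [X in _ - X]exchange_big -sumrB; apply: eq_bigr => i _.
  rewrite -sumrB; apply: eq_bigr => j _.
  rewrite -bracketEE bracketE //; ring.
have -> : \sum_i \sum_j co X i x * co Y j x * (\sum_k C i j k * E k x f) =
   \sum_k (\sum_i \sum_j co X i x * co Y j x * C i j k) * E k x f.
  under [RHS]eq_bigr => k _ do rewrite mulr_suml.
  rewrite [RHS]exchange_big /=; apply: eq_bigr => i _.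
  under [RHS]eq_bigr => k _ do rewrite mulr_suml.
  rewrite [RHS]exchange_big /=; apply: eq_bigr => j _.
  by rewrite mulr_sumr; apply: eq_bigr => k _; ring.
rewrite /frame_nabla -!big_split /=; apply: eq_bigr => k _.
rewrite -!mulrDl; congr (_ * _).
have -> : \sum_i \sum_j co Y i x * co X j x * christoffel i j k =
   \sum_i \sum_j co X i x * co Y j x * christoffel j i k.
  rewrite exchange_big; apply: eq_bigr => i _; apply: eq_bigr => j _; ring.
have -> : \sum_i \sum_j co X i x * co Y j x * christoffel i j k =
   \sum_i \sum_j co X i x * co Y j x * christoffel j i k +
   \sum_i \sum_j co X i x * co Y j x * C i j k.
  rewrite -big_split; apply: eq_bigr => i _; rewrite -big_split.
  by apply: eq_bigr => j _; rewrite gam_torsion mulrDr.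
ring.
Qed.

Lemma frame_levi_civita : is_levi_civita g frame_nabla.
Proof. by split; [exact: nabla_connection|exact: nabla_torsion|exact: nabla_metric]. Qed.

(** For constant coefficients the derivative terms of [frame_nabla] vanish, and being parallel is a
    linear condition on the Christoffel symbols. *)
Lemma frame_parallel (X : vfield M) (a : 'I_n -> R) :
  (forall x f, X x f = \sum_j a j * E j x f) ->
  (forall i k, \sum_j a j * christoffel i j k = 0) -> is_parallel g X.
Proof.
move=> HX Ha; exists frame_nabla; first exact: frame_levi_civita.
have coX j : co X j = fun _ => a j.
  apply/funext => x; rewrite -(co_comb (fun i _ => a i) j x); congr (co _ _ _).
  by apply/funext => y; apply/funext => f.
move=> Y HY; apply/funext => x; apply/funext => f; apply: big1 => k _.
rewrite coX (tangent_cst fV gM _ (vfield_tangent gM x HY)) add0r big1 ?mul0r //.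
move=> i _; have := congr1 ( *%R (co Y i x)) (Ha i k).
rewrite mulr0 mulr_sumr => E0; rewrite -[RHS]E0; apply: eq_bigr => j _.
by rewrite coX mulrA.
Qed.

End Frame.

(** * Left invariant vector fields *)

Section Partial.
Context {R : realType}.
Implicit Types U V W : normedModType R.

Lemma smooth_pairr U V (a : U) (v : V) : smooth_near (fun v : V => (a, v)) v.
Proof. apply: smooth_pair; [exact: smooth_cst|exact: smooth_id]. Qed.

Lemma smooth_pairl U V (u : U) (b : V) : smooth_near (fun u : U => (u, b)) u.
Proof. apply: smooth_pair; [exact: smooth_id|exact: smooth_cst]. Qed.

Lemma derive_pairr U V W (m : U * V -> W) a b w : differentiable m (a, b) ->
  'D_w (fun v => m (a, v)) b = 'D_(0, w) m (a, b).
Proof.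
move=> dm; rewrite (@derive_chain _ _ _ _ (fun v => (a, v)) m) //.
  by rewrite derive_pair ?derive_cst ?derive_id //; exact/smooth_diff/smooth_id.
Qed.

Lemma derive_pairl U V W (m : U * V -> W) a b w : differentiable m (a, b) ->
  'D_w (fun u => m (u, b)) a = 'D_(w, 0) m (a, b).
Proof.
move=> dm; rewrite (@derive_chain _ _ _ _ (fun u => (u, b)) m) //.
  by rewrite derive_pair ?derive_cst ?derive_id //; exact/smooth_diff/smooth_id.
Qed.

Lemma near_pairr U V (a : U) (b : V) (P : U * V -> Prop) :
  (\forall z \near (a, b), P z) -> \forall v \near b, P (a, v).
Proof. exact: (smooth_near_comp (smooth_pairr a b)). Qed.

Lemma near_pairl U V (a : U) (b : V) (P : U * V -> Prop) :
  (\forall z \near (a, b), P z) -> \forall u \near a, P (u, b).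
Proof. exact: (smooth_near_comp (smooth_pairl a b)). Qed.

End Partial.

Section Brackets.
Context {R : realType} {V : normedModType R} (fV : findim V).
Context {M : mfd V} (gM : good_atlas M).
Implicit Types X Y Z : vfield M.

Lemma bracket_junk X Y x f : ~ smooth_at f x -> bracket X Y x f = 0.
Proof. by move=> H; rewrite /bracket asboolF. Qed.

Lemma bracket_anti X Y : bracket X Y = vscale (-1) (bracket Y X).
Proof.
apply/funext => x; apply/funext => f; rewrite /vscale /vmul.
have [sf|nf] := pselect (smooth_at f x); last by rewrite !bracket_junk // mulr0.
by rewrite !bracketE // mulN1r opprB.
Qed.

Lemma bracket_addl X Y Z : is_vfield X -> is_vfield Y -> is_vfield Z ->
  bracket (vadd X Y) Z = vadd (bracket X Z) (bracket Y Z).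
Proof.
move=> HX HY HZ; apply/funext => x; apply/funext => f; rewrite {2}/vadd.
have [sf|nf] := pselect (smooth_at f x); last by rewrite !bracket_junk // addr0.
rewrite !bracketE // {1}/vadd.
have -> : vapp (vadd X Y) f = fun y => vapp X f y + vapp Y f y by [].
rewrite (tangent_addf fV gM (vfield_tangent gM x HZ)).
- ring.
- exact: (vapp_smooth fV gM).
- exact: (vapp_smooth fV gM).
Qed.

Lemma bracket_scalel a X Z : is_vfield X -> is_vfield Z ->
  bracket (vscale a X) Z = vscale a (bracket X Z).
Proof.
move=> HX HZ; apply/funext => x; apply/funext => f; rewrite {2}/vscale /vmul.
have [sf|nf] := pselect (smooth_at f x); last by rewrite !bracket_junk // mulr0.
rewrite !bracketE // /vscale {1}/vmul.
have -> : vapp (vmul (fun _ => a) X) f = fun y => a * vapp X f y by [].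
rewrite (tangent_scalef fV gM _ (vfield_tangent gM x HZ)).
- ring.
- exact: (vapp_smooth fV gM).
Qed.

Lemma bracket_scaler a X Z : is_vfield X -> is_vfield Z ->
  bracket Z (vscale a X) = vscale a (bracket Z X).
Proof.
move=> HX HZ; rewrite bracket_anti bracket_scalel // (bracket_anti Z X).
by apply/funext => x; apply/funext => f; rewrite /vscale /vmul; ring.
Qed.

Lemma bracket_self X : bracket X X = vzero M.
Proof.
apply/funext => x; apply/funext => f.
have [sf|nf] := pselect (smooth_at f x); last by rewrite !bracket_junk.
by rewrite bracketE // subrr.
Qed.

End Brackets.

(** * Left translation and the Lie algebra of left invariant fields *)

Section LieGroup.
Context {R : realType} {V : normedModType R} (fV : findim V).
Context {G : mfd V} {mul : G -> G -> G} {inv : G -> G} {one : G}.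
Context (hG : is_lie_group mul inv one).
Implicit Types (c d e : chart V G) (X Y Z : vfield G).

Local Notation linv := (left_invariant_vfield mul).

Let gG : good_atlas G := manifold_good (lie_mfd hG).

Lemma mul_chart c u d v e z : atlas c -> cdom c u -> atlas d -> cdom d v ->
  atlas e -> cdom e z -> cpar e z = mul (cpar c u) (cpar d v) ->
  exists m : V * V -> V, [/\ smooth_near m (u, v), m (u, v) = z &
   \forall y \near (u, v), cdom e (m y) /\
      cpar e (m y) = mul (cpar c y.1) (cpar d y.2)].
Proof.
move=> ac cu ad dv ae ez E.
have sm : smooth_map_at (M := prod_mfd G G) (fun p => mul p.1 p.2)
    (cpar c u, cpar d v) by move=> f; exact: (lie_smooth_mul hG).
have fVV := findim_prod fV fV.
have gGG := prod_good fV fV gG gG.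
have acd : atlas (prod_chart c d) by exists c, d.
exact: (@smooth_map_chart _ _ _ fVV fV _ _ gGG gG (fun p => mul p.1 p.2)
  (prod_chart c d) (u, v) e z sm acd (conj cu dv) ae ez E).
Qed.

Lemma lmul_smooth a x : smooth_map_at (mul a) x.
Proof.
have [c [u [ac cu <-]]] := ga_cover gG a.
have [d [v [ad dv <-]]] := ga_cover gG x.
have [e [z [ae ez E]]] := ga_cover gG (mul (cpar c u) (cpar d v)).
have [m [sm mz mn]] := mul_chart ac cu ad dv ae ez E.
apply: (chart_smooth_map fV fV gG gG (k := fun y => m (u, y)) ad dv ae).
- apply: smooth_comp => //; [exact: findim_prod|exact: smooth_pairr].
- exact: near_pairr mn.
Qed.

Lemma tmap_comp (U W : normedModType R) (M : mfd U) (N : mfd W)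
    (F : M -> N) (H : N -> G) x v :
  smooth_map_at H (F x) -> tmap H (F x) (tmap F x v) = tmap (H \o F) x v.
Proof.
move=> sH; apply/funext => f; rewrite /tmap; case: asboolP => // sf.
by rewrite asboolT //; exact: sH.
Qed.

Definition lfield (v : tfun G) : vfield G := fun x => tmap (mul x) one v.

Let mul1 x : mul x one = x. Proof. exact: (lie_mul1 hG x).2. Qed.
Let mul1x x : mul one x = x. Proof. exact: (lie_mul1 hG x).1. Qed.

Lemma lfield_linv v : tangent one v -> linv (lfield v).
Proof.
move=> tv; split; last first.
  move=> a x; rewrite /lfield -{1}[x]mul1 (tmap_comp (F := mul x)); last exact: lmul_smooth.
  congr (tmap _ _ _); apply/funext => y /=; exact: lie_mulA hG a x y.
apply: (vfield_local fV gG) => c u ac cu.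
have [d [u0 [ad du0 E]]] := ga_cover gG one.
have [w Ew] := tangent_chart fV gG tv ad du0 E.
have Eu : cpar c u = mul (cpar c u) (cpar d u0) by rewrite E mul1.
have [m [sm mz mn]] := mul_chart ac cu ad du0 ac cu Eu.
(* The differential of [mul x] at [one] is a partial derivative of the multiplication [m] in its
   second factor, so it depends smoothly on [z]. Choosing [c] also as the target chart gives
   [m (z, u0) = z]. *)
exists (fun z => 'D_(0, w) m (z, u0)); split.
  apply: (smooth_comp (h := 'D_(0, w) m) (k := fun z => (z, u0))).
  - exact: findim_prod.
  - exact: smooth_pairl.
  - exact: smooth_derive.
have := near_pairl (near_near mn).
apply: filterS3 (near_pairl (smooth_near_near sm)) (chart_near gG ac cu) => z sz cz nz.
have [cm Em] := nbhs_singleton nz.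
have Ez : m (z, u0) = z by apply: (ga_inj gG ac) => //; rewrite Em /= E mul1.
rewrite /lfield -{1}E Ew.
rewrite (tmap_tvec fV fV gG gG (k := fun y => m (z, y)) w ad du0 ac).
- by rewrite Ez derive_pairr //; exact: smooth_diff.
- apply: smooth_comp => //; [exact: findim_prod|exact: smooth_pairr].
- exact: near_pairr nz.
Qed.

Lemma linv_lfield X : linv X -> X = lfield (X one).
Proof.
by move=> [_ H]; apply/funext => x; rewrite /lfield H mul1.
Qed.

Lemma linv_eq X Y : linv X -> linv Y -> X one = Y one -> X = Y.
Proof. by move=> HX HY E; rewrite (linv_lfield HX) (linv_lfield HY) E. Qed.

Lemma linv_tangent X : linv X -> tangent one (X one).
Proof. by move=> [HX _]; exact: (vfield_tangent gG). Qed.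

Lemma linv_add X Y : linv X -> linv Y -> linv (vadd X Y).
Proof.
move=> [HX LX] [HY LY]; split; first exact: (vfield_add fV gG).
move=> a x; rewrite /vadd -LX -LY; apply/funext => f; rewrite /tmap.
by case: asboolP => // _; rewrite addr0.
Qed.

Lemma linv_scale a X : linv X -> linv (vscale a X).
Proof.
move=> [HX LX]; split; first exact: (vfield_scale fV gG).
move=> b x; rewrite /vscale /vmul -LX; apply/funext => f; rewrite /tmap.
by case: asboolP => // _; rewrite mulr0.
Qed.

Lemma linv_zero : linv (vzero G).
Proof.
split; first exact: vfield_zero.
by move=> a x; apply/funext => f; rewrite /tmap; case: asboolP.
Qed.

Lemma linv_bracket X Y : linv X -> linv Y -> linv (bracket X Y).
Proof.
move=> [HX LX] [HY LY]; split; first exact: (bracket_vfield fV gG).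
move=> a x; apply/funext => f.
have [sf|nf] := pselect (smooth_at f (mul a x)); last first.
  by rewrite bracket_junk // /tmap asboolF.
have sf' : smooth_at (f \o mul a) x by exact: lmul_smooth.
rewrite /tmap asboolT // !bracketE //.
(* Left invariance moves each field through [mul a]. The functions [B (f \o mul a)] and
   [(B f) \o mul a] agree only where [f] stays smooth at [mul a y], which holds for [y] near [x];
   [tangent_eq] needs no more. *)
have D A B : is_vfield A -> is_vfield B ->
    (forall a x, tmap (mul a) x (A x) = A (mul a x)) ->
    (forall a x, tmap (mul a) x (B x) = B (mul a x)) ->
    A x (vapp B (f \o mul a)) = A (mul a x) (vapp B f).
  move=> HA HB LA LB; rewrite -LA /tmap asboolT; last exact: (vapp_smooth fV gG).
  apply: (tangent_eq gG (vfield_tangent gG x HA)).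
  have nf : mnear x (fun y => smooth_at f (mul a y)).
    have [c [u [ac cu cx]]] := ga_cover gG x.
    have [d [v [ad dv dy]]] := ga_cover gG (mul a x).
    have sm : smooth_map_at (mul a) (cpar c u) by exact: lmul_smooth.
    have := smooth_map_chart fV fV gG gG sm ac cu ad dv.
    rewrite cx => /(_ dy)[k [sk ku kn]].
    exists c, u; split=> //; have fn := mnear_chart gG (smooth_at_near fV gG sf) ad dv dy.
    rewrite -ku in fn; apply: filterS2 kn (smooth_near_comp sk fn) => z.
    by move=> [_ ->].
  by apply: mnearS nf => y sy; rewrite /vapp /= -LB /tmap asboolT.
by rewrite (D X Y) // (D Y X).
Qed.

Lemma linv_inner g X Y x : left_invariant_metric mul g -> linv X -> linv Y ->
  minner g X Y x = minner g X Y one.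
Proof.
move=> Lg [HX LX] [HY LY]; rewrite /minner -{1 2 3}[x]mul1 -LX -LY.
by apply: Lg; exact: (vfield_tangent gG).
Qed.

(* Left translation identifies the tangent spaces at [x] and at [one]. *)
Lemma linv_at x v : tangent x v -> exists2 X, linv X & X x = v.
Proof.
move=> tv; have Ex : mul (inv x) x = one := (lie_mulV hG x).1.
have tw : tangent one (tmap (mul (inv x)) x v).
  by rewrite -Ex; apply: (tmap_tangent fV fV gG gG) => //; exact: lmul_smooth.
exists (lfield (tmap (mul (inv x)) x v)); first exact: lfield_linv.
rewrite /lfield -Ex (tmap_comp (F := mul (inv x))); last exact: lmul_smooth.
apply/funext => f; rewrite /tmap.
have E : mul x \o mul (inv x) = id.
  by apply/funext => y /=; rewrite (lie_mulA hG) (lie_mulV hG x).2 mul1x.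
rewrite E /=; case: asboolP => // nf; symmetry; exact: tangent_junk tv nf.
Qed.

End LieGroup.

(** * Metric consequences of parallelism *)

Section Parallel.
Context {R : realType} {V : normedModType R} (fV : findim V).
Context {M : mfd V} (gM : good_atlas M).
Context {g : metric M} (hg : is_riemannian g).
Implicit Types X A B : vfield M.

(** Zero torsion and [nabla C X = 0] give [nabla X C = [X, C]]; metric compatibility in the
    direction [X] then becomes the Killing identity. *)
Lemma parallel_killing X A B x : is_parallel g X -> is_vfield X -> is_vfield A ->
  is_vfield B -> vapp X (minner g A B) x =
    minner g (bracket X A) B x + minner g A (bracket X B) x.
Proof.
move=> [nabla H nX] HX HA HB.
have E C : is_vfield C -> nabla X C = bracket X C.
  move=> HC; rewrite (lc_torsion H HX HC) nX //.
  by apply/funext => y; apply/funext => f; rewrite /vadd add0r.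
by rewrite (lc_metric H) // !E.
Qed.

(** Compatibility reduces [A g(X, B)] to [g(X, nabla A B)], and zero torsion turns the difference of
    two such terms into a bracket: the 1-form dual to [X] is closed. *)
Lemma parallel_perp X A B x : is_parallel g X -> is_vfield X -> is_vfield A ->
  is_vfield B -> minner g X (bracket A B) x =
    vapp A (minner g X B) x - vapp B (minner g X A) x.
Proof.
move=> [nabla H nX] HX HA HB; rewrite !(lc_metric H) // !nX //.
have z C : is_vfield C -> minner g (vzero M) C x = 0.
  by move=> HC; apply: (metric0l gM hg); exact: (vfield_tangent gM).
rewrite !z // !add0r (lc_torsion H HA HB) /minner.
have tt C : is_vfield C -> tangent x (C x) by exact: (vfield_tangent gM).
have HAB := bracket_vfield fV gM HA HB.
have HBA := conn_vfield (lc_connection H) HB HA.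
have -> : g x (X x) (vadd (nabla B A) (bracket A B) x) =
   g x (X x) (nabla B A x) + g x (X x) (bracket A B x).
  rewrite (riem_sym hg); try exact: tt; last exact/tt/(vfield_add fV gM).
  rewrite /vadd (riem_add hg); try exact: tt.
  by congr (_ + _); apply: (riem_sym hg); exact: tt.
by rewrite [X in _ = X - _]addrC addrK.
Qed.

End Parallel.

(** * Orthonormal bases for a positive definite form *)

Section Orthonormal.
Context {R : realType} {n : nat} {B : 'rV[R]_n -> 'rV[R]_n -> R}.
Hypothesis Blin : forall a u v w, B (a *: u + v) w = a * B u w + B v w.
Hypothesis Bsym : forall u v, B u v = B v u.
Hypothesis Bpos : forall v, v != 0 -> 0 < B v v.

Let B0 w : B 0 w = 0.
Proof.
have := Blin 1 0 0 w; rewrite scaler0 addr0 mul1r => H.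
by apply/eqP; rewrite -(inj_eq (addrI (B 0 w))) -H addr0.
Qed.

Let BZ a u w : B (a *: u) w = a * B u w.
Proof. by rewrite -[a *: u]addr0 Blin B0 addr0. Qed.

Let Bsum (m : nat) (v : 'I_m -> 'rV[R]_n) (a : 'I_m -> R) w :
  B (\sum_i a i *: v i) w = \sum_i a i * B (v i) w.
Proof.
elim: m v a => [|m IH] v a; first by rewrite !big_ord0 B0.
by rewrite !big_ord_recl Blin IH.
Qed.

Let gram k (e : 'I_k -> 'rV[R]_n) : 'M[R]_(n, k) :=
  \matrix_(i, j) B (delta_mx ord0 i) (e j).

Let gramE k (e : 'I_k -> 'rV[R]_n) v j : (v *m gram e) ord0 j = B v (e j).
Proof.
rewrite [in RHS](row_sum_delta v) Bsum mxE.
by apply: eq_bigr => i _; rewrite mxE.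
Qed.

(** [gram e] has [k < n] columns, hence a nonzero left kernel; a kernel vector is orthogonal to all
    [e i] and is then normalised. *)
Lemma orthonormal_extend k (e : 'I_k -> 'rV[R]_n) : (k < n)%N ->
  exists v, B v v = 1 /\ forall i, B v (e i) = 0.
Proof.
move=> kn.
have : kermx (gram e) != 0.
  rewrite kermx_eq0 /row_free neq_ltn; apply/orP; left.
  exact: leq_ltn_trans (rank_leq_col _) kn.
move=> /rowV0Pn[v /sub_kermxP vk vn0].
have vp := Bpos vn0.
have s0 : Num.sqrt (B v v) != 0 by rewrite sqrtr_eq0 -ltNge.
exists ((Num.sqrt (B v v))^-1 *: v); split.
  rewrite BZ Bsym BZ mulrA -invfM -expr2 sqr_sqrtr ?ltW //.
  by rewrite mulVf // gt_eqF.
by move=> i; rewrite BZ -gramE vk mxE mulr0.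
Qed.

(** With the vectors [e i] as rows of [P], orthonormality reads [P *m gram e = 1]. Square matrices
    satisfy the reversed identity too, so [v = (v *m gram e) *m P], whose coefficients are the
    values [B v (e i)]. *)
Lemma orthonormal_span (e : 'I_n -> 'rV[R]_n) v :
  (forall i j, B (e i) (e j) = (i == j)%:R) -> v = \sum_i B v (e i) *: e i.
Proof.
move=> He; pose P : 'M[R]_n := \matrix_(i, j) e i ord0 j.
have Prow i : row i P = e i.
  by apply/rowP => j; rewrite !mxE.
have PA : P *m gram e = 1%:M.
  apply/row_matrixP => i; rewrite row_mul Prow; apply/rowP => j.
  by rewrite gramE He row1 !mxE /= eq_sym.
rewrite -[LHS]mulmx1 -(mulmx1C PA) mulmxA.
rewrite mulmx_sum_row; apply: eq_bigr => i _.
by rewrite gramE Prow.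
Qed.

End Orthonormal.

(** Gram-Schmidt started at [w], so that the value of [X] at the identity will lie along the first
    basis vector. *)
Lemma orthonormal_basis3 (R : realType) (B : 'rV[R]_3 -> 'rV[R]_3 -> R) w :
  (forall a u v w, B (a *: u + v) w = a * B u w + B v w) ->
  (forall u v, B u v = B v u) -> (forall v, v != 0 -> 0 < B v v) -> w != 0 ->
  exists (e : 'I_3 -> 'rV[R]_3) (r : R),
    [/\ forall i j, B (e i) (e j) = (i == j)%:R, r != 0 & w = r *: e ord0].
Proof.
move=> Blin Bsym Bpos w0; have Bw := Bpos _ w0.
pose r := Num.sqrt (B w w).
have r0 : r != 0 by rewrite sqrtr_eq0 -ltNge.
have B0 z : B 0 z = 0.
  have := Blin 1 0 0 z; rewrite scaler0 addr0 mul1r => H.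
  by apply/eqP; rewrite -(inj_eq (addrI (B 0 z))) -H addr0.
have BZ a y z : B (a *: y) z = a * B y z by rewrite -[a *: y]addr0 Blin B0 addr0.
pose v0 := r^-1 *: w.
have B00 : B v0 v0 = 1.
  rewrite /v0 BZ Bsym BZ mulrA -invfM -expr2 sqr_sqrtr ?ltW //.
  by rewrite mulVf // gt_eqF.
have [v1 [B11 /(_ ord0) /= B10]] :=
  orthonormal_extend Blin Bsym Bpos (fun i : 'I_1 => v0) isT.
have [v2 [B22 B2]] := orthonormal_extend Blin Bsym Bpos
  (fun i : 'I_2 => if i == ord0 then v0 else v1) isT.
have B20 : B v2 v0 = 0 by exact: B2 ord0.
have B21 : B v2 v1 = 0 by exact: B2 ord_max.
exists (fun i => nth 0 [:: v0; v1; v2] i), r; split=> //; last first.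
  by rewrite /v0 /= scalerA divff // scale1r.
case=> -[|[|[|//]]] p; case=> -[|[|[|//]]] q /=.
all: by [rewrite ?B00 ?B11 ?B22 ?B10 ?B20 ?B21|rewrite Bsym ?B10 ?B20 ?B21].
Qed.

Section LieFrame.
Context {R : realType}.
Context {G : mfd 'rV[R]_3} {mul : G -> G -> G} {inv : G -> G} {one : G}.
Context (hG : is_lie_group mul inv one).
Context {g : metric G} (hg : is_riemannian g) (Lg : left_invariant_metric mul g).
Local Notation linv := (left_invariant_vfield mul).

Let fV : findim 'rV[R]_3 := findim_row 3.
Let gG : good_atlas G := manifold_good (lie_mfd hG).

Lemma linv_sum n (a : 'I_n -> R) (e : 'I_n -> vfield G) : (forall i, linv (e i)) ->
  linv (fun x f => \sum_i a i * e i x f).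
Proof.
move=> He; elim: n a e He => [|n IH] a e He.
  have := @linv_zero _ _ G mul; congr left_invariant_vfield.
  by apply/funext => x; apply/funext => f; rewrite big_ord0.
have := linv_add fV hG (linv_scale fV hG (a ord0) (He ord0))
  (IH (fun i => a (lift ord0 i)) _ (fun i => He (lift ord0 i))).
congr left_invariant_vfield.
by apply/funext => x; apply/funext => f; rewrite big_ord_recl.
Qed.

(** An orthonormal basis at [one] adapted to [X] is spread by left translation; left invariance of
    [g] keeps it orthonormal everywhere, and [linv_at] carries spanning to each point. *)
Lemma orthonormal_frame X : linv X -> X <> vzero G ->
  exists (e : 'I_3 -> vfield G) (r : R), [/\ forall i, linv (e i),
    forall i j x, g x (e i x) (e j x) = (i == j)%:R,
    forall x v, tangent x v -> exists a : 'I_3 -> R,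
      v = fun f => \sum_i a i * e i x f,
    r <> 0 & X = vscale r (e ord0)].
Proof.
move=> LX X0.
have [c [u [ac cu cone]]] := ga_cover gG one.
have [w Ew] := tangent_chart fV gG (linv_tangent hG LX) ac cu cone.
have tt z : tangent one (tvec c u z) by rewrite -cone; exact: tangent_tvec.
pose B (y z : 'rV[R]_3) := g one (tvec c u y) (tvec c u z).
have Blin a y z b : B (a *: y + z) b = a * B y b + B z b.
  rewrite /B -(riem_scale hg) // -(riem_add hg) //; last exact: (tangentZ fV gG).
  by congr (g _ _ _); apply/funext => f; rewrite (tvecP fV gG).
have Bsym y z : B y z = B z y by exact: (riem_sym hg).
have t0 : tvec c u 0 = (fun _ => 0) :> tfun G by apply/funext => f; rewrite tvec0.
have Bpos y : y != 0 -> 0 < B y y.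
  move=> y0; apply: (riem_pos hg) => //; rewrite -t0 => /(tvec_inj fV gG ac cu).
  by apply/eqP.
have w0 : w != 0.
  apply/eqP => w0; apply: X0; apply: (linv_eq hG) => //; first exact: linv_zero.
  by rewrite Ew w0 t0.
have [e [r [He r0 we]]] := orthonormal_basis3 Blin Bsym Bpos w0.
pose E i := lfield (mul := mul) (one := one) (tvec c u (e i)).
have LE i : linv (E i) by exact: (lfield_linv fV hG).
have Eone i : E i one = tvec c u (e i).
  rewrite /E /lfield; apply/funext => f; rewrite /tmap.
  have -> : mul one = id by apply/funext => y; exact: (lie_mul1 hG y).1.
  by case: asboolP => // nf; rewrite (tangent_junk (tt _) nf).
exists E, r; split=> //; [| |exact/eqP|].
- move=> i j x; rewrite -/(minner g (E i) (E j) x) (linv_inner hG) //.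
  by rewrite /minner !Eone; exact: He.
- move=> x v /(linv_at fV hG)[Y LY <-].
  have [y Ey] := tangent_chart fV gG (linv_tangent hG LY) ac cu cone.
  exists (fun i => B y (e i)).
  have -> : Y = fun x f => \sum_i B y (e i) * E i x f; last by [].
  apply: (linv_eq hG) => //; first exact: linv_sum.
  rewrite Ey; apply/funext => f.
  rewrite {1}(orthonormal_span Blin (e := e) y He) (tvec_sum fV gG) //.
  by apply: eq_bigr => i _; rewrite (tvecZ fV gG) // Eone.
- apply: (linv_eq hG) => //; first exact: (linv_scale fV hG).
  rewrite Ew we /vscale /vmul Eone; apply/funext => f.
  by rewrite (tvecZ fV gG).
Qed.

End LieFrame.

(** * Lifts to the tangent bundle *)

Lemma derive_swap_findim (R : realType) (U W : normedModType R) (h : U -> W) u v w :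
  findim W -> smooth_near h u -> 'D_v ('D_w h) u = 'D_w ('D_v h) u.
Proof.
move=> [m [e [l [lc le]]]] sh.
have D i a b : l i ('D_a ('D_b h) u) = 'D_a ('D_b (l i \o h : U -> R^o)) u.
  rewrite -(@derive_linpost _ _ _ _ ('D_b h) (l i)) //; last first.
    exact/smooth_diff/smooth_derive.
  apply: near_eq_derive; apply: filterS (smooth_near_near sh) => z sz.
  by rewrite derive_linpost //; exact: smooth_diff.
have E i : l i ('D_v ('D_w h) u) = l i ('D_w ('D_v h) u).
  by rewrite !D; apply: derive_swap; exact: smooth_linpost.
by rewrite [LHS]le [RHS]le; under eq_bigr => i _ do rewrite E.
Qed.

Lemma velocity_chart (R : realType) (U : normedModType R) (M : mfd U) (gM : good_atlas M)
    (fU : findim U) (gam : R -> M) (t : R) (e : chart U M) (k : R^o -> U) :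
  atlas e -> cdom e (k t) -> differentiable k (t : R^o) ->
  (\forall s \near (t : R^o), gam s = cpar e (k s)) ->
  velocity gam t = tvec e (k t) ('D_1 k (t : R^o)).
Proof.
move=> ae ek dk gk; have E := nbhs_singleton gk.
apply/funext => f; rewrite /velocity /= E; case: asboolP => sf; last first.
  by rewrite tvec_junk.
rewrite tvecE // -(@derive_chain _ _ _ _ k (f \o cpar e : U -> R^o)) //.
  apply: near_eq_derive; apply: filterS gk => s /= -> //.
exact: (tvec_diff fU gM).
Qed.

Lemma smooth_line (R : realType) (V : normedModType R) (w b : V) (t : R^o) :
  smooth_near (fun t : R^o => w + t *: b) t.
Proof.
apply: smooth_add; first exact: smooth_cst.
by apply: smooth_scale; [exact: smooth_id|exact: smooth_cst].
Qed.

Lemma derive_line (R : realType) (V : normedModType R) (w b : V) (t : R^o) :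
  'D_1 (fun t : R^o => w + t *: b) t = b.
Proof.
have dl : differentiable (fun t : R^o => t *: b) t.
  by apply/smooth_diff/smooth_scale; [exact: smooth_id|exact: smooth_cst].
have -> : (fun t : R^o => w + t *: b) = cst w + (fun t : R^o => t *: b) by [].
rewrite deriveD; [|exact/diff_derivable/differentiable_cst|exact: diff_derivable].
rewrite derive_cst add0r (derive_scale (h := fun t : R^o => t)).
- by rewrite derive_cst scaler0 add0r derive_id scale1r.
- exact/smooth_diff/smooth_id.
- exact: differentiable_cst.
Qed.

Section Lifts.
Context {R : realType} {V : normedModType R} (fV : findim V).
Context {M : mfd V} (gM : good_atlas M).
Implicit Types (c : chart V M) (f : M -> R) (X Y Z : vfield M).

Local Notation TM := (tangent_bundle M).
Let gTM : good_atlas TM := tangent_bundle_good fV gM.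
Let fVV : findim (V * V)%type := findim_prod fV fV.
Implicit Types p q : TM.

(* As tangent vectors are derivations, this is the differential of [f]. *)
Definition dfun f : TM -> R := fun q => tfib q f.

Lemma tbase_chart c p0 f (z : V * V) : atlas c -> cdom c z.1 ->
  \forall y \near z, (f \o @tbase _ _ M) (cpar (tchart c p0) y) = f (cpar c y.1).
Proof.
move=> ac cz; apply: filterS (near_fst (chart_near gM ac cz)) => y cy.
by rewrite /comp tbase_tchart.
Qed.

Lemma dfun_chart c p0 f (z : V * V) : atlas c -> cdom c z.1 -> smooth_at f (cpar c z.1) ->
  \forall y \near z, dfun f (cpar (tchart c p0) y) =
     'D_(y.2) (f \o cpar c : V -> R^o) y.1.
Proof.
move=> ac cz sf.
have nf := mnear_chart gM (smooth_at_near fV gM sf) ac cz erefl.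
apply: filterS2 (near_fst (chart_near gM ac cz)) (near_fst nf) => y cy sy.
by rewrite /dfun tfib_tchart // tvecE.
Qed.

Lemma smooth_at_tbase p f : smooth_at f (tbase p) -> smooth_at (f \o @tbase _ _ M) p.
Proof.
have [c [u [w [ac cu Eb _ Ep]]]] := tchart_cover fV gM p p.
rewrite Eb => /(smooth_atP fV gM) => /(_ ac cu) sf.
rewrite -Ep; apply/(smooth_atP fVV gTM) => //; first exact: atlas_tchart.
have H : smooth_near (fun z : V * V => (f \o cpar c : V -> R^o) z.1) (u, w).
  by apply: (smooth_comp (k := fst)) => //; exact: smooth_fst.
apply: smooth_ext H.
apply: filterS (tbase_chart p f (z := (u, w)) ac cu) => z Ez; exact: esym Ez.
Qed.

Lemma smooth_at_dfun p f : smooth_at f (tbase p) -> smooth_at (dfun f) p.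
Proof.
have [c [u [w [ac cu Eb _ Ep]]]] := tchart_cover fV gM p p.
rewrite Eb => sf; have /(smooth_atP fV gM) := sf => /(_ ac cu) sf'.
rewrite -Ep; apply/(smooth_atP fVV gTM) => //; first exact: atlas_tchart.
have H : smooth_near (fun z : V * V => 'D_(z.2) (f \o cpar c : V -> R^o) z.1) (u, w).
  apply: (smooth_derive_var (k := fst) (d := snd)) => //.
    exact: smooth_fst.
  exact: smooth_snd.
apply: smooth_ext H.
apply: filterS (dfun_chart p (z := (u, w)) ac cu sf) => z Ez; exact: esym Ez.
Qed.

Lemma mnear_tbase p (P : M -> Prop) : mnear (tbase p) P ->
  mnear p (fun q => P (tbase q)).
Proof.
move=> nP; have [c [u [w [ac cu Eb _ Ep]]]] := tchart_cover fV gM p p.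
exists (tchart c p), (u, w); split=> //; first exact: atlas_tchart.
have := near_fst (z := (u, w)) (mnear_chart gM nP ac cu (esym Eb)).
apply: filterS2 (near_fst (z := (u, w)) (chart_near gM ac cu)) => y cy.
by rewrite tbase_tchart.
Qed.

Lemma ttvec_tbase c p0 (z d : V * V) f : atlas c -> cdom c z.1 -> smooth_at f (cpar c z.1) ->
  tvec (tchart c p0) z d (f \o @tbase _ _ M) = tvec c z.1 d.1 f.
Proof.
move=> ac cz sf.
have Eb : tbase (cpar (tchart c p0) z) = cpar c z.1 by exact: tbase_tchart.
rewrite !tvecE //; last by apply: smooth_at_tbase; rewrite Eb.
transitivity ('D_d (fun y : V * V => (f \o cpar c : V -> R^o) y.1) z).
  apply: near_eq_derive; exact: tbase_chart.
rewrite (@derive_chain _ _ _ _ fst (f \o cpar c : V -> R^o)) ?derive_fst //.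
  exact/smooth_diff/smooth_fst.
exact: (tvec_diff fV gM).
Qed.

(** In a chart [df] is the function ['D_(y.2) (f \o cpar c) y.1], linear in the fibre variable; its
    derivative has a second-order term from the base direction and a first-order term from the fibre
    direction. *)
Lemma ttvec_dfun c p0 (z d : V * V) f : atlas c -> cdom c z.1 -> smooth_at f (cpar c z.1) ->
  tvec (tchart c p0) z d (dfun f) =
    'D_(d.1) ('D_(z.2) (f \o cpar c : V -> R^o)) z.1
    + 'D_(d.2) (f \o cpar c : V -> R^o) z.1.
Proof.
move=> ac cz sf.
have Eb : tbase (cpar (tchart c p0) z) = cpar c z.1 by exact: tbase_tchart.
rewrite tvecE //; last by apply: smooth_at_dfun; rewrite Eb.
transitivity ('D_d (fun y : V * V => 'D_(y.2) (f \o cpar c : V -> R^o) y.1) z).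
  apply: near_eq_derive; exact: dfun_chart.
rewrite (derive_derive_var fV (k := snd) (b := fst)).
- by rewrite derive_fst derive_snd.
- by apply/(smooth_atP fV gM).
- exact: smooth_snd.
- exact: smooth_fst.
Qed.

(* The functions [f \o tbase] and [dfun f] contain coordinates of the tangent
   bundle. *)
Lemma ttangent_eq p v v' : tangent p v -> tangent p v' ->
  (forall f, smooth_at f (tbase p) -> v (f \o @tbase _ _ M) = v' (f \o @tbase _ _ M)) ->
  (forall f, smooth_at f (tbase p) -> v (dfun f) = v' (dfun f)) -> v = v'.
Proof.
have [c [u [w [ac cu Eb _ Ep]]]] := tchart_cover fV gM p p.
have at_ := atlas_tchart p ac.
move=> /(tangent_chart fVV gTM)/(_ at_ (cu : cdom (tchart c p) (u, w)) Ep)[d ->].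
move=> /(tangent_chart fVV gTM)/(_ at_ (cu : cdom (tchart c p) (u, w)) Ep)[d' ->].
rewrite Eb => H1 H2; have [m [e [l [lc le]]]] := fV.
congr (tvec _ _ _).
have Hs i := coord_smooth fV gM (lc i) ac cu.
have E1 : d.1 = d'.1.
  rewrite (le d.1) (le d'.1); apply: eq_bigr => i _; congr (_ *: _).
  by have := H1 _ (Hs i); rewrite !ttvec_tbase // !(tvec_coord fV gM).
have E2 : d.2 = d'.2.
  rewrite (le d.2) (le d'.2); apply: eq_bigr => i _; congr (_ *: _).
  have := H2 _ (Hs i); rewrite !ttvec_dfun // E1 => /addrI.
  by rewrite -!(tvecE _ (Hs i)) !(tvec_coord fV gM).
by case: d d' E1 E2 {H1 H2} => [? ?] [? ?] /= -> ->.
Qed.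

Lemma vertical_lift_tvec X c p0 u w b : atlas c -> cdom c u ->
  X (cpar c u) = tvec c u b ->
  vertical_lift X (cpar (tchart c p0) (u, w)) = tvec (tchart c p0) (u, w) (0, b).
Proof.
move=> ac cu EX; set p := cpar _ _.
have Eb : tbase p = cpar c u by exact: tbase_tchart.
have Ef : tfib p = tvec c u w by exact: tfib_tchart.
pose k (t : R^o) : V * V := (u, w + t *: b).
have sl := smooth_line w b (0 : R^o).
have sk : smooth_near k (0 : R^o) by apply: smooth_pair => //; exact: smooth_cst.
have k0 : k 0 = (u, w) by rewrite /k scale0r addr0.
have ck : cdom (tchart c p0) (k 0) by rewrite k0.
have gk : \forall s \near (0 : R^o),
    tpt p (tbase p) (fun f => tfib p f + s * X (tbase p) f) = cpar (tchart c p0) (k s) :> TM.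
  near=> s.
  have E : (fun f => tfib p f + s * X (tbase p) f) = tvec c u (w + s *: b).
    apply/funext => f; rewrite Eb Ef EX (tvecD fV gM) //; congr (_ + _).
    by rewrite (tvecZ fV gM).
  have tE := tangent_tvec (w + s *: b) ac cu.
  by rewrite E Eb; apply: tpoint_eq; rewrite ?tbase_tpt ?tfib_tpt.
have := velocity_chart gTM fVV (atlas_tchart p0 ac) ck (smooth_diff sk) gk.
rewrite k0 /k derive_pair; last exact: smooth_diff.
  by rewrite derive_cst derive_line.
exact: differentiable_cst.
Unshelve. all: by end_near. Qed.

Lemma vertical_lift_vfield X : is_vfield X -> is_vfield (vertical_lift X).
Proof.
move=> HX e [c [p0 [ac ->]]]; have [b Hb] := HX c ac.
exists (fun z => (0, b z.1)) => -[u w] /= cu; have [sb Eb] := Hb u cu.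
split; last exact: vertical_lift_tvec.
apply: smooth_pair; first exact: smooth_cst.
by apply: (smooth_comp (k := fst)) => //; exact: smooth_fst.
Qed.

Lemma vertical_lift_tbase X p f : is_vfield X -> smooth_at f (tbase p) ->
  vertical_lift X p (f \o @tbase _ _ M) = 0.
Proof.
have [c [u [w [ac cu Eb _ Ep]]]] := tchart_cover fV gM p p.
move=> HX; rewrite Eb => sf; have [b Hb] := HX c ac; have [_ EX] := Hb u cu.
by rewrite -Ep (vertical_lift_tvec p w ac cu EX) ttvec_tbase // tvec0.
Qed.

Lemma vertical_lift_dfun X p f : is_vfield X -> smooth_at f (tbase p) ->
  vertical_lift X p (dfun f) = X (tbase p) f.
Proof.
have [c [u [w [ac cu Eb _ Ep]]]] := tchart_cover fV gM p p.
move=> HX; rewrite Eb => sf; have [b Hb] := HX c ac; have [_ EX] := Hb u cu.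
rewrite -{1}Ep (vertical_lift_tvec p w ac cu EX) ttvec_dfun //= derive0 add0r.
by rewrite EX tvecE.
Qed.

(** The identities [Y^c (f o pi) = (Y f) o pi] and [Y^c (df) = d(Y f)], evaluated at [p]; by
    [ttangent_eq] they determine [v]. *)
Definition is_clift_at Y p (v : tfun TM) : Prop := tangent p v /\
  forall f, smooth_at f (tbase p) -> v (f \o @tbase _ _ M) = Y (tbase p) f /\
    v (dfun f) = tfib p (vapp Y f).

(* The complete lift of [Y], characterized through its action on functions;
   [clift_complete] relates it to the flow of [Y]. *)
Definition clift Y : vfield TM := fun p =>
  if pselect (exists v, is_clift_at Y p v) is left e then projT1 (cid e)
  else fun _ => 0.

Lemma is_clift_at_unique Y p v v' : is_clift_at Y p v -> is_clift_at Y p v' -> v = v'.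
Proof.
move=> [tv Hv] [tv' Hv']; apply: (ttangent_eq tv tv') => f sf.
  by rewrite (Hv f sf).1 (Hv' f sf).1.
by rewrite (Hv f sf).2 (Hv' f sf).2.
Qed.

Lemma tvec_is_clift_at Y c p0 u w (y : V -> V) : atlas c -> cdom c u ->
  smooth_near y u -> (\forall z \near u, Y (cpar c z) = tvec c z (y z)) ->
  is_clift_at Y (cpar (tchart c p0) (u, w)) (tvec (tchart c p0) (u, w) (tlift y (u, w))).
Proof.
move=> ac cu sy Yn; split; first by apply: tangent_tvec => //; exact: atlas_tchart.
move=> f; rewrite tbase_tchart // => sf; split.
  by rewrite ttvec_tbase //= (nbhs_singleton Yn).
have sh : smooth_near (f \o cpar c : V -> R^o) u by apply/(smooth_atP fV gM).
have nE := vapp_chart fV gM ac cu Yn sf.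
have sV : smooth_at (vapp Y f) (cpar c u).
  apply/(smooth_atP fV gM) => //.
  apply: smooth_ext (smooth_derive_var fV (smooth_id u) sy sh).
  by apply: filterS nE => v <-.
rewrite ttvec_dfun // tfib_tchart //= tvecE //=.
(* [Y f] is ['D_(y z) (f \o cpar c) z] in the chart. Its derivative along [w] yields exactly the two
   terms of [ttvec_dfun], once the second derivatives are swapped. *)
have := derive_derive_var fV w sh sy (smooth_id u).
rewrite derive_id (derive_swap _ _ sh) => <-.
apply: near_eq_derive; apply: filterS nE => v Ev; exact: esym Ev.
Qed.

Lemma clift_tvec Y c p0 u w (y : V -> V) : atlas c -> cdom c u ->
  smooth_near y u -> (\forall z \near u, Y (cpar c z) = tvec c z (y z)) ->
  clift Y (cpar (tchart c p0) (u, w)) = tvec (tchart c p0) (u, w) (tlift y (u, w)).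
Proof.
move=> ac cu sy Yn; have H := tvec_is_clift_at p0 w ac cu sy Yn.
rewrite /clift; case: pselect => [e|[]]; last by eexists; exact: H.
by apply: is_clift_at_unique H; case: cid.
Qed.

Lemma vfield_near Y c u : is_vfield Y -> atlas c -> cdom c u ->
  exists y : V -> V, smooth_near y u /\ \forall z \near u, Y (cpar c z) = tvec c z (y z).
Proof.
move=> HY ac cu; have [y Hy] := HY c ac; exists y; split; first exact: (Hy u cu).1.
by apply: filterS (chart_near gM ac cu) => z /Hy[].
Qed.

Lemma clift_at Y p : is_vfield Y -> is_clift_at Y p (clift Y p).
Proof.
have [c [u [w [ac cu Eb _ Ep]]]] := tchart_cover fV gM p p.
move=> HY; have [y [sy Hy]] := vfield_near HY ac cu.
rewrite -Ep (clift_tvec p w ac cu sy Hy); exact: tvec_is_clift_at.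
Qed.

Lemma clift_tbase Y p f : is_vfield Y -> smooth_at f (tbase p) ->
  clift Y p (f \o @tbase _ _ M) = Y (tbase p) f.
Proof. by move=> HY sf; have [_ /(_ f sf)[]] := clift_at p HY. Qed.

Lemma clift_dfun Y p f : is_vfield Y -> smooth_at f (tbase p) ->
  clift Y p (dfun f) = tfib p (vapp Y f).
Proof. by move=> HY sf; have [_ /(_ f sf)[]] := clift_at p HY. Qed.

Lemma clift_vfield Y : is_vfield Y -> is_vfield (clift Y).
Proof.
move=> HY e [c [p0 [ac ->]]]; have [y Hy] := HY c ac.
exists (tlift y) => -[u w] /= cu; have [sy _] := Hy u cu.
split; first exact: smooth_tlift.
apply: clift_tvec => //.
by apply: filterS (chart_near gM ac cu) => z /Hy[].
Qed.

End Lifts.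

(** * Brackets, span and flows of lifted fields *)

Section LiftBrackets.
Context {R : realType} {V : normedModType R} (fV : findim V).
Context {M : mfd V} (gM : good_atlas M).
Implicit Types (c : chart V M) (f : M -> R) (X Y Z : vfield M).

Local Notation TM := (tangent_bundle M).
Let gTM : good_atlas TM := tangent_bundle_good fV gM.
Let fVV : findim (V * V)%type := findim_prod fV fV.
Implicit Types p q : TM.
Local Notation proj f := (f \o @tbase _ _ M).

Let near_smooth p f : smooth_at f (tbase p) ->
  mnear p (fun q => smooth_at f (tbase q)).
Proof. by move=> sf; apply: (mnear_tbase fV gM); exact: (smooth_at_near fV gM). Qed.

(** The action of a lift on [f o pi] and [df] is known only over points where [f] is smooth. These
    fill a neighbourhood of [p], and tangent vectors see only germs; the next three facts rest on
    the same remark. *)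
Let vl_tbase X p v f : is_vfield X -> tangent p v -> smooth_at f (tbase p) ->
  v (vapp (vertical_lift X) (proj f)) = 0.
Proof.
move=> HX tv sf; rewrite -[RHS](tangent_cst fVV gTM 0 tv).
apply: (tangent_eq gTM tv); apply: mnearS (near_smooth sf) => q sq.
exact: (vertical_lift_tbase fV gM).
Qed.

Let vl_dfun X p v f : is_vfield X -> tangent p v -> smooth_at f (tbase p) ->
  v (vapp (vertical_lift X) (dfun f)) = v (proj (vapp X f)).
Proof.
move=> HX tv sf.
apply: (tangent_eq gTM tv); apply: mnearS (near_smooth sf) => q sq.
exact: (vertical_lift_dfun fV gM).
Qed.

Let cl_tbase X p v f : is_vfield X -> tangent p v -> smooth_at f (tbase p) ->
  v (vapp (clift X) (proj f)) = v (proj (vapp X f)).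
Proof.
move=> HX tv sf.
apply: (tangent_eq gTM tv); apply: mnearS (near_smooth sf) => q sq.
exact: (clift_tbase fV gM).
Qed.

Let cl_dfun X p v f : is_vfield X -> tangent p v -> smooth_at f (tbase p) ->
  v (vapp (clift X) (dfun f)) = v (dfun (vapp X f)).
Proof.
move=> HX tv sf.
apply: (tangent_eq gTM tv); apply: mnearS (near_smooth sf) => q sq.
exact: (clift_dfun fV gM).
Qed.

Let vX X : is_vfield X -> is_vfield (vertical_lift X).
Proof. exact: (vertical_lift_vfield fV gM). Qed.

Let cX X : is_vfield X -> is_vfield (clift X).
Proof. exact: (clift_vfield fV gM). Qed.

Let tX (A : vfield TM) p : is_vfield A -> tangent p (A p).
Proof. exact: (vfield_tangent gTM). Qed.

Let Xf X f x : is_vfield X -> smooth_at f x -> smooth_at (vapp X f) x.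
Proof. exact: (vapp_smooth fV gM). Qed.

Let sp p f : smooth_at f (tbase p) -> smooth_at (proj f) p.
Proof. exact: (smooth_at_tbase fV gM). Qed.

Let sd p f : smooth_at f (tbase p) -> smooth_at (dfun f) p.
Proof. exact: (smooth_at_dfun fV gM). Qed.

Let lift_eq (A B : vfield TM) : is_vfield A -> is_vfield B ->
  (forall p f, smooth_at f (tbase p) -> A p (proj f) = B p (proj f)) ->
  (forall p f, smooth_at f (tbase p) -> A p (dfun f) = B p (dfun f)) -> A = B.
Proof.
move=> HA HB H1 H2; apply/funext => p.
by apply: (ttangent_eq fV gM (tX p HA) (tX p HB)) => f sf; [exact: H1|exact: H2].
Qed.

Lemma bracket_vv X Y : is_vfield X -> is_vfield Y ->
  bracket (vertical_lift X) (vertical_lift Y) = vzero TM.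
Proof.
move=> HX HY; apply: lift_eq => [||p f sf|p f sf].
- by apply: (bracket_vfield fVV gTM); exact: vX.
- exact: vfield_zero.
- rewrite bracketE; last exact: sp.
  by rewrite !(vl_tbase (p := p)) ?subrr //; exact/tX/vX.
- rewrite bracketE; last exact: sd.
  rewrite !(vl_dfun (p := p)) //; do ?exact/tX/vX.
  by rewrite !(vertical_lift_tbase fV gM) ?subrr //; exact: Xf.
Qed.

(** Both sides kill [f o pi]. On [df] the bracket is [X^v (d(Y f)) - Y^c ((X f) o pi)], that is
    [X (Y f) - Y (X f)] at the base point. *)
Lemma bracket_vc X Y : is_vfield X -> is_vfield Y ->
  bracket (vertical_lift X) (clift Y) = vertical_lift (bracket X Y).
Proof.
move=> HX HY; have HXY := bracket_vfield fV gM HX HY.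
apply: lift_eq => [||p f sf|p f sf].
- by apply: (bracket_vfield fVV gTM); [exact: vX|exact: cX].
- exact: vX.
- rewrite bracketE; last exact: sp.
  rewrite (cl_tbase (p := p)) //; last exact/tX/vX.
  rewrite (vl_tbase (p := p)) //; last exact/tX/cX.
  by rewrite !(vertical_lift_tbase fV gM) ?subrr //; exact: Xf.
- rewrite bracketE; last exact: sd.
  rewrite (cl_dfun (p := p)) //; last exact/tX/vX.
  rewrite (vl_dfun (p := p)) //; last exact/tX/cX.
  rewrite !(vertical_lift_dfun fV gM) //; last exact: Xf.
  by rewrite (clift_tbase fV gM) ?bracketE //; exact: Xf.
Qed.

Lemma bracket_cc X Y : is_vfield X -> is_vfield Y ->
  bracket (clift X) (clift Y) = clift (bracket X Y).
Proof.
move=> HX HY; have HXY := bracket_vfield fV gM HX HY.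
apply: lift_eq => [||p f sf|p f sf].
- by apply: (bracket_vfield fVV gTM); exact: cX.
- exact: cX.
- rewrite bracketE; last exact: sp.
  rewrite !(cl_tbase (p := p)) //; do ?exact/tX/cX.
  by rewrite !(clift_tbase fV gM) ?bracketE //; exact: Xf.
- rewrite bracketE; last exact: sd.
  rewrite !(cl_dfun (p := p)) //; do ?exact/tX/cX.
  rewrite !(clift_dfun fV gM) //; do ?exact: Xf.
  have tp := tangent_tfib p.
  rewrite -(tangent_subf fV gM tp); do ?by apply: Xf => //; exact: Xf.
  apply: (tangent_eq gM tp); apply: mnearS (smooth_at_near fV gM sf) => y sy.
  by rewrite /vapp bracketE.
Qed.

Lemma vertical_lift_sum n (a : 'I_n -> R) (X : 'I_n -> vfield M) :
  (forall i, is_vfield (X i)) ->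
  vertical_lift (fun x f => \sum_i a i * X i x f) =
  fun p F => \sum_i a i * vertical_lift (X i) p F.
Proof.
move=> HX.
have HS : is_vfield (fun x f => \sum_i a i * X i x f).
  apply: (vfield_sum fV gM (X := fun i => vscale (a i) (X i))) => i.
  exact: (vfield_scale fV gM).
apply: lift_eq => [||p f sf|p f sf].
- exact: vX.
- apply: (vfield_sum fVV gTM (X := fun i => vscale (a i) (vertical_lift (X i)))) => i.
  exact/(vfield_scale fVV gTM)/vX.
- rewrite (vertical_lift_tbase fV gM) // big1 // => i _.
  by rewrite (vertical_lift_tbase fV gM) ?mulr0.
- rewrite (vertical_lift_dfun fV gM) //; apply: eq_bigr => i _.
  by rewrite (vertical_lift_dfun fV gM).
Qed.

Lemma clift_sum n (a : 'I_n -> R) (X : 'I_n -> vfield M) :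
  (forall i, is_vfield (X i)) ->
  clift (fun x f => \sum_i a i * X i x f) =
  fun p F => \sum_i a i * clift (X i) p F.
Proof.
move=> HX.
have HS : is_vfield (fun x f => \sum_i a i * X i x f).
  apply: (vfield_sum fV gM (X := fun i => vscale (a i) (X i))) => i.
  exact: (vfield_scale fV gM).
apply: lift_eq => [||p f sf|p f sf].
- exact: cX.
- apply: (vfield_sum fVV gTM (X := fun i => vscale (a i) (clift (X i)))) => i.
  exact/(vfield_scale fVV gTM)/cX.
- rewrite (clift_tbase fV gM) //; apply: eq_bigr => i _.
  by rewrite (clift_tbase fV gM).
- rewrite (clift_dfun fV gM) //.
  have tp := tangent_tfib p.
  rewrite (_ : vapp _ f = fun y => \sum_i a i * vapp (X i) f y) //.
  rewrite (tangent_sumf fV gM tp); last first.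
    by move=> i; apply: (smooth_at_scale fV gM); exact: Xf.
  apply: eq_bigr => i _; rewrite (clift_dfun fV gM) //.
  by rewrite (tangent_scalef fV gM _ tp) //; exact: Xf.
Qed.

Lemma lift_span n (X : 'I_n -> vfield M) p (v : tfun TM) :
  (forall i, is_vfield (X i)) ->
  (forall x w, tangent x w -> exists a : 'I_n -> R, w = fun f => \sum_i a i * X i x f) ->
  tangent p v -> exists a b : 'I_n -> R,
    v = fun F => \sum_i a i * clift (X i) p F + \sum_i b i * vertical_lift (X i) p F.
Proof.
move=> HX sX tv.
have [c [u [w [ac cu Eb _ Ep]]]] := tchart_cover fV gM p p.
have at_ := atlas_tchart p ac.
have [[d1 d2] Ev] := tangent_chart fVV gTM tv at_ (cu : cdom (tchart c p) (u, w)) Ep.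
(* The complete lift of the combination [A] matches the base component [d1], but brings along the
   fibre component ['D_w y u]. *)
have [a Ea] := sX _ _ (tangent_tvec d1 ac cu).
pose A : vfield M := fun x f => \sum_i a i * X i x f.
have HA : is_vfield A.
  apply: (vfield_sum fV gM (X := fun i => vscale (a i) (X i))) => i.
  exact: (vfield_scale fV gM).
have [y [sy Hy]] := vfield_near gM HA ac cu.
have y1 : y u = d1.
  by apply: (tvec_inj fV gM ac cu); rewrite -(nbhs_singleton Hy) Ea.
(* The remaining fibre component is vertical and is supplied by a vertical lift. *)
have [b Hb] := sX _ _ (tangent_tvec (d2 - 'D_w y u) ac cu).
pose B : vfield M := fun x f => \sum_i b i * X i x f.
exists a, b.
have -> : v = fun F => clift A p F + vertical_lift B p F.
  apply/funext => F; rewrite Ev -{2 3}Ep.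
  rewrite (clift_tvec fV gM p w ac cu sy Hy).
  rewrite (vertical_lift_tvec fV gM p w ac cu (b := d2 - 'D_w y u)); last by rewrite Hb.
  transitivity (tvec (tchart c p) (u, w) (tlift y (u, w) + (0, d2 - 'D_w y u)) F);
    last exact: (tvecD fVV gTM _ _ _ at_ (cu : cdom (tchart c p) (u, w))).
  congr (tvec _ _ _ F).
  by rewrite /tlift /= y1; congr (_, _) => /=; rewrite ?addr0 // addrC subrK.
by rewrite clift_sum // vertical_lift_sum.
Qed.

(** Links [clift] to the flow definition, which is the form in which [is_lifted_metric] constrains
    complete lifts. For any given local flow, differentiating its equation ['D_(1, 0) k = y \o k] in
    the space direction yields the fibre component ['D_w y]. *)
Lemma clift_complete Y : is_vfield Y -> is_complete_lift Y (clift Y).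
Proof.
move=> HY p phi.
have [c [u [w [ac cu Eb Ef Ep]]]] := tchart_cover fV gM p p.
rewrite Eb => -[sphi phi0 phit].
pose lc : chart R^o (line_mfd R) := Chart (V := R^o) (T := line_mfd R) setT (fun t => t : R).
have alc : atlas (lc : chart R^o (line_mfd R)) by [].
have gl := line_good R; have fl := @findim_real R.
have fP := findim_prod fl fV; have gP := prod_good fl fV gl gM.
have aP : atlas (prod_chart lc c) by exists lc, c.
have cP : cdom (prod_chart lc c) (0, u) by [].
have e0 : phi 0 (cpar c u) = cpar c u by exact: mnear_here phi0.
have [k [sk k0 kn]] := smooth_map_chart fP fV gP gM (c := prod_chart lc c) (u := (0, u))
  (d := c) (v := u) sphi aP cP ac cu (esym e0).
have [y [sy Hy]] := vfield_near gM HY ac cu.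
rewrite /= in kn.
have k0n : \forall v \near u, k (0, v) = v.
  have H := mnear_chart gM phi0 ac cu erefl.
  apply: filterS3 (near_pairr kn) H (chart_near gM ac cu) => v [ck Ek] ev cv.
  by apply: (ga_inj gM ac ck cv); rewrite Ek /= ev.
(* The flow equation is needed on a neighbourhood of [(0, u)], since it is differentiated along
   [(0, w)] below. *)
have kt : \forall z \near ((0, u) : R^o * V), 'D_(1, 0) k z = y (k z).
  have H := mnear_chart gP phit aP cP erefl.
  have Hy' : \forall z \near ((0, u) : R^o * V), Y (cpar c (k z)) = tvec c (k z) (y (k z)).
    by apply: (smooth_near_comp (P := fun v => Y (cpar c v) = tvec c v (y v)) sk);
      rewrite k0.
  have H2 : \forall z \near ((0, u) : R^o * V),
      velocity (phi^~ (cpar c z.2)) z.1 = tvec c (k z) ('D_(1, 0) k z).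
    apply: filterS2 (near_near kn) (smooth_near_near sk) => -[t v] nz sz /=.
    have nt := near_pairl nz.
    have dz := smooth_diff sz.
    have skt : smooth_near (fun s : R^o => k (s, v)) t.
      by apply: (smooth_comp (k := fun s : R^o => (s, v))) => //; exact: smooth_pairl.
    rewrite -(derive_pairl (m := k)) //.
    apply: (velocity_chart gM fV ac (k := fun s : R^o => k (s, v)) (t := t)).
    - exact: (nbhs_singleton nt).1.
    - exact: smooth_diff.
    - by apply: filterS nt => s [_ ->].
  move: kn; apply: filter_app; apply: filterS3 H Hy' H2 => z h1 h2 h3 [h4 h5].
  apply: (tvec_inj fV gM ac h4); rewrite -h3 -h2 h5.
  exact: h1.
rewrite -{1}Ep (clift_tvec fV gM p w ac cu sy Hy).
(* The chart expression of the curve [t |-> T phi_t (p)] in the tangent bundle. *)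
pose K (t : R^o) : V * V := (k (t, u), 'D_(0, w) k (t, u)).
have sk1 : smooth_near (fun t : R^o => k (t, u)) 0.
  by apply: (smooth_comp (k := fun s : R^o => (s, u))) => //; exact: smooth_pairl.
have sk2 : smooth_near (fun t : R^o => 'D_(0, w) k (t, u)) 0.
  apply: (smooth_comp (h := 'D_(0, w) k) (k := fun s : R^o => (s, u))) => //.
    exact: smooth_pairl.
  exact: smooth_derive.
have sK : smooth_near K 0 by exact: smooth_pair.
have dw0 : 'D_(0, w) k (0, u) = w.
  rewrite -derive_pairr; last exact: smooth_diff.
  by rewrite -[RHS](derive_id u w); exact: near_eq_derive.
have K0 : K 0 = (u, w) by rewrite /K k0 dw0.
have cK : cdom (tchart c p) (K 0) by rewrite K0.
have gK : \forall t \near (0 : R^o), tpt p (phi t (cpar c u))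
      (tmap (phi t) (cpar c u) (tfib p)) = cpar (tchart c p) (K t) :> TM.
  apply: filterS2 (near_pairl (near_near kn)) (near_pairl (smooth_near_near sk)) => t nt st.
  have nt' := near_pairr nt; have [ck Ek] := nbhs_singleton nt'.
  have E : tmap (phi t) (cpar c u) (tvec c u w) = tvec c (k (t, u)) ('D_(0, w) k (t, u)).
    rewrite -derive_pairr; last exact: smooth_diff.
    apply: (tmap_tvec fV fV gM gM (k := fun v => k (t, v)) w ac cu ac) => //.
    by apply: (smooth_comp (k := fun v => (t, v))) => //; exact: smooth_pairr.
  by rewrite Ef E /K -Ek.
have -> : tvec (tchart c p) (u, w) (tlift y (u, w)) =
   tvec (tchart c p) (K 0) ('D_1 K 0).
  rewrite K0; congr (tvec _ _ _).
  rewrite derive_pair; [|exact: smooth_diff|exact: smooth_diff].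
  rewrite (derive_pairl (m := k)); last exact: smooth_diff.
  rewrite (derive_pairl (m := 'D_(0, w) k)); last exact/smooth_diff/smooth_derive.
  (* Time and space derivatives of [k] are exchanged, so that the flow equation replaces the time
     derivative by [y \o k]. *)
  rewrite (derive_swap_findim _ _ fV sk) (nbhs_singleton kt) k0.
  congr (_, _) => /=.
  transitivity ('D_(0, w) (y \o k) (0, u)); last first.
    by apply: near_eq_derive; apply: filterS kt => z Ez; rewrite Ez.
  rewrite (@derive_chain _ _ _ _ k y) ?k0 ?dw0 //; first exact: smooth_diff.
  exact: smooth_diff.
symmetry.
exact: (velocity_chart gTM fVV (atlas_tchart p ac) cK (smooth_diff sK) gK).
Qed.

End LiftBrackets.

(** * Left invariance of vertical lifts on the tangent group *)

Section TangentGroup.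
Context {R : realType} {V : normedModType R} (fV : findim V).
Context {G : mfd V} {mul : G -> G -> G} {inv : G -> G} {one : G}.
Context (hG : is_lie_group mul inv one).
Local Notation linv := (left_invariant_vfield mul).
Local Notation TG := (tangent_bundle G).
Let gG : good_atlas G := manifold_good (lie_mfd hG).
Let fVV : findim (V * V)%type := findim_prod fV fV.
Let gTG : good_atlas TG := tangent_bundle_good fV gG.

(** Left translation by [p] in TG is affine on fibres with linear part [T l_x], so it sends the
    vertical vector of [X] to that of [T l_x X], which is [X] at the translated point. *)
Lemma vertical_lift_linv X : linv X ->
  left_invariant_vfield (tangent_mul mul) (vertical_lift X).
Proof.
move=> [HX LX]; split; first exact: (vertical_lift_vfield fV gG).
move=> p q.
have [e [z [r [ae ez Epb Epf _]]]] := tchart_cover fV gG p p.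
have [c [u [w [ac cu Eqb Eqf Eq]]]] := tchart_cover fV gG q q.
have [d [v [ad dv Ev]]] := ga_cover gG (mul (cpar e z) (cpar c u)).
have [m [sm mz mn]] := mul_chart fV hG ae ez ac cu ad dv Ev.
(* Chart form of [q |-> p q]: the sum [T l_x w + T r_y v] is the single derivative of [m] in the
   joint direction [(r, y.2)]. *)
pose K (y : V * V) : V * V := (m (z, y.1), 'D_(r, y.2) m (z, y.1)).
have sb : smooth_near (fun y : V * V => (z, y.1)) (u, w).
  by apply: smooth_pair; [exact: smooth_cst|exact: smooth_fst].
have sk : smooth_near (fun y : V * V => (r, y.2)) (u, w).
  by apply: smooth_pair; [exact: smooth_cst|exact: smooth_snd].
have sK1 : smooth_near (fun y : V * V => m (z, y.1)) (u, w).
  by apply: (smooth_comp (k := fun y : V * V => (z, y.1))).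
have sK2 : smooth_near (fun y : V * V => 'D_(r, y.2) m (z, y.1)) (u, w).
  by apply: (smooth_derive_var (k := fun y : V * V => (z, y.1))
    (d := fun y : V * V => (r, y.2))).
have sK : smooth_near K (u, w) by exact: smooth_pair.
have Hn : \forall x \near u, cdom c x /\
    ((\forall y \near (z, x), cdom d (m y) /\
      cpar d (m y) = mul (cpar e y.1) (cpar c y.2)) /\ smooth_near m (z, x)).
  apply: filterI (chart_near gG ac cu) _.
  exact: near_pairr (filterI (near_near mn) (smooth_near_near sm)).
have lmul x b : cdom c x -> (\forall y \near (z, x), cdom d (m y) /\
      cpar d (m y) = mul (cpar e y.1) (cpar c y.2)) -> smooth_near m (z, x) ->
    tmap (mul (cpar e z)) (cpar c x) (tvec c x b) = tvec d (m (z, x)) ('D_(0, b) m (z, x)).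
  move=> cx nx sx; rewrite -derive_pairr; last exact: smooth_diff.
  apply: (tmap_tvec fV fV gG gG (k := fun y => m (z, y)) b ac cx ad).
    by apply: (smooth_comp (k := fun y => (z, y))) => //; exact: smooth_pairr.
  exact: near_pairr nx.
have Kn : \forall y \near (u, w), cdom (tchart d q) (K y) /\
    cpar (tchart d q) (K y) = tangent_mul mul p (cpar (tchart c q) y).
  apply: filterS (near_fst (z := (u, w)) Hn) => -[x b] /= [cx [nx sx]].
  have [dx Ex] := nbhs_singleton nx; split=> //.
  have rmul : tmap (mul^~ (cpar c x)) (cpar e z) (tvec e z r) =
      tvec d (m (z, x)) ('D_(r, 0) m (z, x)).
    rewrite -derive_pairl; last exact: smooth_diff.
    apply: (tmap_tvec fV fV gG gG (F := mul^~ (cpar c x)) (k := fun y => m (y, x)) r ae ez ad).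
      by apply: (smooth_comp (k := fun y => (y, x))) => //; exact: smooth_pairl.
    exact: near_pairl nx.
  rewrite /tangent_mul Epb Epf.
  rewrite tbase_tpt; last exact: tangent_tvec.
  rewrite tfib_tpt; last exact: tangent_tvec.
  rewrite lmul // rmul.
  have -> : (fun f => tvec d (m (z, x)) ('D_(0, b) m (z, x)) f +
      tvec d (m (z, x)) ('D_(r, 0) m (z, x)) f) =
      tvec d (m (z, x)) ('D_(r, b) m (z, x)).
    apply/funext => f; rewrite -(tvecD fV gG) // -deriveDirD; last exact: smooth_diff.
    have -> : (0, b) + (r, 0) = (r, b) :> V * V; last by [].
    by congr (_, _); rewrite /= ?addr0 ?add0r.
  have tE := tangent_tvec ('D_(r, b) m (z, x)) ad dx.
  rewrite Ex /= in tE.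
  apply: tpoint_eq; rewrite ?tbase_tpt ?tfib_tpt ?Ex //.
have [b Eb] : exists b, X (cpar c u) = tvec c u b.
  by apply: (tangent_chart fV gG (vfield_tangent gG (cpar c u) HX) ac cu).
have nu := nbhs_singleton Hn.
(* Along a fibre the base point is constant and the second component of [K] is affine, so only the
   partial derivative of [m] in its second factor survives. *)
have dK : 'D_(0, b) K (u, w) = (0, 'D_(0, b) m (z, u)).
  rewrite derive_pair; [|exact: smooth_diff|exact: smooth_diff].
  congr (_, _).
    rewrite (@derive_chain _ _ _ _ fst (fun y => m (z, y))) ?derive_fst ?derive0 //.
      exact/smooth_diff/smooth_fst.
    by apply/smooth_diff/(smooth_comp (k := fun y => (z, y))) => //; exact: smooth_pairr.
  rewrite (derive_derive_var fVV (k := fun y : V * V => (r, y.2))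
    (b := fun y : V * V => (z, y.1))) //.
  rewrite derive_pair; [|exact: differentiable_cst|exact/smooth_diff/smooth_fst].
  rewrite derive_pair; [|exact: differentiable_cst|exact/smooth_diff/smooth_snd].
  by rewrite !derive_cst derive_fst derive_snd /= derive0 add0r.
have EK := nbhs_singleton Kn.
rewrite -{1 2}Eq (vertical_lift_tvec fV gG q w ac cu Eb).
rewrite (tmap_tvec fVV fVV gTG gTG (F := tangent_mul mul p) (c := tchart c q)
  (d := tchart d q) (k := K)) //; try exact: atlas_tchart.
rewrite dK -{2}Eq -EK.2; symmetry.
apply: (vertical_lift_tvec fV gG) => //; first exact: EK.1.
have [_ Ex] := nbhs_singleton nu.2.1.
rewrite Ex /= -LX Eb; exact: (lmul _ _ cu nu.2.1 nu.2.2).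
Qed.

End TangentGroup.

(** * Berwald metrics and central fields *)

Definition central (R : realType) (V : normedModType R) (G : mfd V)
  (mul : G -> G -> G) (X : vfield G) : Prop :=
  forall Y, left_invariant_vfield mul Y -> bracket X Y = vzero G.

Section Central.
Context {R : realType}.
Context {G : mfd 'rV[R]_3} {mul : G -> G -> G} {inv : G -> G} {one : G}.
Context (hG : is_lie_group mul inv one).
Context {g : metric G} (hg : is_riemannian g) (Lg : left_invariant_metric mul g).
Local Notation linv := (left_invariant_vfield mul).
Context {X : vfield G} (LX : linv X) (X0 : X <> vzero G) (PX : is_parallel g X).

Let fV : findim 'rV[R]_3 := findim_row 3.
Let gG : good_atlas G := manifold_good (lie_mfd hG).

Lemma minner_scalel a A B x : is_vfield A -> is_vfield B ->
  minner g (vscale a A) B x = a * minner g A B x.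
Proof.
by move=> HA HB; apply: (riem_scale hg); exact: (vfield_tangent gG).
Qed.

Lemma minner_scaler a A B x : is_vfield A -> is_vfield B ->
  minner g A (vscale a B) x = a * minner g A B x.
Proof.
move=> HA HB; rewrite (minner_sym gG hg) //; last exact: (vfield_scale fV gG).
by rewrite minner_scalel // (minner_sym gG hg).
Qed.

Lemma minner_zerol A x : is_vfield A -> minner g (vzero G) A x = 0.
Proof. by move=> HA; apply: (metric0l gG hg); exact: (vfield_tangent gG). Qed.

Lemma vapp_linv_inner A B C x : linv A -> linv B -> linv C ->
  vapp A (minner g B C) x = 0.
Proof.
move=> LA LB LC; have -> : minner g B C = fun _ => minner g B C one.
  by apply/funext => y; exact: (linv_inner hG).
exact: (tangent_cst fV gG _ (vfield_tangent gG x LA.1)).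
Qed.

(** Inner products of left invariant fields are constant, so the Killing identity makes the adjoint
    action of [X] skew. *)
Lemma linv_killing A B x : linv A -> linv B ->
  minner g (bracket X A) B x + minner g A (bracket X B) x = 0.
Proof.
move=> LA LB; rewrite -(parallel_killing _ PX LX.1 LA.1 LB.1).
exact: vapp_linv_inner.
Qed.

Lemma linv_perp A B x : linv A -> linv B -> minner g X (bracket A B) x = 0.
Proof.
move=> LA LB; rewrite (parallel_perp fV gG hg _ PX LX.1 LA.1 LB.1).
by rewrite !vapp_linv_inner // subrr.
Qed.

Lemma linv_minner_eq0 A : linv A -> minner g A A one = 0 -> A = vzero G.
Proof.
move=> LA A0; apply: (linv_eq hG LA (@linv_zero _ _ G mul)).
have [//|An0] := pselect (A one = (fun _ => 0)).
have := riem_pos hg (linv_tangent hG LA) An0.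
by rewrite -/(minner g A A one) A0 ltxx.
Qed.

Context {e : 'I_3 -> vfield G} (Le : forall i, linv (e i)).
Hypothesis orthe : forall i j x, g x (e i x) (e j x) = (i == j)%:R.
Hypothesis spane : forall x v, tangent x v -> exists a : 'I_3 -> R,
  v = fun f => \sum_i a i * e i x f.

Let te i x : tangent x (e i x). Proof. exact: (vfield_tangent gG x (Le i).1). Qed.

Lemma linv_expand A : linv A ->
  A = fun x f => \sum_k minner g A (e k) one * e k x f.
Proof.
move=> LA; apply: (linv_eq hG LA).
  exact: (linv_sum hG (fun k => minner g A (e k) one) Le).
have [a Ea] := spane (linv_tangent hG LA).
rewrite Ea; apply/funext => f; apply: eq_bigr => k _; congr (_ * _).
rewrite /minner Ea (metric_suml fV gG hg) // (bigD1 k) //= orthe eqxx mulr1.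
by rewrite big1 ?addr0 // => i ik; rewrite orthe (negbTE ik) mulr0.
Qed.

Definition structc i j k : R := minner g (bracket (e i) (e j)) (e k) one.

Lemma bracket_structc i j :
  bracket (e i) (e j) = fun x f => \sum_k structc i j k * e k x f.
Proof. by rewrite {1}(linv_expand (linv_bracket fV hG (Le i) (Le j))). Qed.

Lemma structc_anti i j k : structc i j k = - structc j i k.
Proof.
rewrite /structc bracket_anti minner_scalel ?mulN1r //.
  exact: (bracket_vfield fV gG (Le j).1 (Le i).1).
exact: (Le k).1.
Qed.

Context {r : R} (r0 : r <> 0) (Xe : X = vscale r (e ord0)).

Lemma structc_perp i j : structc i j ord0 = 0.
Proof.
have LB := linv_bracket fV hG (Le i) (Le j).
have := linv_perp one (Le i) (Le j); rewrite Xe minner_scalel //; last exact: LB.1.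
  move=> /eqP; rewrite mulf_eq0 => /orP[/eqP//|/eqP E].
  by rewrite /structc (minner_sym gG hg) //; [exact: LB.1|exact: (Le _).1].
exact: (Le _).1.
Qed.

Lemma structc_central j k : central mul X -> structc ord0 j k = 0.
Proof.
move=> /(_ _ (Le j)); rewrite Xe (bracket_scalel fV gG); [|exact: (Le _).1..].
move=> E; have LB := linv_bracket fV hG (Le ord0) (Le j).
have : minner g (vscale r (bracket (e ord0) (e j))) (e k) one = 0.
  by rewrite E minner_zerol //; exact: (Le _).1.
rewrite minner_scalel //; [|exact: LB.1|exact: (Le _).1].
by move=> /eqP; rewrite mulf_eq0 => /orP[/eqP//|/eqP].
Qed.

Local Notation TG := (tangent_bundle G).
Let fVV : findim ('rV[R]_3 * 'rV[R]_3)%type := findim_prod fV fV.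
Let gTG : good_atlas TG := tangent_bundle_good fV gG.
Context {gt : metric TG} (hgt : is_lifted_metric mul g gt).

(** Skewness is tested on [Y^c] and [[X, Y]^v]. These are orthogonal and [[X^v, [X, Y]^v] = 0], so
    what remains is the squared norm of [[X, Y]]. *)
Lemma lift_central : is_parallel gt (vertical_lift X) -> central mul X.
Proof.
move=> PT Y LY; have LZ := linv_bracket fV hG LX LY.
apply: (linv_minner_eq0 LZ).
have t0 := tangent0 gG one.
(* The zero vector at the identity: some point of TG over [one], where the norm is evaluated. *)
pose p : TG := exist (fun p : G * tfun G => `[< tangent p.1 p.2 >])
  (one, fun _ => 0) (asboolT t0).
have hgt' := lifted_riemannian hgt.
have cY := clift_complete fV gG LY.1.
have vX := vertical_lift_vfield fV gG LX.1.
have vZ := vertical_lift_vfield fV gG LZ.1.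
have vcY := clift_vfield fV gG LY.1.
have := parallel_killing p PT vX vcY vZ.
have -> : minner gt (clift Y) (vertical_lift (bracket X Y)) = fun _ => 0.
  by apply/funext => q; exact: (lifted_cv hgt q LY LZ cY).
rewrite /vapp (tangent_cst fVV gTG _ (vfield_tangent gTG p vX)).
rewrite (bracket_vc fV gG LX.1 LY.1) (bracket_vv fV gG LX.1 LZ.1).
rewrite (lifted_vv hgt p LZ LZ) (minner_sym gTG hgt' vcY (@vfield_zero _ _ TG)).
rewrite {2}/minner (metric0l gTG hgt') ?addr0 => [<- //|].
exact: (vfield_tangent gTG p vcY).
Qed.

Definition lift_frame (i : 'I_(3 + 3)) : vfield TG :=
  match fintype.split i with
  | inl j => clift (e j)
  | inr j => vertical_lift (e j) end.

(** Complete lifts bracket to complete lifts, mixed pairs to vertical lifts, and vertical pairs to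
    0, always with the constants of [e]. *)
Definition lift_structc (i j k : 'I_(3 + 3)) : R :=
  match fintype.split i, fintype.split j, fintype.split k with
  | inl a, inl b, inl c | inl a, inr b, inr c | inr a, inl b, inr c => structc a b c
  | _, _, _ => 0 end.

Let frame_l j : lift_frame (lshift 3 j) = clift (e j).
Proof. by rewrite /lift_frame (unsplitK (inl j)). Qed.

Let frame_r j : lift_frame (rshift 3 j) = vertical_lift (e j).
Proof. by rewrite /lift_frame (unsplitK (inr j)). Qed.

Let split_l (j : 'I_3) : fintype.split (lshift 3 j) = inl j.
Proof. exact: (unsplitK (inl j)). Qed.

Let split_r (j : 'I_3) : fintype.split (rshift 3 j) = inr j.
Proof. exact: (unsplitK (inr j)). Qed.

Let sc := (split_l, split_r).

Let ve i : is_vfield (e i). Proof. exact: (Le i).1. Qed.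

Let frame_vfield i : is_vfield (lift_frame i).
Proof.
rewrite /lift_frame; case: fintype.split => j.
  exact: (clift_vfield fV gG).
exact: (vertical_lift_vfield fV gG).
Qed.

Let frame_orth i j p : gt p (lift_frame i p) (lift_frame j p) = (i == j)%:R.
Proof.
have hgt' := lifted_riemannian hgt.
have cY a := clift_complete fV gG (ve a).
rewrite -/(minner gt (lift_frame i) (lift_frame j) p).
case: (split_ordP i) => a ->; case: (split_ordP j) => b ->; rewrite ?frame_l ?frame_r.
- by rewrite (lifted_cc hgt p (Le a) (Le b) (cY a) (cY b)) eq_lshift /minner orthe.
- by rewrite (lifted_cv hgt p (Le a) (Le b) (cY a)) eq_lrshift.
- rewrite (minner_sym gTG hgt').
  + by rewrite (lifted_cv hgt p (Le b) (Le a) (cY b)) eq_rlshift.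
  + exact: (vertical_lift_vfield fV gG).
  + exact: (clift_vfield fV gG).
- by rewrite (lifted_vv hgt p (Le a) (Le b)) eq_rshift /minner orthe.
Qed.

Let frame_span p v : tangent p v -> exists a : 'I_(3 + 3) -> R,
  v = fun f => \sum_i a i * lift_frame i p f.
Proof.
move=> /(lift_span fV gG ve spane)[a [b ->]].
exists (fun i => match fintype.split i with inl j => a j | inr j => b j end).
apply/funext => f; rewrite big_split_ord /=; congr (_ + _).
  by apply: eq_bigr => i _; rewrite split_l frame_l.
by apply: eq_bigr => i _; rewrite split_r frame_r.
Qed.

Let frame_bracket i j p f : bracket (lift_frame i) (lift_frame j) p f =
  \sum_k lift_structc i j k * lift_frame k p f.
Proof.
rewrite big_split_ord /=.
under eq_bigr => k _ do rewrite frame_l.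
under [X in _ + X]eq_bigr => k _ do rewrite frame_r.
rewrite /lift_structc.
case: (split_ordP i) => a ->; case: (split_ordP j) => b ->; rewrite ?frame_l ?frame_r.
- rewrite (bracket_cc fV gG) // bracket_structc (clift_sum fV gG) //.
  rewrite [X in _ = _ + X]big1 ?addr0; last by move=> k _; rewrite !sc mul0r.
  by apply: eq_bigr => k _; rewrite !sc.
- rewrite bracket_anti (bracket_vc fV gG) // bracket_structc (vertical_lift_sum fV gG) //.
  rewrite [X in _ = X + _]big1 ?add0r; last by move=> k _; rewrite !sc mul0r.
  rewrite /vscale /vmul mulr_sumr; apply: eq_bigr => k _; rewrite !sc.
  by rewrite (structc_anti a b) mulN1r mulNr.
- rewrite (bracket_vc fV gG) // bracket_structc (vertical_lift_sum fV gG) //.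
  rewrite [X in _ = X + _]big1 ?add0r; last by move=> k _; rewrite !sc mul0r.
  by apply: eq_bigr => k _; rewrite !sc.
- rewrite (bracket_vv fV gG) // big1 => [|k _]; last by rewrite ?sc mul0r.
  by rewrite big1 ?addr0 // => k _; rewrite ?sc mul0r.
Qed.

Let frame_anti i j k : lift_structc i j k = - lift_structc j i k.
Proof.
rewrite /lift_structc.
by case: (split_ordP i) => a _; case: (split_ordP j) => b _;
  case: (split_ordP k) => c _; rewrite ?oppr0 //; exact: structc_anti.
Qed.

Lemma central_lift : central mul X -> is_parallel gt (vertical_lift X).
Proof.
move=> CX.
(* The lift of [X = r e_0] has the single coefficient [r], at the vertical copy of index 0. *)
pose a (j : 'I_(3 + 3)) : R := if j == rshift 3 ord0 then r else 0.
apply: (frame_parallel fVV gTG (lifted_riemannian hgt) frame_vfield frame_orth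
  frame_span frame_bracket frame_anti (a := a)).
  move=> p f; rewrite (bigD1 (rshift 3 ord0)) //= big1 => [|j nj]; last first.
    by rewrite /a (negbTE nj) mul0r.
  rewrite addr0 /a eqxx frame_r Xe.
  have -> : vscale r (e ord0) = fun x f => \sum_(i < 1) r * e ord0 x f.
    by apply/funext => x; apply/funext => h; rewrite big_ord1.
  by rewrite (vertical_lift_sum fV gG (fun=> r) (fun=> ve ord0)) // big_ord1.
move=> i k; rewrite (bigD1 (rshift 3 ord0)) //= big1 => [|j nj]; last first.
  by rewrite /a (negbTE nj) mul0r.
(* Two of the three structure constants in the Christoffel symbol have the lift of [e_0] as an
   argument and vanish by centrality; the third is a component along that lift and vanishes by
   [structc_perp]. *)
have z0 b c : structc ord0 b c = 0 by exact: structc_central.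
have z1 b c : structc b ord0 c = 0 by rewrite structc_anti z0 oppr0.
rewrite addr0 /christoffel /lift_structc.
case: (split_ordP i) => b _; case: (split_ordP k) => c _;
  by rewrite !sc ?z0 ?z1 ?structc_perp ?subr0 ?addr0 ?mul0r ?mulr0.
Qed.

End Central.

(** * Central parallel fields and the two Lie algebras *)

Section LieAlgebra.
Context {R : realType}.
Context {G : mfd 'rV[R]_3} {mul : G -> G -> G} {inv : G -> G} {one : G}.
Context (hG : is_lie_group mul inv one) (hsc : simply_connected G).
Context {g : metric G} (hg : is_riemannian g) (Lg : left_invariant_metric mul g).
Local Notation linv := (left_invariant_vfield mul).
Context {X : vfield G} (LX : linv X) (X0 : X <> vzero G) (PX : is_parallel g X).

Let fV : findim 'rV[R]_3 := findim_row 3.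
Let gG : good_atlas G := manifold_good (lie_mfd hG).

Let vf A : linv A -> is_vfield A. Proof. by case. Qed.

Lemma bracket_comb a b c W Y Z A : linv W -> linv Y -> linv Z -> linv A ->
  bracket (vadd (vscale a W) (vadd (vscale b Y) (vscale c Z))) A =
  fun x f => a * bracket W A x f + (b * bracket Y A x f + c * bracket Z A x f).
Proof.
move=> LW LY LZ LA.
have LaW := linv_scale fV hG a LW; have LbY := linv_scale fV hG b LY.
have LcZ := linv_scale fV hG c LZ; have LS := linv_add fV hG LbY LcZ.
by rewrite !(bracket_addl fV gG) ?(bracket_scalel fV gG) //; apply: vf.
Qed.

Lemma central_basis W Y Z : lie_algebra_basis mul W Y Z ->
  bracket X W = vzero G -> bracket X Y = vzero G -> bracket X Z = vzero G ->
  central mul X.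
Proof.
move=> [LW LY LZ _ S] EW EY EZ A LA; have [a [b [c Ec]]] := S A LA.
rewrite bracket_anti {1}Ec bracket_comb // (bracket_anti W) (bracket_anti Y).
rewrite (bracket_anti Z) EW EY EZ; apply/funext => x; apply/funext => f.
by rewrite /vscale /vmul /vzero !mulr0 !addr0 mulr0.
Qed.

Lemma central_case1 : lie_case1 mul -> central mul X.
Proof.
move=> [_ [W [Y [Z [H WY WZ YZ]]]]]; have [LW LY LZ _ S] := H.
have [a [b [c Ec]]] := S X LX.
have B A : linv A -> bracket W A = vzero G -> bracket Y A = vzero G ->
    bracket Z A = vzero G -> bracket X A = vzero G.
  move=> LA E1 E2 E3; rewrite {1}Ec bracket_comb // E1 E2 E3.
  by apply/funext => x; apply/funext => f; rewrite /vzero !mulr0 !addr0.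
have z0 : vscale (-1) (vzero G) = vzero G.
  by apply/funext => x; apply/funext => f; rewrite /vscale /vmul /vzero mulr0.
apply: (central_basis H); apply: B => //; rewrite ?bracket_self //.
- by rewrite bracket_anti WY.
- by rewrite bracket_anti WZ.
- by rewrite bracket_anti YZ.
Qed.

Lemma central_case2 : lie_case2 mul -> central mul X.
Proof.
move=> [_ [W [Y [Z [H WY WZ YZ]]]]]; have [LW LY LZ Fr S] := H.
have [a [b [c Ec]]] := S X LX.
have Y0 : Y <> vzero G.
  move=> Y0; have [|_ /eqP] := Fr 0 1 0; last by rewrite oner_eq0.
  apply/funext => x; apply/funext => f.
  by rewrite /vadd /vscale /vmul Y0 /vzero !mul0r mulr0 !addr0.
have YY : minner g Y Y one != 0.
  by apply/eqP => /(linv_minner_eq0 hG hg LY).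
have E A : linv A -> bracket X A =
    fun x f => a * bracket W A x f + (b * bracket Y A x f + c * bracket Z A x f).
  by move=> LA; rewrite {1}Ec bracket_comb.
(* With [[X, Y] = 2 c Y], skewness on the pair [Y], [Y] forces [c = 0]. *)
have XY : bracket X Y = vscale (2 * c) Y.
  rewrite E // WY bracket_self (bracket_anti Z) YZ.
  by apply/funext => x; apply/funext => f; rewrite /vscale /vmul /vzero; ring.
have c0 : c = 0.
  have := linv_killing hG Lg LX PX one LY LY.
  rewrite XY (minner_scalel hG hg) ?(minner_scaler hG hg) //; try exact: vf.
  have := YY; set y := minner g Y Y one => y0 K.
  have : c * y = 0 by lra.
  by move=> /eqP; rewrite mulf_eq0 (negbTE y0) orbF => /eqP.
have XY0 : bracket X Y = vzero G.
  rewrite XY c0; apply/funext => x; apply/funext => f.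
  by rewrite /vscale /vmul /vzero mulr0 mul0r.
have XZ : bracket X Z = vscale (- (a + 2 * b)) Y.
  rewrite E // WZ YZ bracket_self.
  by apply/funext => x; apply/funext => f; rewrite /vscale /vmul /vzero; ring.
(* Skewness on [Z], [Y]: since [[X, Y] = 0], the field [[X, Z]] is orthogonal to [Y], of which it is
   a multiple. *)
have ab : a + 2 * b = 0.
  have := linv_killing hG Lg LX PX one LZ LY.
  rewrite XY0 XZ (minner_scalel hG hg) //; try exact: vf.
  have -> : minner g Z (vzero G) one = 0.
    rewrite (minner_sym gG hg (vf LZ) (@vfield_zero _ _ G)).
    exact: (minner_zerol hG hg _ (vf LZ)).
  rewrite addr0 => /eqP; rewrite mulf_eq0 (negbTE YY) orbF oppr_eq0.
  by move/eqP.
apply: (central_basis H) => //.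
- rewrite E // bracket_self (bracket_anti Y) WY c0.
  by apply/funext => x; apply/funext => f; rewrite /vscale /vmul /vzero; ring.
- rewrite XZ ab; apply/funext => x; apply/funext => f.
  by rewrite /vscale /vmul /vzero oppr0 mul0r.
Qed.

(** The Lie algebra is a central line plus a nonabelian plane spanned by [A] and [B]. The hypotheses
    are phrased so that [A] and [B] can be exchanged. *)
Lemma case2_of_bracket E A B (r beta gamma : R) : linv E -> linv A -> linv B ->
  (forall a b c, (forall x f, a * E x f + (b * A x f + c * B x f) = 0) ->
     [/\ a = 0, b = 0 & c = 0]) ->
  (forall Y, linv Y -> exists a b c, forall x f,
     Y x f = a * E x f + (b * A x f + c * B x f)) ->
  r != 0 -> X = vscale r E -> central mul X -> beta != 0 ->
  bracket A B = vadd (vscale beta A) (vscale gamma B) -> lie_case2 mul.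
Proof.
move=> LE LA LB Fr S r0 XE CX b0 AB; split=> //.
(* [[Y, B] = beta Y], so scaling [B] by [- 2 / beta] gives [[Y, Z] = -2 Y]. In the target algebra
   [W - Y / 2] is central, hence [W] is the central field plus [Y / 2]. *)
pose Y := bracket A B; pose Z := vscale (- (2 / beta)) B.
pose W := vadd X (vscale (2^-1) Y).
have LY : linv Y by exact: (linv_bracket fV hG).
have LZ : linv Z by exact: (linv_scale fV hG).
have LY2 : linv (vscale (2^-1) Y) by exact: (linv_scale fV hG).
have LW : linv W by exact: (linv_add fV hG).
have YB : bracket Y B = vscale beta Y.
  have LbA := linv_scale fV hG beta LA; have LgB := linv_scale fV hG gamma LB.
  rewrite {1}/Y AB (bracket_addl fV gG) ?(bracket_scalel fV gG) //; try exact: vf.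
  rewrite bracket_self; apply/funext => x; apply/funext => f.
  by rewrite /vadd /vscale /vmul /vzero mulr0 addr0.
have YZ : bracket Y Z = vscale (-2) Y.
  rewrite /Z (bracket_scaler fV gG) ?YB //; try exact: vf.
  apply/funext => x; apply/funext => f; rewrite /vscale /vmul.
  by field.
exists W, Y, Z; split=> //.
- split=> //.
  + move=> p q s H.
    have [|h1 h2 h3] := Fr (p * r) ((p / 2 + q) * beta)
        ((p / 2 + q) * gamma - s * (2 / beta)).
      move=> x f; have := congr1 (fun H : vfield G => H x f) H.
      rewrite /W /Z /Y AB XE /vadd /vscale /vmul /vzero => <-; field.
      exact: b0.
    have p0 : p = 0.
      by move/eqP: h1; rewrite mulf_eq0 (negbTE r0) orbF => /eqP.
    have q0 : q = 0.
      move/eqP: h2; rewrite mulf_eq0 (negbTE b0) orbF => /eqP.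
      by rewrite p0 mul0r add0r.
    split=> //; move: h3; rewrite p0 q0 mul0r addr0 mul0r add0r => /eqP.
    rewrite oppr_eq0 !mulf_eq0 invr_eq0 (negbTE b0) orbF pnatr_eq0 orbF.
    by move/eqP.
  + move=> H /S[a [b [c Hc]]].
    (* Coordinates from [E = (W - Y / 2) / r], [B = - (beta / 2) Z] and
       [A = (Y - gamma B) / beta]. *)
    exists (a / r), (b / beta - a / r / 2), ((gamma * b / beta - c) * beta / 2).
    apply/funext => x; apply/funext => f.
    rewrite Hc /W /Z /Y AB XE /vadd /vscale /vmul; field.
    by rewrite r0 b0.
- rewrite /W (bracket_addl fV gG) ?(bracket_scalel fV gG) //; try exact: vf.
  rewrite CX // bracket_self; apply/funext => x; apply/funext => f.
  by rewrite /vadd /vscale /vmul /vzero mulr0 addr0.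
- rewrite /W (bracket_addl fV gG) ?(bracket_scalel fV gG) //; try exact: vf.
  rewrite CX // YZ; apply/funext => x; apply/funext => f.
  by rewrite /vadd /vscale /vmul /vzero; field.
Qed.

Lemma central_cases : central mul X -> lie_case1 mul \/ lie_case2 mul.
Proof.
move=> CX; have [e [r [Le orthe spane r0 Xe]]] := orthonormal_frame hG hg Lg LX X0.
pose i1 : 'I_3 := lift ord0 ord0; pose i2 : 'I_3 := lift ord0 (lift ord0 ord0).
have rn : r != 0 by exact/eqP.
have te i x : tangent x (e i x) by exact: (vfield_tangent gG x (Le i).1).
have S3 (F : 'I_3 -> R) : \sum_i F i = F ord0 + (F i1 + F i2).
  by rewrite !big_ord_recl big_ord0 addr0.
have Fr a b c : (forall x f, a * e ord0 x f + (b * e i1 x f + c * e i2 x f) = 0) ->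
     [/\ a = 0, b = 0 & c = 0].
  move=> H; pose h (i : 'I_3) : R := nth 0 [:: a; b; c] i.
  have Hh i : h i = 0.
    have := metric_suml fV gG hg h (fun i => te i one) (te i one).
    rewrite (_ : (fun f => _) = (fun _ => 0)); last first.
      by apply/funext => f; rewrite S3; exact: H.
    rewrite (metric0l gG hg) // (bigD1 i) //= orthe eqxx mulr1 big1 ?addr0 //.
    by move=> j ji; rewrite orthe (negbTE ji) mulr0.
  by split; [exact: (Hh ord0)|exact: (Hh i1)|exact: (Hh i2)].
have S Y : linv Y -> exists a b c, forall x f,
     Y x f = a * e ord0 x f + (b * e i1 x f + c * e i2 x f).
  move=> LY; exists (minner g Y (e ord0) one), (minner g Y (e i1) one),
    (minner g Y (e i2) one) => x f.
  by rewrite {1}(linv_expand hG hg Le orthe spane LY) S3.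
pose s := structc (one := one) (g := g) (e := e).
have B i j : bracket (e i) (e j) = vadd (vscale (s i j i1) (e i1)) (vscale (s i j i2) (e i2)).
  rewrite (bracket_structc hG hg Le orthe spane).
  apply/funext => x; apply/funext => f; rewrite S3.
  by rewrite (structc_perp hG hg Lg LX PX Le r0 Xe) mul0r add0r.
have B0 j : bracket (e ord0) (e j) = vzero G.
  rewrite (bracket_structc hG hg Le orthe spane).
  apply/funext => x; apply/funext => f; apply: big1 => k _.
  by rewrite (structc_central hG hg Le r0 Xe) // mul0r.
have anti i j k : s i j k = - s j i k by exact: (structc_anti hG hg Le).
have [b0|b0] := eqVneq (s i1 i2 i1) 0; last first.
  right; exact: (case2_of_bracket (Le ord0) (Le i1) (Le i2) Fr S rn Xe CX b0 (B _ _)).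
(* If only the second coefficient of [[e_1, e_2]] is nonzero, the roles of [e_1] and [e_2] are
   exchanged; if both vanish the algebra is abelian. *)
have [c0|c0] := eqVneq (s i1 i2 i2) 0; last first.
  right; apply: (case2_of_bracket (E := e ord0) (A := e i2) (B := e i1)
    (beta := s i2 i1 i2) (gamma := s i2 i1 i1)) rn Xe CX _ _ => //.
  - move=> a b c H; have [|-> -> ->] := Fr a c b; last by [].
    by move=> x f; rewrite -[RHS](H x f); congr (_ + _); rewrite addrC.
  - move=> Y /S[a [b [c Hc]]]; exists a, c, b => x f.
    by rewrite Hc; congr (_ + _); rewrite addrC.
  - by rewrite anti oppr_eq0.
  - rewrite B; apply/funext => x; apply/funext => f; rewrite /vadd addrC //.
left; split=> //; exists (e ord0), (e i1), (e i2); split.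
- split=> //.
  + move=> a b c H; apply: Fr => x f.
    exact: (congr1 (fun H : vfield G => H x f) H).
  + move=> Y /S[a [b [c Hc]]]; exists a, b, c.
    by apply/funext => x; apply/funext => f; rewrite Hc.
- exact: B0.
- exact: B0.
- rewrite B b0 c0; apply/funext => x; apply/funext => f.
  by rewrite /vadd /vscale /vmul /vzero !mul0r addr0.
Qed.

End LieAlgebra.

Theorem theorem4p2 (R : realType) (G : mfd 'rV[R]_3)
    (mul : G -> G -> G) (inv : G -> G) (one : G)
    (hG : is_lie_group mul inv one) (hsc : simply_connected G)
    (F : G -> tfun G -> R) (g : metric G) (X : vfield G)
    (hF : left_invariant_randers_berwald mul F g X) (hX : X <> vzero G)
    (gt : metric (tangent_bundle G)) (hgt : is_lifted_metric mul g gt) :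
  left_invariant_randers_berwald (tangent_mul mul) (randers_v gt X) gt
    (vertical_lift X)
  <-> lie_case1 mul \/ lie_case2 mul.
Proof.
have [[hg HX nX _] Lg LX PX] := hF.
have fV := @findim_row R 3; have gG := manifold_good (lie_mfd hG).
split=> [[_ _ _ PT]|H].
  exact: (central_cases hG hsc hg Lg LX hX PX (lift_central hG hg LX hgt PT)).
have CX : central mul X.
  by case: H; [exact: (central_case1 hG)|exact: (central_case2 hG hg Lg LX PX)].
have [e [r [Le orthe spane r0 Xe]]] := orthonormal_frame hG hg Lg LX hX.
have LT := vertical_lift_linv fV hG LX.
split=> //; last 2 first.
- exact: lifted_left_invariant hgt.
- exact: (central_lift hG hg Lg LX PX Le orthe spane r0 Xe hgt).
split=> //; [exact: lifted_riemannian hgt|exact: LT.1|] => p.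
(* The norm of [X^v] at [p] equals that of [X] at the base point, so the bound below 1 is
   inherited. *)
rewrite -/(minner gt (vertical_lift X) (vertical_lift X) p) (lifted_vv hgt p LX LX).
exact: nX.
Qed.
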